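(* Let $d\ge1$, let $\Omega\subset\mathbb{R}^d$ be a bounded open set with $C^1$ boundary and outward unit normal $n(x)$, and let $T>0$. Assume that $H:[0,T]\times\overline\Omega\times\mathbb{R}^d\to\mathbb{R}$ satisfies conditions (H-i)–(H-iv) and that $F:[0,T]\times\partial\Omega\times\mathbb{R}^d\to\mathbb{R}$ satisfies conditions (F-i)–(F-iv), all listed in the context. Assume that $u_0:\overline\Omega\to\mathbb{R}$ is continuous. Let $u,v:[0,T)\times\overline\Omega\to\mathbb{R}$ be two functions with $u$ upper semi-continuous and $v$ lower semi-continuous. Assume that, in the viscosity sense, $$u_t+H(X,Du)\le 0 \ \text{ in } (0,T)\times\Omega,\qquad u_t+\min(F,H)(X,Du)\le 0\ \text{ on } (0,T)\times\partial\Omega,$$ $$v_t+H(X,Dv)\ge 0 \ \text{ in } (0,T)\times\Omega,\qquad v_t+\max(F,H)(X,Dv)\ge 0\ \text{ on } (0,T)\times\partial\Omega,$$ where $X=(t,x)$. Assume moreover that there exists a constant $C_T>0$ such that $$u(t,x)\le u_0(x)+C_T\quad\text{and}\quad v(t,x)\ge u_0(x)-C_T\quad\text{for all }(t,x)\in[0,T)\times\overline\Omega.$$ If $u(0,\cdot)\le u_0\le v(0,\cdot)$ on $\overline\Omega$, then $u\le v$ in $[0,T)\times\overline\Omega$.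
   Context: Notation: $X=(t,x)$; $Du$ is the gradient in $x$. Below $\omega$ and $\omega_L$ (for $L>0$) denote moduli of continuity, i.e. continuous nondecreasing functions $[0,+\infty)\to[0,+\infty)$ vanishing at $0$. Viscosity inequalities are understood with $C^1$ test functions: an upper semi-continuous $u$ is a subsolution if, whenever a $C^1$ function $\varphi$ on $(0,T)\times\overline\Omega$ touches $u$ from above at a point $X_0\in(0,T)\times\overline\Omega$ (locally, relative to $(0,T)\times\overline\Omega$), the stated inequality holds at $X_0$ with $(u_t,Du)$ replaced by $(\varphi_t,D\varphi)(X_0)$; supersolutions are defined similarly with touching from below and reversed inequalities. Conditions on $H$: (H-i) $H$ is continuous on $[0,T]\times\overline\Omega\times\mathbb{R}^d$. (H-ii) For any $L>0$, for all $X\in[0,T]\times\overline\Omega$ and $p,q\in[-L,L]^d$: $|H(X,p)-H(X,q)|\le\omega_L(|p-q|)$. (H-iii) For all $X,Y\in[0,T]\times\overline\Omega$ and $p\in\mathbb{R}^d$: $H(Y,p)-H(X,p)\le\omega\big(|Y-X|(1+\max\{0,H(X,p)\})\big)$. (H-iv) $\lim_{|p|\to+\infty}\inf_{X\in[0,T]\times\overline\Omega}H(X,p)=+\infty$. Conditions on $F$ (with $X=(t,x)$): (F-i) $F$ is continuous on $[0,T]\times\partial\Omega\times\mathbb{R}^d$ and the map $q\mapsto F(X,p-q\,n(x))$, $q\in\mathbb{R}$, is nonincreasing. (F-ii) For any $L>0$, for all $X\in[0,T]\times\partial\Omega$ and $p,q\in[-L,L]^d$: $|F(X,p)-F(X,q)|\le\omega_L(|p-q|)$.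 (F-iii) For all $X,Y\in[0,T]\times\partial\Omega$ and $p\in\mathbb{R}^d$: $F(Y,p)-F(X,p)\le\omega\big(|Y-X|(1+\max\{0,\max(F,H)(X,p)\})\big)$. (F-iv) For any $L>0$: $\lim_{q\to-\infty}\inf_{X\in[0,T]\times\partial\Omega,\ p\in[-L,L]^d}F(X,p-q\,n(x))=+\infty$. *)

(* Defs.v *)
From HB Require Import structures.
From mathcomp Require Import all_boot all_order all_algebra.
From mathcomp Require Import all_classical all_reals all_analysis.
Set Implicit Arguments.
Unset Strict Implicit.
Unset Printing Implicit Defensive.
Import Order.TTheory GRing.Theory Num.Theory.
Import numFieldNormedType.Exports.
Local Open Scope classical_set_scope.
Local Open Scope ring_scope.

(* The library norm on 'rV[R]_d and on products is the max norm (it induces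
   the same topology), so the Euclidean norms of R^d and of R x R^d are
   introduced here. *)
Definition enorm (R : realType) (d : nat) (x : 'rV[R]_d) : R :=
  Num.sqrt (\sum_(i < d) x 0 i ^+ 2).

Definition stnorm (R : realType) (d : nat) (X : R * 'rV[R]_d) : R :=
  Num.sqrt (X.1 ^+ 2 + \sum_(i < d) X.2 0 i ^+ 2).

Definition enorm_infty (R : realType) (d : nat) : set_system 'rV[R]_d :=
  [set A | \forall r \near +oo, forall p, r <= enorm p -> A p].

Definition cube (R : realType) (d : nat) (L : R) : set 'rV[R]_d :=
  [set p | forall i, `|p 0 i| <= L].

Definition boundary (T : topologicalType) (A : set T) : set T :=
  closure A `\` interior A.

(* Only the values on [0, +oo) are constrained. *)
Definition modulus (R : realType) (w : R -> R) : Prop :=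
  [/\ {within `[0, +oo[, continuous w},
      {in `[0, +oo[ &, {homo w : r s / r <= s}},
      (forall r : R, 0 <= r -> 0 <= w r) & w 0 = 0].

(* Semi-continuity relative to A: points outside A are isolated in subspace A,
   so they impose no condition. *)
Definition lsc_within (R : realType) (T : topologicalType) (A : set T)
    (f : T -> R) : Prop :=
  lower_semicontinuous (fun x : subspace A => (f x)%:E).

Definition usc_within (R : realType) (T : topologicalType) (A : set T)
    (f : T -> R) : Prop := lsc_within A (fun x => - f x).

(* In finite dimension, continuity of all directional derivatives is
   continuity of the differential. *)
Definition C1_on (R : realType) (V : normedModType R) (U : set V)
    (f : V -> R) : Prop :=
  forall x, U x ->
    differentiable f x /\ forall v : V, {for x, continuous ('D_v f)}.

Definition grad (R : realType) (d : nat) (f : 'rV[R]_d -> R) (x : 'rV[R]_d) :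
  'rV[R]_d := \row_(i < d) 'D_(delta_mx 0 i) f x.

Definition dt (R : realType) (d : nat) (f : R * 'rV[R]_d -> R)
  (X : R * 'rV[R]_d) : R := 'D_(1, 0) f X.

Definition Dx (R : realType) (d : nat) (f : R * 'rV[R]_d -> R)
  (X : R * 'rV[R]_d) : 'rV[R]_d := \row_(i < d) 'D_(0, delta_mx 0 i) f X.

(* rho is a C^1 local defining function of Omega near the boundary point x.
   The points of U where rho vanishes are then exactly those of the boundary. *)
Definition local_defining (R : realType) (d : nat) (Omega : set 'rV[R]_d)
    (x : 'rV[R]_d) (U : set 'rV[R]_d) (rho : 'rV[R]_d -> R) : Prop :=
  [/\ open U, U x, C1_on U rho, (forall y, U y -> grad rho y != 0) &
      Omega `&` U = [set y | rho y < 0] `&` U].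

Definition C1_boundary (R : realType) (d : nat) (Omega : set 'rV[R]_d) : Prop :=
  forall x, boundary Omega x ->
    exists (U : set 'rV[R]_d) (rho : 'rV[R]_d -> R),
      local_defining Omega x U rho.

Definition outward_unit_normal (R : realType) (d : nat) (Omega : set 'rV[R]_d)
    (x nu : 'rV[R]_d) : Prop :=
  exists (U : set 'rV[R]_d) (rho : 'rV[R]_d -> R),
    local_defining Omega x U rho /\
    nu = (enorm (grad rho x))^-1 *: grad rho x.

Definition Qcl (R : realType) (d : nat) (T : R) (Omega : set 'rV[R]_d) :
  set (R * 'rV[R]_d) := `[0, T] `*` closure Omega.

Definition Qlat (R : realType) (d : nat) (T : R) (Omega : set 'rV[R]_d) :
  set (R * 'rV[R]_d) := `[0, T] `*` boundary Omega.

Definition Q0 (R : realType) (d : nat) (T : R) (Omega : set 'rV[R]_d) :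
  set (R * 'rV[R]_d) := `[0, T[ `*` closure Omega.

Definition Qopen (R : realType) (d : nat) (T : R) (Omega : set 'rV[R]_d) :
  set (R * 'rV[R]_d) := `]0, T[ `*` closure Omega.

(* C^1 on a set that need not be open: restriction of a function which is C^1
   on some open neighbourhood of the set. *)
Definition test_function (R : realType) (d : nat) (T : R)
    (Omega : set 'rV[R]_d) (phi : R * 'rV[R]_d -> R) : Prop :=
  exists U : set (R * 'rV[R]_d),
    [/\ open U, Qopen T Omega `<=` U & C1_on U phi].

Definition touches_from_above (R : realType) (T : topologicalType) (A : set T)
    (phi u : T -> R) (X : T) : Prop :=
  phi X = u X /\ \forall Y \near within A (nbhs X), u Y <= phi Y.

Definition touches_from_below (R : realType) (T : topologicalType) (A : set T)
    (phi u : T -> R) (X : T) : Prop :=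
  phi X = u X /\ \forall Y \near within A (nbhs X), phi Y <= u Y.

(* H is the Hamiltonian imposed inside Omega, G the one imposed on its
   boundary. *)
Definition viscosity_subsolution (R : realType) (d : nat) (T : R)
    (Omega : set 'rV[R]_d) (H G : R * 'rV[R]_d -> 'rV[R]_d -> R)
    (w : R * 'rV[R]_d -> R) : Prop :=
  forall (phi : R * 'rV[R]_d -> R) (X : R * 'rV[R]_d),
    test_function T Omega phi -> Qopen T Omega X ->
    touches_from_above (Qopen T Omega) phi w X ->
    (Omega X.2 -> dt phi X + H X (Dx phi X) <= 0) /\
    (boundary Omega X.2 -> dt phi X + G X (Dx phi X) <= 0).

Definition viscosity_supersolution (R : realType) (d : nat) (T : R)
    (Omega : set 'rV[R]_d) (H G : R * 'rV[R]_d -> 'rV[R]_d -> R)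
    (w : R * 'rV[R]_d -> R) : Prop :=
  forall (phi : R * 'rV[R]_d -> R) (X : R * 'rV[R]_d),
    test_function T Omega phi -> Qopen T Omega X ->
    touches_from_below (Qopen T Omega) phi w X ->
    (Omega X.2 -> 0 <= dt phi X + H X (Dx phi X)) /\
    (boundary Omega X.2 -> 0 <= dt phi X + G X (Dx phi X)).

Definition maxH (R : realType) (d : nat)
    (F H : R * 'rV[R]_d -> 'rV[R]_d -> R) : R * 'rV[R]_d -> 'rV[R]_d -> R :=
  fun X p => Num.max (F X p) (H X p).

Definition minH (R : realType) (d : nat)
    (F H : R * 'rV[R]_d -> 'rV[R]_d -> R) : R * 'rV[R]_d -> 'rV[R]_d -> R :=
  fun X p => Num.min (F X p) (H X p).

(* H and F are total functions; only their values at points X of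
   [0, T] x closure Omega, resp. [0, T] x boundary Omega, are constrained. *)
Definition H_i (R : realType) (d : nat) (T : R) (Omega : set 'rV[R]_d)
    (H : R * 'rV[R]_d -> 'rV[R]_d -> R) : Prop :=
  {within Qcl T Omega `*` setT,
    continuous (fun Z : (R * 'rV[R]_d) * 'rV[R]_d => H Z.1 Z.2)}.

Definition H_ii (R : realType) (d : nat) (T : R) (Omega : set 'rV[R]_d)
    (omegaL : R -> R -> R) (H : R * 'rV[R]_d -> 'rV[R]_d -> R) : Prop :=
  forall (L : R), 0 < L ->
  forall (X : R * 'rV[R]_d) (p q : 'rV[R]_d),
    Qcl T Omega X -> cube L p -> cube L q ->
    `|H X p - H X q| <= omegaL L (enorm (p - q)).

Definition H_iii (R : realType) (d : nat) (T : R) (Omega : set 'rV[R]_d)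
    (omega : R -> R) (H : R * 'rV[R]_d -> 'rV[R]_d -> R) : Prop :=
  forall (X Y : R * 'rV[R]_d) (p : 'rV[R]_d),
    Qcl T Omega X -> Qcl T Omega Y ->
    H Y p - H X p <= omega (stnorm (Y - X) * (1 + Num.max 0 (H X p))).

Definition H_iv (R : realType) (d : nat) (T : R) (Omega : set 'rV[R]_d)
    (H : R * 'rV[R]_d -> 'rV[R]_d -> R) : Prop :=
  ereal_inf [set (H X p)%:E | X in Qcl T Omega] @[p --> @enorm_infty R d]
    --> +oo%E.

Definition F_i (R : realType) (d : nat) (T : R) (Omega : set 'rV[R]_d)
    (n : 'rV[R]_d -> 'rV[R]_d) (F : R * 'rV[R]_d -> 'rV[R]_d -> R) : Prop :=
  {within Qlat T Omega `*` setT,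
    continuous (fun Z : (R * 'rV[R]_d) * 'rV[R]_d => F Z.1 Z.2)} /\
  forall (X : R * 'rV[R]_d) (p : 'rV[R]_d), Qlat T Omega X ->
    {homo (fun q : R => F X (p - q *: n X.2)) : q r / q <= r >-> r <= q}.

Definition F_ii (R : realType) (d : nat) (T : R) (Omega : set 'rV[R]_d)
    (omegaL : R -> R -> R) (F : R * 'rV[R]_d -> 'rV[R]_d -> R) : Prop :=
  forall (L : R), 0 < L ->
  forall (X : R * 'rV[R]_d) (p q : 'rV[R]_d),
    Qlat T Omega X -> cube L p -> cube L q ->
    `|F X p - F X q| <= omegaL L (enorm (p - q)).

Definition F_iii (R : realType) (d : nat) (T : R) (Omega : set 'rV[R]_d)
    (omega : R -> R) (H F : R * 'rV[R]_d -> 'rV[R]_d -> R) : Prop :=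
  forall (X Y : R * 'rV[R]_d) (p : 'rV[R]_d),
    Qlat T Omega X -> Qlat T Omega Y ->
    F Y p - F X p <= omega (stnorm (Y - X) * (1 + Num.max 0 (maxH F H X p))).

Definition F_iv (R : realType) (d : nat) (T : R) (Omega : set 'rV[R]_d)
    (n : 'rV[R]_d -> 'rV[R]_d) (F : R * 'rV[R]_d -> 'rV[R]_d -> R) : Prop :=
  forall (L : R), 0 < L ->
  ereal_inf [set (F Xp.1 (Xp.2 - q *: n Xp.1.2))%:E
            | Xp in Qlat T Omega `*` cube L] @[q --> -oo%R] --> +oo%E.

(* Main.v *)
Require Import Defs.
From HB Require Import structures.
From mathcomp Require Import all_boot all_order all_algebra.
From mathcomp Require Import all_classical all_reals all_analysis.
From mathcomp Require Import ring lra.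
Import Order.TTheory GRing.Theory Num.Theory.
Import numFieldNormedType.Exports.
Local Open Scope classical_set_scope.
Local Open Scope ring_scope.

(* If u > v somewhere, double the time variable with the penalisation
   N (t - s)^2; condition (H-iii) makes the error at a maximum point small for
   large N. With N fixed, double the space variable near the maximum point, but
   only among pairs (x, y) lying on the same level set of a local defining
   function rho, with the penalisation K |x - y|^2. At a maximum point (P, Q)
   the parallelogram inequality decouples the two variables: u minus a quadratic
   and v minus a quadratic are compared level by level, i.e. as functions of the
   single variable -rho, and both vanish at (P, Q). In the interior a further
   doubling in -rho gives a common slope. At the boundary, looking at all the
   slopes q for which u minus its quadratic is below -q rho, or v minus its
   quadratic above it, gives a slope q for which either both inequalities hold
   for H, or both hold for F (with the inequality of H for u). Since P and Q are
   on the same level set, P - Q is almost tangential, so coercivity of H bounds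
   K |P - Q| and q separately, uniformly in K; letting K tend to infinity
   contradicts (H-ii), (H-iii), (F-ii) and (F-iii). *)

(** * Upper semi-continuous functions on compact sets *)

(** Doubled points raise two difficulties. One of them may be on the boundary while the other is
    inside, so that different operators meet; and the gradients contain 2 K (x - y), which is not
    bounded a priori, while the moduli of (H-ii) and (F-ii) depend on the size of the gradients. The
    constraint to one level set removes the first: both points are inside or both are on the
    boundary. Its price is a normal slope q that plays the role of a Lagrange multiplier and has to
    be found. Coercivity removes the second: its bounds do not involve K, so the neighbourhood on
    which the operators are compared is fixed before K. The inequality of H for u accompanies the
    pair of inequalities for F because (F-iii) measures the variation of F by max(F, H). The
    function - v is handled as a subsolution for reflected operators, so that each one-sided lemma
    serves u and v; coercivity is used on the side of u. *)

Section CompactMaximization.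
Context {R : realType} {E : topologicalType}.
Implicit Types (D Z V : set E) (f g : E -> R).

Definition usc_on D f := forall x, D x -> forall c, f x < c ->
  \forall y \near x, D y -> f y < c.

Lemma usc_on_sub D Z f : Z `<=` D -> usc_on D f -> usc_on Z f.
Proof.
move=> ZD uf x /ZD Dx c fc; apply: filterS (uf _ Dx _ fc) => y h /ZD; exact: h.
Qed.

Lemma pointwise_usc_on D f : (forall x, D x -> {for x, continuous f}) ->
  usc_on D f.
Proof.
move=> cf x Dx c fc; have /cvgr_lt/(_ _ fc) := cf x Dx.
by apply: filterS => y + _.
Qed.

Lemma continuous_usc_on D f : continuous f -> usc_on D f.
Proof. by move=> cf; apply: pointwise_usc_on => x _; exact: cf. Qed.

Lemma usc_onD D f g : usc_on D f -> usc_on D g -> usc_on D (fun x => f x + g x).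
Proof.
move=> uf ug x Dx c fgc.
have e0 : 0 < (c - (f x + g x)) / 2 by rewrite divr_gt0 ?subr_gt0.
have fe : f x < f x + (c - (f x + g x)) / 2 by rewrite ltrDl ?ltr01.
have ge : g x < g x + (c - (f x + g x)) / 2 by rewrite ltrDl ?ltr01.
apply: filterS2 (uf x Dx _ fe) (ug x Dx _ ge) => y fy gy Dy.
have := fy Dy; have := gy Dy; lra.
Qed.

(** Compactness enters as near-covering: a property of (z, s) that holds for z near each point of Z
    and s near a limit holds, for s near that limit, at all z of Z at once. Here s is the bound C,
    tending to +oo. *)
Lemma usc_on_bounded Z f : compact Z -> usc_on Z f ->
  exists C, forall z, Z z -> f z < C.
Proof.
move=> /compact_near_coveringP/near_covering_withinP cZ uf.
have : \forall C \near +oo, Z `<=` (fun z => f z < C).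
  apply: cZ => x Zx.
  have fx1 : f x < f x + 1 by rewrite ltrDl ?ltr01.
  exists ([set y | Z y -> f y < f x + 1], [set C | f x + 1 < C]).
    by split; [exact: uf|apply: nbhs_pinfty_gt; rewrite num_real].
  by move=> [y C] /= [h1 h2] /h1/lt_trans; exact.
move=> [C [_ hC]]; exists (C + 1) => z Zz.
by apply: (hC (C + 1)) => //; rewrite ltrDl.
Qed.

(** If the supremum M is not attained, each x has a neighbourhood where f stays below the midpoint
    of f x and M; near-covering with c tending to M from below then bounds f on Z by some c < M. *)
Lemma usc_on_max Z f : compact Z -> Z !=set0 -> usc_on Z f ->
  exists2 z, Z z & forall y, Z y -> f y <= f z.
Proof.
move=> cZ [z0 Zz0] uf; apply: contrapT => /forall2NP nomax.
have [C fC] := usc_on_bounded _ _ cZ uf.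
have hs : has_sup (f @` Z).
  split; first by exists (f z0), z0.
  by exists C => _ [z Zz <-]; exact/ltW/fC.
pose M := sup (f @` Z).
have fM z : Z z -> f z < M.
  move=> Zz; have [//|/existsNP[y /not_implyP[Zy /negP]]] := nomax z.
  rewrite -ltNge => /lt_le_trans; apply.
  by apply: sup_upper_bound => //; exists y.
have : \forall c \near M^'-, Z `<=` (fun z => f z < c).
  move: cZ => /compact_near_coveringP/near_covering_withinP; apply => x Zx.
  have fx : f x < (f x + M) / 2 by have := fM _ Zx; lra.
  exists ([set y | Z y -> f y < (f x + M) / 2], [set c | (f x + M) / 2 < c]).
    split; first exact: uf.
    by apply: nbhs_left_gt; have := fM _ Zx; lra.
  by move=> [y c] /= [h1 h2] /h1/lt_trans; exact.
move=> /filterI/(_ (nbhs_left_lt M)) /filter_ex[c [Zc cM]].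
have [_ [z Zz <-]] := sup_adherent (ltr0Sn R 0) hs.
have [_ [y Zy <-]] : exists2 e, (f @` Z) e & c < e.
  have e0 : 0 < M - c by rewrite subr_gt0.
  have [e fe] := sup_adherent e0 hs.
  by rewrite /M opprB addrC subrK => ?; exists e.
by rewrite ltNge (ltW (Zc _ Zy)).
Qed.

(** Around each x one of three things settles the claim for small dl: g x > 0, or f x < M, or V is a
    neighbourhood of x. Near-covering with dl tending to 0 from the right gives one dl for all. *)
Lemma compact_penalization Z f g M V : compact Z -> usc_on Z f ->
    continuous g -> (forall z, Z z -> 0 <= g z) ->
    (forall z, Z z -> g z = 0 -> M <= f z -> nbhs z V) ->
  exists2 dl, 0 < dl & forall z, Z z -> g z <= dl -> M - dl <= f z -> V z.
Proof.
move=> /compact_near_coveringP/near_covering_withinP cZ uf cg g0 hV.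
have : \forall dl \near (0:R)^'+,
    Z `<=` (fun z => g z <= dl -> M - dl <= f z -> V z).
  apply: cZ => x Zx.
  have [gx0|gx0] := eqVneq (g x) 0; last first.
    have gx : 0 < g x by rewrite lt_def gx0 g0.
    exists ([set y | g x / 2 < g y], [set dl | dl < g x / 2]).
      split; last by apply: nbhs_right_lt; lra.
      have h : g x / 2 < g x by lra.
      by have /cvgr_gt/(_ _ h) := cg x.
    by move=> [y dl] /= [h1 h2] _ h3; exfalso; lra.
  have [Mf|fM] := leP M (f x).
    exists (V, setT); first by split; [exact: hV|exact: filterT].
    by move=> [y dl] /= [].
  have fx : f x < (f x + M) / 2 by lra.
  exists ([set y | Z y -> f y < (f x + M) / 2], [set dl | dl < (M - f x) / 2]).
    split; first exact: uf.
    by apply: nbhs_right_lt; lra.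
  by move=> [y dl] /= [h1 h2] Zy _ h3; exfalso; have := h1 Zy; lra.
move=> /filterI/(_ (nbhs_right_gt (0:R)))/filter_ex[dl [h dl0]].
by exists dl => // z Zz; exact: h.
Qed.

(** Since C bounds f, a value of g above dl would cost more than f - M can repay; this dictates k.
    The penalty k g itself is at most e because f < M + e on the set reached. *)
Lemma penalization Z f g M V (e : R) : compact Z -> usc_on Z f ->
    continuous g -> (forall z, Z z -> 0 <= g z) ->
    (forall z, Z z -> g z = 0 -> f z <= M) ->
    (forall z, Z z -> g z = 0 -> f z = M -> nbhs z V) -> 0 < e ->
  exists2 k, 0 < k & forall z, Z z -> M <= f z - k * g z ->
    V z /\ k * g z <= e.
Proof.
move=> cZ uf cg g0 fM hV e0.
have [C fC] := usc_on_bounded _ _ cZ uf.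
have [|dl dl0 hdl] := compact_penalization
    Z f g M (V `&` [set z | Z z -> f z < M + e]) cZ uf cg g0.
  move=> z Zz gz Mf; have fzM : f z = M by apply/eqP; rewrite eq_le Mf fM.
  apply: filterI; first exact: hV.
  by apply: uf => //; rewrite fzM ltrDl.
pose k := (`|C - M| + 1) / dl.
have k0 : 0 < k by rewrite divr_gt0 // ltr_wpDl.
exists k => // z Zz Mfk.
have gz := g0 _ Zz.
have kg0 : 0 <= k * g z by rewrite mulr_ge0 // ltW.
have [||Vz /(_ Zz) fze] := hdl z Zz; [|lra|split=> //; lra].
rewrite leNgt; apply/negP => dlg.
have : k * dl < k * g z by rewrite ltr_pM2l.
rewrite /k divfK ?gt_eqF //.
have := fC _ Zz; have := ler_norm (C - M); rewrite -/k; lra.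
Qed.

End CompactMaximization.

(** * One-sided slopes along a level function *)

Section Slopes.
Context {R : realType} {E : topologicalType}.
Variables (D : set E) (P : E) (w r : E -> R) (h : E -> R -> R).

(* [h X q] stands for the operator at [X], evaluated on the gradient of slope
   [q] in the direction of increasing [r]. *)
Definition tested (X : E) : Prop := forall q c : R,
  (\forall Y \near X, D Y ->
     w Y - (q * r Y + c * r Y ^+ 2) <= w X - (q * r X + c * r X ^+ 2)) ->
  h X (q + 2 * c * r X) <= 0.

(** As w P = r P = 0, the function q r touches w from above at P. These slopes form an upward closed
    set, whose infimum matters below. *)
Definition slope_above (q : R) : Prop :=
  \forall X \near P, D X -> w X <= q * r X.

Definition stable_positivity : Prop := forall q, 0 < h P q ->
  exists2 dl, 0 < dl & \forall X \near P, D X ->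
    forall q', `|q' - q| <= dl -> 0 < h X q'.

Hypotheses (cD : compact D) (uw : usc_on D w) (cr : continuous r)
  (r0 : forall X, D X -> 0 <= r X)
  (rP : r P = 0) (w0 : forall X, D X -> r X = 0 -> 0 <= w X -> X = P)
  (wP : w P = 0)
  (hT : \forall X \near P, D X -> 0 < r X -> tested X)
  (hpos : stable_positivity).

Lemma level0_le0 X : D X -> r X = 0 -> w X <= 0.
Proof.
move=> DX rX; have [//|wX] := leP (w X) 0.
by move: (wX); rewrite (w0 _ DX rX (ltW wX)) wP ltxx.
Qed.

Lemma slope_above_le q q' : q <= q' -> slope_above q -> slope_above q'.
Proof.
move=> qq'; apply: filterS => X hX DX; apply: le_trans (hX DX) _.
by rewrite ler_wpM2r // r0.
Qed.

(** P is the only point of level 0 with w >= 0, so points of low level at which w is not too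
    negative cluster at P. This carries hypotheses given near P over to whole slabs of levels. *)
Lemma near_levels V : nbhs P V ->
  exists2 rb, 0 < rb & forall X, D X -> r X <= rb -> - rb <= w X -> V X.
Proof.
move=> nV; have [|rb rb0 hrb] := compact_penalization D w r 0 V cD uw cr r0.
  by move=> X DX rX wX; rewrite (w0 _ DX rX wX).
by exists rb => // X DX rX wX; apply: hrb => //; rewrite sub0r.
Qed.

(** A maximum principle on the slab r <= r2. The maximum of w minus the parabola would be positive,
    hence away from level 0, where w <= 0, and from level r2; there [tested] contradicts the
    positivity of h. *)
Lemma no_bump (q c r2 : R) X0 :
  D X0 -> r X0 < r2 -> q * r X0 + c * r X0 ^+ 2 < w X0 ->
  (forall X, D X -> r X = r2 -> w X <= q * r2 + c * r2 ^+ 2) ->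
  (forall X, D X -> 0 < r X < r2 -> q * r X + c * r X ^+ 2 < w X ->
     tested X /\ 0 < h X (q + 2 * c * r X)) -> False.
Proof.
move=> DX0 rX0 wX0 lvl hX.
pose f X := w X + - (q * r X + c * r X ^+ 2).
have cZ : compact (D `&` [set X | r X <= r2]).
  apply: compact_closedI => //.
  by apply: (@closed_comp _ _ r [set x | x <= r2]) => [x _|]; [exact: cr|exact: closed_le].
have cf : continuous (fun X => - (q * r X + c * r X ^+ 2)).
  move=> X; apply: cvgN; apply: cvgD; apply: cvgM; try exact: cvg_cst.
    exact: cr.
  exact: (cvgM (cr X) (cr X)).
have uf : usc_on (D `&` [set X | r X <= r2]) f.
  apply: usc_onD; last exact: continuous_usc_on.
  by apply: usc_on_sub uw => X [].
have [|X [DX /= rX] mX] := usc_on_max _ f cZ _ uf.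
  by exists X0; split => //=; exact: ltW.
have fX : 0 < f X.
  by apply: lt_le_trans (mX X0 _); rewrite /f ?subr_gt0//; split => //; exact: ltW.
have rX0' : 0 < r X.
  rewrite lt_def r0 // andbT; apply/eqP => rX00.
  have := level0_le0 _ DX rX00; move: fX; rewrite /f rX00; nra.
have rX2 : r X < r2.
  rewrite lt_neqAle rX andbT; apply/eqP => rXr2.
  by have := lvl _ DX rXr2; move: fX; rewrite /f rXr2; nra.
have [||tX] := hX X DX; first by rewrite rX0'.
  by rewrite -subr_gt0.
apply/negP; rewrite -leNgt; apply: tX.
have /cvgr_lt/(_ _ rX2) := cr X.
by apply: filterS => Y rY DY; apply: mX; split => //; exact: ltW.
Qed.

(** A low level on which w <= q r would be an upper barrier for [no_bump] with c = 0 and would make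
    q a slope above. So every low level carries a violation, which is the form needed for pairing
    points of equal level. *)
Lemma slope_dichotomy q : 0 < h P q -> ~ slope_above q ->
  exists2 dl, 0 < dl &
    forall rr, 0 < rr < dl -> exists X, [/\ D X, r X = rr & q * rr < w X].
Proof.
move=> /hpos[dl dl0 hq] nI.
have [rb rb0 hrb] := near_levels _ (filterI hT hq).
(* The second bound keeps q r above - rb on the levels concerned, so that w > q r implies the
   condition w >= - rb of [hrb]. *)
exists (Num.min rb (rb / (`|q| + 1))).
  by rewrite lt_min rb0 divr_gt0 // ltr_wpDl.
move=> rr /andP[rr0]; rewrite lt_min => /andP[rrb].
rewrite ltr_pdivlMr ?ltr_wpDl // => rrq.
apply: contrapT => nX; apply: nI.
have rPr : r P < rr by rewrite rP.
have /cvgr_lt/(_ _ rPr) := cr P; apply: filterS => X0 rX0 DX0.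
rewrite leNgt; apply/negP => wX0.
apply: (no_bump q 0 rr X0) => //.
- by rewrite mul0r addr0.
- move=> X DX rX; rewrite mul0r addr0 leNgt; apply/negP => ?.
  by apply: nX; exists X.
move=> X DX /andP[rX0' rXr]; rewrite mul0r addr0 => wX.
have [||hX1 hX2] := hrb X DX; first by lra.
  have := normr_ge0 q; have := ler_norm (- q); rewrite normrN; nra.
by split; [exact: hX1|apply: hX2 => //; rewrite mulr0 mul0r addr0 subrr normr0 ltW].
Qed.

(** By contraposition: h P q <= 0 at the infimum of the slopes above. If no slope below q were
    admissible, some X0 of very low level would have w above (q - dl / 4) r. A parabola passing
    under X0, above w at level r2, and with all its slopes within dl of q then contradicts
    [no_bump]. *)
Lemma slope_critical q : 0 < h P q -> (forall q', q < q' -> slope_above q') ->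
  exists2 q', q' < q & slope_above q'.
Proof.
move=> /hpos[dl dl0 hq] hI; apply: contrapT => nI.
have q1 : q < q + dl / 4 by lra.
have [rb rb0 hrb] := near_levels _ (filterI (filterI hT hq) (hI _ q1)).
pose r2 := Num.min (rb / 2) (rb / (`|q| + dl + 1)).
have r20 : 0 < r2.
  by rewrite lt_min !divr_gt0 //; have := normr_ge0 q; lra.
have r2b : r2 < rb by rewrite gt_min; apply/orP; left; lra.
have r2q : r2 * (`|q| + dl + 1) <= rb.
  have h1 : 0 < `|q| + dl + 1 by have := normr_ge0 q; lra.
  by rewrite -ler_pdivlMr // ge_min lexx orbT.
have [X0 [DX0 rX0 wX0]] :
    exists X0, [/\ D X0, r X0 < r2 / 3 & (q - dl / 4) * r X0 < w X0].
  apply: contrapT => nX; apply: nI; exists (q - dl / 4); first lra.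
  have rPr : r P < r2 / 3 by rewrite rP; lra.
  have /cvgr_lt/(_ _ rPr) := cr P; apply: filterS => X rX DX.
  by rewrite leNgt; apply/negP => ?; apply: nX; exists X.
have rX0' : 0 < r X0.
  rewrite lt_def r0 // andbT; apply/eqP => rX00.
  by have := level0_le0 _ DX0 rX00; move: wX0; rewrite rX00; lra.
(* With this c the parabola of initial slope q - dl / 2 equals (q + dl / 4) r2 at level r2, stays
   under (q - dl / 4) r below r2 / 3, and has slopes between q - dl / 2 and q + dl. *)
pose c := 3 * dl / 4 / r2.
have c0 : 0 < c by rewrite /c !divr_gt0 //; lra.
have cr2 : c * r2 = 3 * dl / 4 by rewrite /c divfK ?gt_eqF.
have nq := ler_norm (- q); rewrite normrN in nq.
have nq0 := normr_ge0 q.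
apply: (no_bump (q - dl / 2) c r2 X0) => //; first lra.
- apply: le_lt_trans wX0.
  have : c * r X0 <= dl / 4 by nra.
  nra.
- move=> X DX rX; have -> : (q - dl / 2) * r2 + c * r2 ^+ 2 = (q + dl / 4) * r2.
    by rewrite expr2 mulrA cr2; field.
  have [wX|wX] := leP (- rb) (w X).
    have [|_] := hrb X DX _ wX; first lra.
    by move=> /(_ DX); rewrite rX.
  by nra.
move=> X DX /andP[rXp rXr] wX.
have crX : 0 <= c * r X <= 3 * dl / 4 by apply/andP; split; nra.
have [||[hX1 hX2] _] := hrb X DX; first by lra.
  by nra.
split; first exact: hX1.
by apply: hX2 => //; rewrite ler_norml; apply/andP; split; nra.
Qed.

(** Positivity of h at all slopes from K on lets q be arbitrarily steep; it is chosen so that q r is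
    at least the upper bound C of w on level rb / 2, which serves as the barrier. *)
Lemma slope_above_exists (K : R) :
  (\forall X \near P, D X -> forall q, K <= q -> 0 < h X q) ->
  exists q, slope_above q.
Proof.
move=> hK.
have [rb rb0 hrb] := near_levels _ (filterI hT hK).
have [C wC] := usc_on_bounded _ _ cD uw.
pose q := `|K| + `|C| / (rb / 2).
have q0 : 0 <= q by rewrite addr_ge0 // divr_ge0 // ltW // divr_gt0.
have qK : K <= q.
  by apply: le_trans (ler_norm K) _; rewrite lerDl divr_ge0 // ltW // divr_gt0.
have qC : C <= q * (rb / 2).
  rewrite mulrDl divfK ?gt_eqF ?divr_gt0 //.
  by have := ler_norm C; have := normr_ge0 K; nra.
exists q.
have rPr : r P < rb / 2 by rewrite rP; lra.
have /cvgr_lt/(_ _ rPr) := cr P; apply: filterS => X0 rX0 DX0.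
rewrite leNgt; apply/negP => wX0.
apply: (no_bump q 0 (rb / 2) X0) => //.
- by rewrite mul0r addr0.
- by move=> X DX rX; rewrite mul0r addr0; apply: le_trans qC; exact/ltW/wC.
move=> X DX /andP[rX0' rXr]; rewrite mul0r addr0 => wX.
have [||hX1 hX2] := hrb X DX; first by lra.
  by nra.
by split; [exact: hX1|apply: hX2 => //; rewrite mulr0 mul0r addr0].
Qed.

End Slopes.

Record boundary_side {R : realType} {E : topologicalType} (D : set E) (P : E)
    (w r : E -> R) (h : E -> R -> R) : Prop := BoundarySide {
  side_compact : compact D;
  side_usc : usc_on D w;
  side_cont : continuous r;
  side_ge0 : forall X, D X -> 0 <= r X;
  side_base : D P;
  side_r0 : r P = 0;
  side_strict : forall X, D X -> r X = 0 -> 0 <= w X -> X = P;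
  side_w0 : w P = 0;
  side_test : \forall X \near P, D X -> 0 < r X -> tested D w r h X;
  side_pos : stable_positivity D P h }.

(** * One slope for both sides *)

Section Matching.
Context {R : realType} {E : topologicalType}.

(** If q fails for the first side, each low level has some X with w1 X > q r1 X; the constraint w1 +
    w2 <= 0 on equal levels then forces w2 < - q r2 on that level. *)
Lemma slope_above_or (D1 D2 : set E) (P1 P2 : E) (w1 w2 r1 r2 : E -> R)
    (h1 h2 : E -> R -> R) q :
  boundary_side D1 P1 w1 r1 h1 -> boundary_side D2 P2 w2 r2 h2 ->
  (forall X Y, D1 X -> D2 Y -> r1 X = r2 Y -> w1 X + w2 Y <= 0) ->
  0 < h1 P1 q -> slope_above D1 P1 w1 r1 q \/ slope_above D2 P2 w2 r2 (- q).
Proof.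
move=> [cD1 uw1 cr1 ge1 DP1 rP1 st1 wP1 T1 pos1] [cD2 uw2 cr2 ge2 DP2 rP2 st2 wP2 T2 pos2].
move=> sum hq; have [|nI] := pselect (slope_above D1 P1 w1 r1 q); first by left.
right; have [dl dl0 H] := slope_dichotomy D1 P1 w1 r1 h1 cD1 uw1 cr1 ge1 rP1 st1 wP1 T1 pos1 q hq nI.
have : r2 P2 < dl by rewrite rP2.
move=> /(cvgr_lt _ (cr2 P2)); apply: filterS => Y rY DY.
have [rY0|rY0] := eqVneq (r2 Y) 0.
  by rewrite rY0 mulr0; have := sum _ _ DP1 DY; rewrite rP1 rY0 wP1 add0r; apply.
have [|X [DX rX wX]] := H (r2 Y); first by rewrite rY lt_def rY0 ge2.
by have := sum _ _ DX DY rX; lra.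
Qed.

(* The slope found in the proof is the largest [c] with [h1 P1 c <= 0] such that
   all smaller slopes bound the second side. It is not critical for that side,
   so the slopes slightly above [c] bound both sides but violate [h1 P1 q <= 0],
   which only leaves the boundary operators. *)
Lemma boundary_matching (D1 D2 : set E) (P1 P2 : E) (w1 w2 r1 r2 : E -> R)
    (h1 h2 : E -> R -> R) (F1 F2 : R -> R) (K : R) :
  boundary_side D1 P1 w1 r1 h1 -> boundary_side D2 P2 w2 r2 h2 ->
  (forall X Y, D1 X -> D2 Y -> r1 X = r2 Y -> w1 X + w2 Y <= 0) ->
  continuous F1 ->
  (forall q, slope_above D1 P1 w1 r1 q -> h1 P1 q <= 0 \/ F1 q <= 0) ->
  (forall q, slope_above D2 P2 w2 r2 q -> h2 P2 q <= 0 \/ F2 q <= 0) ->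
  (forall q, q <= - K -> 0 < F1 q) ->
  (\forall X \near P1, D1 X -> forall q, K <= `|q| -> 0 < h1 X q) ->
  exists q, h1 P1 q <= 0 /\ (h2 P2 (- q) <= 0 \/ F1 q <= 0 /\ F2 (- q) <= 0).
Proof.
move=> S1 S2 sum cF1 t1 t2 F1K h1K; apply: contrapT => /forallNP nq.
have sep1 q : h1 P1 q <= 0 -> 0 < h2 P2 (- q).
  by move=> hq; rewrite ltNge; apply/negP => h2q; apply: (nq q); split => //; left.
have sep2 q : h1 P1 q <= 0 -> F1 q <= 0 -> 0 < F2 (- q).
  by move=> hq Fq; rewrite ltNge; apply/negP => F2q; apply: (nq q); split => //; right.
pose I := slope_above D1 P1 w1 r1; pose J q := slope_above D2 P2 w2 r2 (- q).
have IJ q : I q \/ J q.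
  have [hq|hq] := leP (h1 P1 q) 0; last exact: slope_above_or S1 S2 sum hq.
  have := slope_above_or D2 D1 P2 P1 w2 w1 r2 r1 h2 h1 (- q) S2 S1.
  rewrite opprK => /(_ _ (sep1 _ hq))[|Jq|Iq]; [|by right|by left].
  by move=> X Y DX DY rXY; rewrite addrC; apply: sum.
move: (S1) (S2) => [cD1 uw1 cr1 ge1 DP1 rP1 st1 wP1 T1 pos1] [cD2 uw2 cr2 ge2 DP2 rP2 st2 wP2 T2 pos2].
have Ile q q' : q <= q' -> I q -> I q' by exact: slope_above_le.
have Jle q q' : q <= q' -> J q' -> J q by rewrite -lerN2; apply: slope_above_le.
have h1P q : K <= `|q| -> 0 < h1 P1 q by apply: (nbhs_singleton h1K).
have I0 : I !=set0.
  have [|q Iq] := slope_above_exists D1 P1 w1 r1 h1 cD1 uw1 cr1 ge1 rP1 st1 wP1 T1 K.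
    by apply: filterS h1K => X hX DX q Kq; apply: hX => //; exact: le_trans (ler_norm _).
  by exists q.
(* Below - K both h1 and F1 are positive, so [t1] keeps such slopes out of I. *)
have Ilb q : I q -> - `|K| <= q.
  move=> Iq; rewrite leNgt; apply/negP => qK.
  have nK := ler_norm K.
  have Fq : 0 < F1 q by apply: F1K; lra.
  have hq : 0 < h1 P1 q.
    by apply: h1P; have := ler_norm (- q); rewrite normrN; lra.
  by have [] := t1 _ Iq; rewrite leNgt ?hq ?Fq.
have hI : has_inf I by split => //; exists (- `|K|) => q; exact: Ilb.
pose a := inf I.
have Ia q : a < q -> I q.
  rewrite -subr_gt0 => e0; have [s Is] := inf_adherent e0 hI.
  by rewrite addrC subrK => /ltW sq; exact: Ile sq Is.
have nIa q : q < a -> ~ I q.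
  by move=> qa Iq; have := ge_inf hI.2 Iq; rewrite leNgt -/a qa.
(* Otherwise [slope_critical] would produce a slope of I below its infimum. *)
have ha : h1 P1 a <= 0.
  rewrite leNgt; apply/negP => ha.
  have [q qa] := slope_critical D1 P1 w1 r1 h1 cD1 uw1 cr1 ge1 rP1 st1 wP1 T1 pos1 a ha Ia.
  exact: nIa.
pose S := [set q | h1 P1 q <= 0 /\ forall q', q' < q -> J q'].
have Sa : S a by split=> // q /nIa; have [] := IJ q.
have hS : has_sup S.
  split; first by exists a.
  exists K => q [hq _]; rewrite leNgt; apply/negP => Kq.
  by have := h1P q (le_trans (ltW Kq) (ler_norm _)); rewrite ltNge hq.
pose c := sup S.
have ac : a <= c by exact: sup_upper_bound Sa.
have Jc q : q < c -> J q.
  rewrite -subr_gt0 => e0; have [s [_ Js]] := sup_adherent e0 hS.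
  by rewrite opprB addrC subrK => /Js.
(* Positivity at c would persist at nearby slopes, among them elements of S. *)
have hc : h1 P1 c <= 0.
  rewrite leNgt; apply/negP => /pos1[dl dl0 /nbhs_singleton hdl].
  have [s Ss] := sup_adherent dl0 hS; rewrite -/c => cs.
  have sc : s <= c by exact: sup_upper_bound.
  have : 0 < h1 P1 s by apply: hdl => //; rewrite ler_norml; apply/andP; split; lra.
  by rewrite ltNge (proj1 Ss).
have [|q' q'c Jq'] := slope_critical D2 P2 w2 r2 h2 cD2 uw2 cr2 ge2 rP2 st2 wP2 T2 pos2 (- c) (sep1 _ hc).
  by move=> q; rewrite ltrNl => /Jc; rewrite /J opprK.
have F1c : 0 < F1 c.
  rewrite ltNge; apply/negP => F1c.
  have cq : c <= - q' by lra.
  have Jcc : J c by apply: Jle cq _; rewrite /J opprK.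
  by have [] := t2 _ Jcc; rewrite leNgt ?sep1 ?sep2.
have /(cvgr_gt _ (cF1 c)) F1near := F1c.
have : \forall q \near c^'+, [/\ c < q, q < - q' & 0 < F1 q].
  near=> q; split; near: q.
  - exact: nbhs_right_gt.
  - by apply: nbhs_right_lt; lra.
  - exact: cvg_within F1near.
move=> /filter_ex[q [cq qq' Fq]].
(* Otherwise q would lie in S above its supremum: all s < q are in J, since q < - q' and - q' is in
   J. *)
have hq : 0 < h1 P1 q.
  rewrite ltNge; apply/negP => hq.
  have : S q.
    split=> // s sq; apply: (Jle s (- q')); first by lra.
    by rewrite /J opprK.
  by move=> /(sup_upper_bound hS); rewrite -/c leNgt cq.
by have [] := t1 q (Ia _ (le_lt_trans ac cq)); rewrite leNgt ?hq ?Fq.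
Unshelve. all: by end_near. Qed.

End Matching.

Lemma near_dist_le {R : realType} (q dl : R) : 0 < dl ->
  \forall q' \near q, `|q' - q| <= dl.
Proof. by move=> dl0; apply: (@cvgr_distC_le _ _ _ (nbhs q) _ id q). Qed.

Lemma near_fst {S T : topologicalType} (x : S) (y : T) (A : S -> Prop) :
  (\forall x' \near x, A x') -> \forall z \near (x, y), A z.1.
Proof. by move=> hA; exact: (@cvg_fst _ _ (nbhs x) (nbhs y) _ A hA). Qed.

Lemma near_snd {S T : topologicalType} (x : S) (y : T) (A : T -> Prop) :
  (\forall y' \near y, A y') -> \forall z \near (x, y), A z.2.
Proof. by move=> hA; exact: (@cvg_snd _ _ (nbhs x) (nbhs y) _ A hA). Qed.

Lemma continuous_fst {S T U : topologicalType} (f : S -> U) :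
  continuous f -> continuous (fun z : S * T => f z.1).
Proof. by move=> cf z; apply: continuous_comp; [exact: cvg_fst|exact: cf]. Qed.

Lemma continuous_snd {S T U : topologicalType} (f : T -> U) :
  continuous f -> continuous (fun z : S * T => f z.2).
Proof. by move=> cf z; apply: continuous_comp; [exact: cvg_snd|exact: cf]. Qed.

Lemma usc_on_fst {R : realType} {S T : topologicalType} (A : set S) (B : set T)
  (f : S -> R) : usc_on A f -> usc_on (A `*` B) (fun z => f z.1).
Proof.
move=> uf [x y] [/= Ax _] c /(uf _ Ax)/(near_fst _ y); apply: filterS.
by move=> z hz [Az _]; exact: hz.
Qed.

Lemma usc_on_snd {R : realType} {S T : topologicalType} (A : set S) (B : set T)
  (f : T -> R) : usc_on B f -> usc_on (A `*` B) (fun z => f z.2).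
Proof.
move=> uf [x y] [/= _ By] c /(uf _ By)/(near_snd x); apply: filterS.
by move=> z hz [_ Bz]; exact: hz.
Qed.

(** Doubling with the penalty k (r1 - r2)^2 yields the common slope 2 k (r1 - r2), but at points
    that depend on k. So the negation is first made uniform on one neighbourhood of (P1, P2), fixed
    before k: by compactness for slopes in [-K, K], by coercivity of h1 beyond. *)
Lemma interior_matching {R : realType} {E : topologicalType} (D1 D2 : set E)
    (P1 P2 : E) (w1 w2 r1 r2 : E -> R) (h1 h2 : E -> R -> R) (K : R) :
  compact D1 -> compact D2 -> usc_on D1 w1 -> usc_on D2 w2 ->
  continuous r1 -> continuous r2 -> D1 P1 -> D2 P2 -> r1 P1 = r2 P2 ->
  w1 P1 = 0 -> w2 P2 = 0 ->
  (forall X Y, D1 X -> D2 Y -> r1 X = r2 Y -> w1 X + w2 Y <= 0) ->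
  (forall X Y, D1 X -> D2 Y -> r1 X = r2 Y -> 0 <= w1 X + w2 Y ->
     X = P1 /\ Y = P2) ->
  (\forall X \near P1, D1 X -> tested D1 w1 r1 h1 X) ->
  (\forall Y \near P2, D2 Y -> tested D2 w2 r2 h2 Y) ->
  stable_positivity D1 P1 h1 -> stable_positivity D2 P2 h2 ->
  (\forall X \near P1, D1 X -> forall q, K <= `|q| -> 0 < h1 X q) ->
  exists q, h1 P1 q <= 0 /\ h2 P2 (- q) <= 0.
Proof.
move=> cD1 cD2 uw1 uw2 cr1 cr2 DP1 DP2 rP wP1 wP2 sum strict T1 T2 pos1 pos2 hK.
apply: contrapT => /forallNP nq.
have alt q : 0 < h1 P1 q \/ 0 < h2 P2 (- q).
  have [hq|] := leP (h1 P1 q) 0; last by left.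
  by right; rewrite ltNge; apply/negP => h2q; apply: (nq q).
have unif : \forall Z \near (P1, P2), `[- K, K]%classic `<=`
    (fun q => D1 Z.1 -> D2 Z.2 -> 0 < h1 Z.1 q \/ 0 < h2 Z.2 (- q)).
  have /compact_near_coveringP/(_ _ (nbhs (P1, P2)) (fun (Z : E * E) q =>
    D1 Z.1 -> D2 Z.2 -> 0 < h1 Z.1 q \/ 0 < h2 Z.2 (- q)) _) :=
    @segment_compact R (- K) K; apply => q _.
  have [/pos1[dl dl0 H]|/pos2[dl dl0 H]] := alt q.
    exists ([set q' | `|q' - q| <= dl],
            [set Z : E * E | D1 Z.1 -> forall q', `|q' - q| <= dl -> 0 < h1 Z.1 q']).
      by split; [exact: near_dist_le|exact: near_fst H].
    by move=> [q' Z] /= [qq' HZ] D1Z _; left; exact: HZ.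
  exists ([set q' | `|q' - q| <= dl],
          [set Z : E * E | D2 Z.2 -> forall q', `|q' - - q| <= dl -> 0 < h2 Z.2 q']).
    by split; [exact: near_dist_le|exact: near_snd H].
  move=> [q' Z] /= [qq' HZ] _ D2Z; right; apply: HZ => //.
  by have -> : - q' - - q = - (q' - q) by [ring]; rewrite normrN.
pose r' (Z : E * E) := r1 Z.1 - r2 Z.2.
pose g (Z : E * E) := r' Z * r' Z.
pose f (Z : E * E) := w1 Z.1 + w2 Z.2.
have cg : continuous g.
  have cr' : continuous r'.
    by move=> Z; apply: cvgB; [exact: continuous_fst|exact: continuous_snd].
  by move=> Z; exact: (cvgM (cr' Z) (cr' Z)).
have cD := compact_setX cD1 cD2.
have uf : usc_on (D1 `*` D2) f.
  by apply: usc_onD; [exact: usc_on_fst|exact: usc_on_snd].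
pose V := [set Z : E * E | [/\ D1 Z.1 -> tested D1 w1 r1 h1 Z.1,
   D2 Z.2 -> tested D2 w2 r2 h2 Z.2,
   D1 Z.1 -> forall q, K <= `|q| -> 0 < h1 Z.1 q &
   `[- K, K]%classic `<=`
    (fun q => D1 Z.1 -> D2 Z.2 -> 0 < h1 Z.1 q \/ 0 < h2 Z.2 (- q))]].
have nV : nbhs (P1, P2) V.
  have n1 := near_fst _ P2 _ T1; have n2 := near_snd P1 _ _ T2.
  have n3 := near_fst _ P2 _ hK.
  by near=> Z; split; near: Z.
have g0 Z : (D1 `*` D2) Z -> 0 <= g Z by move=> _; exact: sqr_ge0.
have gz Z : g Z = 0 -> r1 Z.1 = r2 Z.2.
  by move=> /eqP; rewrite mulf_eq0 orbb subr_eq0 => /eqP.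
have fM Z : (D1 `*` D2) Z -> g Z = 0 -> f Z <= 0.
  by move=> [DX DY] /gz; exact: sum.
have fV Z : (D1 `*` D2) Z -> g Z = 0 -> f Z = 0 -> nbhs Z V.
  move: Z => [X Y] [/= DX DY] /gz/= rXY; rewrite /f /= => fXY.
  have [-> ->] : X = P1 /\ Y = P2 by apply: strict; rewrite ?fXY.
  exact: nV.
have [k k0 hk] := penalization (D1 `*` D2) f g 0 V 1 cD uf cg g0 fM fV ltr01.
have ufk : usc_on (D1 `*` D2) (fun Z => f Z + - (k * g Z)).
  apply: usc_onD => //; apply: continuous_usc_on => Z.
  by apply: cvgN; apply: cvgM; [exact: cvg_cst|exact: cg].
have [|[X Y] [/= DX DY] mXY] := usc_on_max _ _ cD _ ufk.
  by exists (P1, P2).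
have [|[/(_ DX) tX /(_ DY) tY /(_ DX) KX uXY] _] := hk (X, Y) (conj DX DY).
  have := mXY (P1, P2) (conj DP1 DP2).
  by rewrite /f /g /r' /= wP1 wP2 rP subrr mul0r mulr0 addr0 oppr0 addr0.
have h1X : h1 X (2 * k * (r1 X - r2 Y)) <= 0.
  (* With Y frozen, the penalty is a parabola in r1 X up to a constant: [tested] is used with q = -
     2 k r2 Y and c = k. *)
  have -> : 2 * k * (r1 X - r2 Y) = - (2 * k * r2 Y) + 2 * k * r1 X by ring.
  apply: tX; apply: nearW => X' DX'.
  have := mXY (X', Y) (conj DX' DY); rewrite /f /g /r' /=; nra.
have h2Y : h2 Y (- (2 * k * (r1 X - r2 Y))) <= 0.
  have -> : - (2 * k * (r1 X - r2 Y)) = - (2 * k * r1 X) + 2 * k * r2 Y by ring.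
  apply: tY; apply: nearW => Y' DY'.
  have := mXY (X, Y') (conj DX DY'); rewrite /f /g /r' /=; nra.
have [qK|qK] := leP K (`|2 * k * (r1 X - r2 Y)|).
  by have := KX _ qK; rewrite ltNge h1X.
have qin : `[- K, K]%classic (2 * k * (r1 X - r2 Y)).
  by rewrite /= in_itv/= -ler_norml ltW.
by have [] := uXY _ qin DX DY; rewrite ltNge ?h1X ?h2Y.
Unshelve. all: by end_near. Qed.

(** * Continuously differentiable functions *)

Section C1Calculus.
Context {R : realType} {V : normedModType R}.
Implicit Types (U : set V) (f g : V -> R).

Lemma continuous_near_eq {T S : topologicalType} (f g : T -> S) (x : T) :
  (\forall y \near x, f y = g y) -> {for x, continuous g} ->
  {for x, continuous f}.
Proof.
move=> fg cg; rewrite /prop_for /continuous_at (nbhs_singleton fg).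
by apply: cvg_trans cg; apply: near_eq_cvg; apply: filterS fg.
Qed.

Lemma C1_on_cst U (k : R) : C1_on U (fun=> k).
Proof.
move=> x Ux; split=> [|v]; first exact: differentiable_cst.
apply: (@continuous_near_eq _ _ _ (fun=> 0)); last exact: cvg_cst.
by apply: nearW => y; exact: derive_cst.
Qed.

Lemma C1_on_derivable U f x v : C1_on U f -> U x -> derivable f x v.
Proof. by move=> C1f /C1f[df _]; exact: diff_derivable. Qed.

Lemma C1_on_continuous U f x : C1_on U f -> U x -> {for x, continuous f}.
Proof. by move=> C1f /C1f[df _]; exact: differentiable_continuous. Qed.

Lemma C1_onD U f g : open U -> C1_on U f -> C1_on U g ->
  C1_on U (fun x => f x + g x).
Proof.
move=> oU C1f C1g x Ux; have [df cf] := C1f x Ux; have [dg cg] := C1g x Ux.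
split=> [|v]; first exact: differentiableD.
apply: (@continuous_near_eq _ _ _ (fun y => 'D_v f y + 'D_v g y)).
  have := open_nbhs_nbhs (conj oU Ux); apply: filterS => y Uy.
  by apply: deriveD; [exact: C1_on_derivable C1f Uy|exact: C1_on_derivable C1g Uy].
by apply: cvgD; [exact: cf|exact: cg].
Qed.

Lemma C1_onM U f g : open U -> C1_on U f -> C1_on U g ->
  C1_on U (fun x => f x * g x).
Proof.
move=> oU C1f C1g x Ux; have [df cf] := C1f x Ux; have [dg cg] := C1g x Ux.
split=> [|v]; first exact: differentiableM.
apply: (@continuous_near_eq _ _ _ (fun y => f y * 'D_v g y + g y * 'D_v f y)).
  have := open_nbhs_nbhs (conj oU Ux); apply: filterS => y Uy.
  by rewrite deriveM //; [exact: C1_on_derivable C1f Uy|exact: C1_on_derivable C1g Uy].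
have cfx := C1_on_continuous _ _ _ C1f Ux; have cgx := C1_on_continuous _ _ _ C1g Ux.
by apply: cvgD; apply: cvgM; [exact: cfx|exact: cg|exact: cgx|exact: cf].
Qed.

Lemma C1_on_scale U f k : open U -> C1_on U f -> C1_on U (fun x => k * f x).
Proof. by move=> oU; apply: C1_onM => //; exact: C1_on_cst. Qed.

Lemma C1_on_sum U (I : Type) (s : seq I) (f : I -> V -> R) : open U ->
  (forall i, C1_on U (f i)) -> C1_on U (fun x => \sum_(i <- s) f i x).
Proof.
move=> oU C1f; elim: s => [|i s IH].
  have -> : (fun x => \sum_(i <- [::]) f i x) = (fun=> 0).
    by apply/funext => x; rewrite big_nil.
  exact: C1_on_cst.
have -> : (fun x => \sum_(j <- i :: s) f j x) =
    (fun x => f i x + \sum_(j <- s) f j x).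
  by apply/funext => x; rewrite big_cons.
exact: C1_onD.
Qed.

Lemma C1_on_sub U U' f : U' `<=` U -> C1_on U f -> C1_on U' f.
Proof. by move=> UU C1f x /UU; exact: C1f. Qed.

Lemma differentiable_near0 f x : (\forall y \near x, f y = 0) ->
  differentiable f x.
Proof.
move=> f0; have fx0 : f x = 0 by exact: nbhs_singleton f0.
have c0 : continuous (\0 : {linear V -> R}) by move=> y; exact: cvg_cst.
have H : f \o shift x = cst (f x) + (\0 : {linear V -> R}) +o_ 0 id.
  apply/eqaddoP => e e0; move: f0; rewrite (near_shift 0) /=.
  apply: filterS => y; rewrite subr0 addrC => fy.
  by rewrite !fctE /= fx0 addrC fy !addr0 subrr normr0 mulr_ge0 // ltW.
have dE := diff_unique c0 H.
by apply/diff_locallyP; rewrite dE.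
Qed.

Lemma C1_on_near_eq U f g : open U -> (forall x, U x -> f x = g x) ->
  C1_on U g -> C1_on U f.
Proof.
move=> oU fg C1g x Ux; have [dg cg] := C1g x Ux.
have nfg y : U y -> \forall z \near y, g z = f z.
  move=> Uy; have := open_nbhs_nbhs (conj oU Uy); apply: filterS => z Uz.
  by rewrite fg.
split=> [|v].
  (* Subtracting from g a function that vanishes near x reduces the locality of differentiability to
     [differentiable_near0]. *)
  have -> : f = g - (fun y => g y - f y) by apply/funext => y /=; rewrite subKr.
  apply: differentiableB => //; apply: differentiable_near0.
  by apply: filterS (nfg _ Ux) => y ->; rewrite subrr.
apply: (@continuous_near_eq _ _ _ ('D_v g)); last exact: cg.
have := open_nbhs_nbhs (conj oU Ux); apply: filterS => y Uy.
by apply/esym/near_eq_derive; apply: filterS (nfg _ Uy) => z ->.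
Qed.

Lemma C1_on_comp U f (k k' : R -> R) : open U ->
  (forall s : R, is_derive s 1 k (k' s)) -> continuous k' -> C1_on U f ->
  C1_on U (fun x => k (f x)) /\
  forall x v, U x -> 'D_v (fun x => k (f x)) x = k' (f x) * 'D_v f x.
Proof.
move=> oU dk ck C1f.
have dif s : differentiable k s by apply/derivable1_diffP; have [] := dk s.
have der x v : U x -> 'D_v (fun x => k (f x)) x = k' (f x) * 'D_v f x.
  move=> Ux; have [df _] := C1f x Ux.
  rewrite deriveE; last exact: (differentiable_comp df (dif _)).
  rewrite (diff_comp df (dif _)) /= [in RHS]deriveE // mulrC.
  have [_ <-] := dk (f x); rewrite -derive1E.
  exact: (congr1 (fun g : R -> R => g ('d f x v)) (diff1E (dif (f x)))).
split=> // x Ux; have [df cf] := C1f x Ux.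
split=> [|v]; first exact: (differentiable_comp df (dif _)).
apply: (@continuous_near_eq _ _ _ (fun y => k' (f y) * 'D_v f y)).
  have := open_nbhs_nbhs (conj oU Ux); apply: filterS => y; exact: der.
apply: cvgM; last exact: cf.
by apply: continuous_comp; [exact: C1_on_continuous C1f Ux|exact: ck].
Qed.

(** The two difference quotients are the same function of the increment. *)
Lemma derive_linear_comp {W : normedModType R} (L : V -> W) (h : W -> R) x v :
  linear L -> 'D_v (fun y => h (L y)) x = 'D_(L v) h (L x).
Proof.
move=> linL.
rewrite /derive; set F := (X in lim (X @ _) = _); set G := (X in _ = lim (X @ _)).
suff -> : F = G by [].
by apply/funext => r; rewrite /F /G /= linL.
Qed.

Lemma C1_on_linear_comp {W : normedModType R} (L : V -> W) (h : W -> R)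
    (U : set W) : linear L -> continuous L -> C1_on U h ->
  C1_on (L @^-1` U) (fun x => h (L x)).
Proof.
move=> linL cL C1h x Ux; have [dh ch] := C1h (L x) Ux; split=> [|v].
  apply: (@differentiable_comp _ _ _ _ L h); last exact: dh.
  pose LM := GRing.isLinear.Build _ _ _ _ L linL.
  pose LL : {linear V -> W} := HB.pack L LM.
  exact: (@linear_differentiable _ _ _ LL).
apply: (@continuous_near_eq _ _ _ (fun y => 'D_(L v) h (L y))).
  by apply: nearW => y; exact: derive_linear_comp.
by apply: (@continuous_comp _ _ _ L ('D_(L v) h) x); [exact: cL|exact: ch].
Qed.

End C1Calculus.

(** * Functions separated in time and space, and their gradients *)

Section SpaceTime.
Context {R : realType} {d : nat}.
Implicit Types (x y v : 'rV[R]_d) (g : R -> R) (h : 'rV[R]_d -> R).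
Local Notation ST := (R * 'rV[R]_d)%type.

Definition dotp x y : R := \sum_(i < d) x 0 i * y 0 i.

Lemma grad_derive h x v : differentiable h x -> 'D_v h x = dotp (grad h x) v.
Proof.
move=> dh; rewrite deriveE // [in LHS](row_sum_delta v) linear_sum.
by apply: eq_bigr => i _; rewrite linearZ /= -deriveE // mxE mulrC.
Qed.

Lemma C1_on_time (A : set R) g : C1_on A g ->
  C1_on [set X : ST | A X.1] (fun X => g X.1).
Proof.
by move=> C1g; apply: (@C1_on_linear_comp _ _ _ fst) => // X; exact: cvg_fst.
Qed.

Lemma C1_on_space h : C1_on setT h -> C1_on setT (fun X : ST => h X.2).
Proof.
move=> C1h; apply: (@C1_on_linear_comp _ _ _ snd h setT) => // X; exact: cvg_snd.
Qed.

(** All test functions below are sums of a time part and a space part. The set A is there for the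
    time part, which blows up at T and is C^1 only for t < T. *)
Lemma C1_on_separated (A : set R) g h : open A ->
  C1_on A g -> C1_on setT h ->
  C1_on [set X : ST | A X.1] (fun X => g X.1 + h X.2).
Proof.
move=> oA C1g C1h; apply: C1_onD; first by apply: open_comp => // X _; exact: cvg_fst.
  exact: C1_on_time.
by apply: C1_on_sub (C1_on_space _ C1h).
Qed.

Lemma derive_separated (A : set R) g h X (w : ST) : A X.1 ->
  C1_on A g -> C1_on setT h ->
  'D_w (fun X : ST => g X.1 + h X.2) X =
  'D_(w.1) g X.1 + 'D_(w.2) h X.2.
Proof.
move=> AX C1g C1h.
have dg : derivable (fun X : ST => g X.1) X w.
  exact: C1_on_derivable (C1_on_time _ _ C1g) AX.
have dh : derivable (fun X : ST => h X.2) X w.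
  exact: C1_on_derivable (C1_on_space _ C1h) Logic.I.
by rewrite deriveD // (@derive_linear_comp _ _ _ fst g) // (@derive_linear_comp _ _ _ snd h).
Qed.

Lemma dt_separated (A : set R) g h X : A X.1 ->
  C1_on A g -> C1_on setT h ->
  dt (fun X : ST => g X.1 + h X.2) X = 'D_1 g X.1.
Proof.
by move=> AX C1g C1h; rewrite /dt (derive_separated A) //= derive0 addr0.
Qed.

Lemma Dx_separated (A : set R) g h X : A X.1 ->
  C1_on A g -> C1_on setT h ->
  Dx (fun X : ST => g X.1 + h X.2) X = grad h X.2.
Proof.
move=> AX C1g C1h; apply/rowP => i; rewrite !mxE (derive_separated A) //=.
by rewrite derive0 add0r.
Qed.

Lemma gradD h1 h2 x : C1_on setT h1 -> C1_on setT h2 ->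
  grad (fun y => h1 y + h2 y) x = grad h1 x + grad h2 x.
Proof.
move=> C1 C2; apply/rowP => i; rewrite !mxE deriveD //.
  exact: C1_on_derivable C1 Logic.I.
exact: C1_on_derivable C2 Logic.I.
Qed.

Lemma gradM h1 h2 x : C1_on setT h1 -> C1_on setT h2 ->
  grad (fun y => h1 y * h2 y) x = h1 x *: grad h2 x + h2 x *: grad h1 x.
Proof.
move=> C1 C2; apply/rowP => i; rewrite !mxE deriveM //.
  exact: C1_on_derivable C1 Logic.I.
exact: C1_on_derivable C2 Logic.I.
Qed.

Lemma grad_cst (k : R) x : grad (fun=> k) x = 0.
Proof. by apply/rowP => i; rewrite !mxE derive_cst. Qed.

Lemma grad_scale (k : R) h x : C1_on setT h ->
  grad (fun y => k * h y) x = k *: grad h x.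
Proof.
move=> C1; rewrite gradM ?grad_cst ?scaler0 ?addr0 //; exact: C1_on_cst.
Qed.

Lemma C1_on_coord (i : 'I_d) : C1_on setT (fun x => x 0 i).
Proof.
apply: (@C1_on_linear_comp _ _ R (fun x => x 0 i) id setT).
- by move=> a x y; rewrite !mxE.
- exact: coord_continuous.
- move=> x _; split => [|v]; first exact: ex_diff.
  have -> : 'D_v id = (fun=> v) :> (R -> R).
    by apply/funext => y; exact: derive_id.
  exact: cvg_cst.
Qed.

Lemma grad_coord (i : 'I_d) x : grad (fun y => y 0 i) x = delta_mx 0 i.
Proof.
apply/rowP => j; rewrite !mxE.
rewrite (@derive_linear_comp _ _ R (fun x => x 0 i) id).
  by rewrite derive_id !mxE !eqxx eq_sym.
by move=> a y z; rewrite !mxE.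
Qed.

Lemma C1_on_affine (a z : 'rV[R]_d) : C1_on setT (fun x => dotp a (x - z)).
Proof.
apply: C1_on_sum => [|i]; first exact: openT.
apply: C1_on_scale; first exact: openT.
have -> : (fun x => (x - z) 0 i) = (fun x => x 0 i + - z 0 i).
  by apply/funext => x; rewrite !mxE.
by apply: C1_onD; [exact: openT|exact: C1_on_coord|exact: C1_on_cst].
Qed.

Lemma grad_sum (I : Type) (s : seq I) (f : I -> 'rV[R]_d -> R) x :
  (forall i, C1_on setT (f i)) ->
  grad (fun y => \sum_(i <- s) f i y) x = \sum_(i <- s) grad (f i) x.
Proof.
move=> C1f; elim: s => [|i s IH].
  rewrite big_nil; have -> : (fun x => \sum_(i <- [::]) f i x) = (fun=> 0).
    by apply/funext => y; rewrite big_nil.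
  exact: grad_cst.
rewrite big_cons -IH -gradD //.
  by congr (grad _ x); apply/funext => y; rewrite big_cons.
by apply: C1_on_sum => //; exact: openT.
Qed.

Lemma grad_affine (a z : 'rV[R]_d) x : grad (fun x => dotp a (x - z)) x = a.
Proof.
have C1c i : C1_on setT (fun x : 'rV[R]_d => x 0 i + - z 0 i).
  by apply: C1_onD; [exact: openT|exact: C1_on_coord|exact: C1_on_cst].
have -> : (fun x => dotp a (x - z)) =
    (fun x => \sum_(i < d) a 0 i * (x 0 i + - z 0 i)).
  by apply/funext => y; apply: eq_bigr => i _; rewrite !mxE.
rewrite grad_sum => [|i]; last by apply: C1_on_scale => //; exact: openT.
rewrite [RHS]row_sum_delta; apply: eq_bigr => i _.
rewrite grad_scale // gradD ?grad_cst ?addr0 ?grad_coord //.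
  exact: C1_on_coord.
exact: C1_on_cst.
Qed.

Lemma C1_on_sqdist (z : 'rV[R]_d) : C1_on setT (fun x => dotp (x - z) (x - z)).
Proof.
have C1c i : C1_on setT (fun x : 'rV[R]_d => (x - z) 0 i).
  have -> : (fun x => (x - z) 0 i) = (fun x => x 0 i + - z 0 i).
    by apply/funext => x; rewrite !mxE.
  by apply: C1_onD; [exact: openT|exact: C1_on_coord|exact: C1_on_cst].
by apply: C1_on_sum => [|i]; [exact: openT|apply: C1_onM => //; exact: openT].
Qed.

Lemma grad_sqdist (z : 'rV[R]_d) x :
  grad (fun x => dotp (x - z) (x - z)) x = 2 *: (x - z).
Proof.
have C1c i : C1_on setT (fun x : 'rV[R]_d => x 0 i + - z 0 i).
  by apply: C1_onD; [exact: openT|exact: C1_on_coord|exact: C1_on_cst].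
have -> : (fun x => dotp (x - z) (x - z)) =
    (fun x => \sum_(i < d) (x 0 i + - z 0 i) * (x 0 i + - z 0 i)).
  by apply/funext => y; apply: eq_bigr => i _; rewrite !mxE.
rewrite grad_sum => [|i]; last by apply: C1_onM => //; exact: openT.
rewrite [RHS]row_sum_delta; apply: eq_bigr => i _.
rewrite gradM // gradD ?grad_cst ?addr0 ?grad_coord; last exact: C1_on_cst.
  by rewrite -scalerDl !mxE mulr_natl mulr2n.
exact: C1_on_coord.
Qed.

End SpaceTime.

(** * Euclidean inner product and parallel gradients *)

Section Euclid.
Context {R : realType} {d : nat}.
Implicit Types (x y z v : 'rV[R]_d) (h : 'rV[R]_d -> R).

Lemma dotpC x y : dotp x y = dotp y x.
Proof. by apply: eq_bigr => i _; rewrite mulrC. Qed.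

Lemma dotpDl x y z : dotp (x + y) z = dotp x z + dotp y z.
Proof. by rewrite /dotp -big_split; apply: eq_bigr => i _; rewrite mxE mulrDl. Qed.

Lemma dotpZl k x y : dotp (k *: x) y = k * dotp x y.
Proof. by rewrite /dotp mulr_sumr; apply: eq_bigr => i _; rewrite mxE mulrA. Qed.

Lemma dotpDr x y z : dotp x (y + z) = dotp x y + dotp x z.
Proof. by rewrite dotpC dotpDl !(dotpC x). Qed.

Lemma dotpZr k x y : dotp x (k *: y) = k * dotp x y.
Proof. by rewrite dotpC dotpZl dotpC. Qed.

Lemma dotpNl x y : dotp (- x) y = - dotp x y.
Proof. by rewrite -scaleN1r dotpZl mulN1r. Qed.

Lemma dotpNr x y : dotp x (- y) = - dotp x y.
Proof. by rewrite dotpC dotpNl dotpC. Qed.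

Definition dotpE := (dotpDl, dotpDr, dotpNl, dotpNr, dotpZl, dotpZr).

Lemma dotp_ge0 x : 0 <= dotp x x.
Proof. by apply: sumr_ge0 => i _; exact: sqr_ge0. Qed.

Lemma dotp_coord_le x i : x 0 i ^+ 2 <= dotp x x.
Proof.
rewrite /dotp (bigD1 i) //= expr2 lerDl.
by apply: sumr_ge0 => j _; exact: sqr_ge0.
Qed.

Lemma dotp_eq0 x : (dotp x x == 0) = (x == 0).
Proof.
apply/eqP/eqP => [x0|->]; last first.
  by rewrite /dotp big1 // => i _; rewrite mxE mul0r.
apply/rowP => i; apply/eqP; rewrite mxE -sqrf_eq0 eq_le sqr_ge0 andbT -x0.
exact: dotp_coord_le.
Qed.

Lemma dotp_gt0 x : x != 0 -> 0 < dotp x x.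
Proof. by move=> x0; rewrite lt_def dotp_eq0 x0 dotp_ge0. Qed.

Lemma cauchy_schwarz x y : dotp x y ^+ 2 <= dotp x x * dotp y y.
Proof.
have [->|y0] := eqVneq y 0.
  by rewrite -[0](scale0r x) !dotpZr !mul0r expr0n mulr0.
have yy := dotp_gt0 _ y0.
have := dotp_ge0 (dotp y y *: x - dotp x y *: y).
rewrite !dotpE (dotpC y x) => H.
have {}H : 0 <= dotp y y * (dotp x x * dotp y y - dotp x y ^+ 2).
  by apply: le_trans H _; rewrite le_eqVlt; apply/orP; left; apply/eqP; ring.
by move: H; rewrite pmulr_rge0 // subr_ge0.
Qed.

Lemma dotpD_le x y : dotp (x + y) (x + y) <= 2 * dotp x x + 2 * dotp y y.
Proof. have := dotp_ge0 (x - y); rewrite !dotpE (dotpC y x); lra. Qed.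

Lemma dotpB_le x y : dotp (x - y) (x - y) <= 2 * dotp x x + 2 * dotp y y.
Proof. have := dotp_ge0 (x + y); rewrite !dotpE (dotpC y x); lra. Qed.

Lemma enorm_ge0 x : 0 <= enorm x.
Proof. exact: sqrtr_ge0. Qed.

Lemma enorm_sqr x : enorm x ^+ 2 = dotp x x.
Proof. by rewrite sqr_sqrtr // dotp_ge0. Qed.

Lemma enorm_le x L : 0 <= L -> (enorm x <= L) = (dotp x x <= L ^+ 2).
Proof.
by move=> L0; rewrite -enorm_sqr ler_pXn2r // ?nnegrE ?enorm_ge0.
Qed.

Lemma enorm_cube x L : 0 <= L -> dotp x x <= L ^+ 2 -> cube L x.
Proof.
move=> L0 xL i; rewrite -(ler_pXn2r (n := 2)) ?nnegrE // real_normK ?num_real //.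
exact: le_trans (dotp_coord_le _ _) xL.
Qed.

Lemma continuous_dotp {S : topologicalType} (f g : S -> 'rV[R]_d) (s : S) :
  {for s, continuous f} -> {for s, continuous g} ->
  {for s, continuous (fun t => dotp (f t) (g t))}.
Proof.
move=> cf cg; rewrite /prop_for /continuous_at /dotp.
apply: cvg_big => [|i _]; first exact: add_continuous.
apply: cvgM; first exact: (cvg_comp _ _ cf (@coord_continuous _ _ _ 0 i (f s))).
exact: (cvg_comp _ _ cg (@coord_continuous _ _ _ 0 i (g s))).
Qed.

Lemma near_dotp_lt x e : 0 < e -> \forall y \near x, dotp (y - x) (y - x) < e.
Proof.
move=> e0.
have cs : {for x, continuous (fun y : 'rV[R]_d => y - x)}.
  by apply: (@cvgB _ _ _ (nbhs x)); [exact: cvg_id|exact: cvg_cst].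
have := continuous_dotp _ _ _ cs cs.
rewrite /prop_for /continuous_at subrr => /cvgr_lt; apply.
by rewrite /dotp big1 // => i _; rewrite mxE mul0r.
Qed.

Lemma nbhs_dotp x (A : set 'rV[R]_d) : nbhs x A ->
  exists2 e, 0 < e & forall y, dotp (y - x) (y - x) < e -> A y.
Proof.
move=> /nbhs_ballP[e /= e0 xA]; exists (e ^+ 2); first by rewrite exprn_gt0.
move=> y xy; apply: xA; split=> // i j; rewrite ord1.
have H : `|y 0 j - x 0 j| < e.
  rewrite -(ltr_pXn2r (n := 2)) ?nnegrE ?normr_ge0 ?(ltW e0) //.
  rewrite real_normK ?num_real //.
  by apply: le_lt_trans xy; have := dotp_coord_le (y - x) j; rewrite !mxE.
by rewrite /ball /= distrC.
Qed.

Lemma derive_along_line h x v (s : R) :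
  'D_1 (fun r : R => h (r *: v + x)) s = 'D_v h (s *: v + x).
Proof.
rewrite /derive; set F := (X in lim (X @ _) = _); set G := (X in _ = lim (X @ _)).
suff -> : F = G by [].
by apply/funext => r; rewrite /F /G /= [r%:A]mulr1 scalerDl addrA.
Qed.

Lemma derivable_along_line h x v (s : R) : derivable h (s *: v + x) v ->
  derivable (fun r : R => h (r *: v + x)) s 1.
Proof.
rewrite /derivable.
set F := (X in cvg (X @ _) -> _); set G := (X in _ -> cvg (X @ _)).
suff -> : F = G by [].
by apply/funext => r; rewrite /F /G /= [r%:A]mulr1 scalerDl addrA.
Qed.

Lemma level_rolle h x y : C1_on setT h -> h x = h y ->
  exists2 s, 0 <= s <= 1 & dotp (grad h (s *: (x - y) + y)) (x - y) = 0.
Proof.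
move=> C1h hxy; pose k (r : R) := h (r *: (x - y) + y).
have dk r : derivable k r 1.
  by apply: derivable_along_line; exact: C1_on_derivable C1h Logic.I.
have ck : {within `[0, 1], continuous k}.
  apply: continuous_subspaceT => r; apply: differentiable_continuous.
  exact/derivable1_diffP.
have kE : k 0 = k 1 by rewrite /k scale0r add0r scale1r subrK.
have [c] := @Rolle R k 0 1 ltr01 (fun r _ => dk r) ck kE.
rewrite in_itv /= => /andP[c0 c1] [_ Dc]; exists c; first by rewrite !ltW.
rewrite -grad_derive; last by have [] := C1h (c *: (x - y) + y) Logic.I.
by rewrite -derive_along_line.
Qed.

Lemma derive_gt0_right h x v : derivable h x v -> 0 < 'D_v h x -> h x = 0 ->
  \forall s \near (0 : R)^'+, 0 < h (s *: v + x).
Proof.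
move=> dh D0 hx.
have : \forall s \near (0 : R)^', 0 < s^-1 *: (h (s *: v + x) - h x).
  by have /cvgr_gt/(_ _ D0) := dh.
move=> H.
have : \forall s \near (0 : R)^'+, 0 < s^-1 *: (h (s *: v + x) - h x).
  move: H; rewrite !near_withinE; apply: filterS => s H s0; apply: H.
  by rewrite gt_eqF.
move=> /filterI/(_ (nbhs_right_gt (0 : R))); apply: filterS => s [+ s0].
by rewrite hx subr0 /GRing.scale /= pmulr_rgt0 // invr_gt0.
Qed.

(** Let c be the part of b orthogonal to a. Testing v = c - e a gives |c|^2 <= e l |a|^2 for every e
    > 0, hence c = 0; testing v = - a gives the sign of l. *)
Lemma half_space_parallel (a b : 'rV[R]_d) : a != 0 -> b != 0 ->
  (forall v, dotp a v < 0 -> dotp b v <= 0) ->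
  exists2 l : R, 0 < l & b = l *: a.
Proof.
move=> a0 b0 H; have aa := dotp_gt0 _ a0.
pose l := dotp b a / dotp a a.
have lE : dotp b a = l * dotp a a by rewrite /l divfK ?gt_eqF.
have [c cE] : exists c, c = b - l *: a by exists (b - l *: a).
have ac : dotp a c = 0 by rewrite cE !dotpE (dotpC a b) lE subrr.
have bc : dotp b c = dotp c c.
  by rewrite cE !dotpE (dotpC a b) lE; ring.
have c0 : c = 0.
  apply/eqP; rewrite -dotp_eq0 eq_le dotp_ge0 andbT leNgt; apply/negP => cc.
  have key e : 0 < e -> dotp c c <= e * (l * dotp a a).
    move=> e0; have := H (c - e *: a); rewrite !dotpE ac bc lE sub0r.
    by rewrite oppr_lt0 mulr_gt0 // subr_le0; apply.
  move: (l * dotp a a) key => m key; have [la|la] := ltP 0 m.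
    have e0 : 0 < dotp c c / (2 * m) by rewrite divr_gt0 // mulr_gt0.
    by have := key _ e0; rewrite invfM mulrA divfK ?gt_eqF //; lra.
  by have := key 1 ltr01; rewrite mul1r; lra.
have bE : b = l *: a by apply/eqP; rewrite -subr_eq0 -cE c0.
exists l => //; rewrite lt_def; apply/andP; split.
  by apply: contra b0; rewrite bE => /eqP ->; rewrite scale0r.
rewrite -oppr_le0; have := H (- a); rewrite !dotpE oppr_lt0 lE => /(_ aa).
by rewrite -mulNr pmulr_lle0.
Qed.

End Euclid.

(** * Local defining functions of the domain *)

Section Charts.
Context {R : realType} {d : nat}.
Implicit Types (x y z v : 'rV[R]_d) (h rho : 'rV[R]_d -> R)
  (U Omega : set 'rV[R]_d).

Definition pospart_sqr (s : R) : R := Num.max 0 s ^+ 2.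

Lemma is_derive_pospart_sqr (s : R) :
  is_derive s 1 pospart_sqr (2 * Num.max 0 s).
Proof.
have [s0|s0|<-] := ltgtP 0 s.
- apply: (@near_eq_is_derive R R R (fun t : R => t ^+ 2) pospart_sqr s 1).
    have := lt_nbhsr s0; apply: filterS => t t0.
    by rewrite /pospart_sqr max_r // ltW.
  by apply: is_derive_eq; rewrite [s%:A]mulr1 mulr_natl.
- apply: (@near_eq_is_derive R R R (fun _ : R => 0 : R) pospart_sqr s 1 (2 * 0)).
    have := lt_nbhsl s0; apply: filterS => t t0.
    by rewrite /pospart_sqr max_l ?ltW // expr0n.
  by apply: is_derive_eq; rewrite mulr0.
rewrite mulr0; have D : derivable pospart_sqr 0 1 /\ 'D_1 pospart_sqr 0 = 0.
  suff H : (r^-1 *: (pospart_sqr (r%:A + 0) - pospart_sqr 0) @[r --> (0 : R)^'] --> (0:R)).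
    by split; [apply/cvg_ex; exists 0|exact: cvg_lim].
  apply/cvgr0Pnorm_lt => e e0; near=> r.
  have r0 : r != 0 by near: r; exact: nbhs_dnbhs_neq.
  rewrite addr0 [r%:A]mulr1 /pospart_sqr maxxx expr0n subr0.
  rewrite /GRing.scale /= normrM normfV normrX.
  have [rp|rn] := leP 0 r; last by rewrite normr0 expr0n mulr0.
  rewrite expr2 mulKf ?normr_eq0 //; near: r; exact: dnbhs0_lt.
by case: D => D1 D2; exact: DeriveDef.
Unshelve. all: by end_near. Qed.

(** A C^1 cutoff made of two clampings by [pospart_sqr], which is flat on the negative half-line:
    the outer one is at rest for s <= 1, the inner one for s >= 2. *)
Definition plateau (s : R) : R :=
  1 - pospart_sqr (1 - pospart_sqr (2 - s)).

Lemma plateau1 s : s <= 1 -> plateau s = 1.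
Proof.
move=> s1; have h1 : 1 <= Num.max 0 (2 - s) by rewrite le_max; apply/orP; right; lra.
have : 1 <= pospart_sqr (2 - s) by rewrite /pospart_sqr exprn_ege1.
by move=> h; rewrite /plateau {1}/pospart_sqr max_l ?expr0n ?subr0 // subr_le0.
Qed.

Lemma plateau0 s : 2 <= s -> plateau s = 0.
Proof.
move=> s2; have -> : plateau s = 1 - pospart_sqr (1 - 0).
  by rewrite /plateau {2}/pospart_sqr [X in X ^+ 2]max_l ?expr0n // subr_le0.
by rewrite subr0 /pospart_sqr max_r // expr1n subrr.
Qed.

Lemma C1_on_pospart_sqr h : C1_on setT h -> C1_on setT (fun x => pospart_sqr (h x)).
Proof.
move=> C1h; have [] := @C1_on_comp _ _ setT h pospart_sqr
  (fun s => 2 * Num.max 0 s) openT is_derive_pospart_sqr _ C1h; last by [].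
move=> s; apply: cvgM; first exact: cvg_cst.
by apply: continuous_max; [exact: cst_continuous|exact: cvg_id].
Qed.

Lemma C1_on_plateau h : C1_on setT h -> C1_on setT (fun x => plateau (h x)).
Proof.
have C1B h1 k : C1_on setT h1 -> C1_on setT (fun x => k - h1 x).
  move=> C1; have -> : (fun x => k - h1 x) = (fun x => k + (-1) * h1 x).
    by apply/funext => x; rewrite mulN1r.
  by apply: C1_onD => //; [exact: openT|exact: C1_on_cst|
    apply: C1_on_scale => //; exact: openT].
move=> C1h; apply: (C1B); apply: C1_on_pospart_sqr.
by apply: (C1B); apply: C1_on_pospart_sqr; exact: C1B.
Qed.

(** Test functions must be C^1 around all of (0, T) x closure Omega, while rho is given on U only. A
    cutoff makes it global without changing it near x. *)
Lemma local_defining_extend Omega x U rho : local_defining Omega x U rho ->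
  exists U' rho', local_defining Omega x U' rho' /\ C1_on setT rho'.
Proof.
move=> [oU Ux C1rho grho OmU].
have [e e0 He] := nbhs_dotp _ _ (open_nbhs_nbhs (conj oU Ux)).
(* The set q < 3 lies in U, and the cutoff vanishes for q >= 2. So the open sets q < 3 and 2 < q
   cover the space, and the product is C^1 on each. *)
pose q y := 3 / e * dotp (y - x) (y - x).
have C1q : C1_on setT q.
  by apply: C1_on_scale; [exact: openT|exact: C1_on_sqdist].
have cq : continuous q by move=> y; exact: C1_on_continuous C1q Logic.I.
have qU y : q y < 3 -> U y.
  move=> qy; apply: He; move: qy; rewrite /q mulrAC ltr_pdivrMr //.
  by rewrite ltr_pM2l.
have qx : q x = 0 by rewrite /q subrr /dotp big1 ?mulr0 // => i _; rewrite mxE mul0r.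
pose rho' y := plateau (q y) * rho y.
have oA : open [set y | q y < 3].
  by apply: (@open_comp _ _ q [set s | s < 3]) => [y _|]; [exact: cq|exact: open_lt].
have oB : open [set y | 2 < q y].
  by apply: (@open_comp _ _ q [set s | 2 < s]) => [y _|]; [exact: cq|exact: open_gt].
have oU' : open [set y | q y < 1].
  by apply: (@open_comp _ _ q [set s | s < 1]) => [y _|]; [exact: cq|exact: open_lt].
have C1rho' : C1_on setT rho'.
  move=> y _; have [q3|q3] := ltP (q y) 3.
    have : C1_on [set y | q y < 3] rho'.
      apply: (C1_onM _ _ _ oA); last by apply: C1_on_sub C1rho => z; exact: qU.
      by apply: C1_on_sub (C1_on_plateau _ C1q).
    by apply.
  have : C1_on [set y | 2 < q y] rho'.
    apply: (@C1_on_near_eq _ _ _ rho' (fun=> 0)) => //; last exact: C1_on_cst.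
    by move=> z /= qz; rewrite /rho' plateau0 ?mul0r // ltW.
  by apply => /=; lra.
have rhoE y : q y < 1 -> rho' y = rho y.
  by move=> qy; rewrite /rho' plateau1 ?mul1r // ltW.
exists [set y | q y < 1], rho'; split; last exact: C1rho'.
split; first exact: oU'.
- by rewrite /= qx ltr01.
- exact: C1_on_sub C1rho'.
- move=> y /= qy; have -> : grad rho' y = grad rho y.
    apply/rowP => i; rewrite !mxE; apply: near_eq_derive.
    have := open_nbhs_nbhs (conj oU' (qy : [set y | q y < 1] y)).
    by apply: filterS => z; exact: rhoE.
  by apply: grho; apply: qU; lra.
- apply/seteqP; split=> y [/= H qy]; split => //.
    have : (Omega `&` U) y by split => //; apply: qU; lra.
    by rewrite OmU => -[/=]; rewrite rhoE.
  have : (Omega `&` U) y.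
    by rewrite OmU; split; [rewrite /= -rhoE|apply: qU; lra].
  by case.
Qed.

Lemma local_defining_closure Omega x U rho y : local_defining Omega x U rho ->
  closure Omega y -> U y -> rho y <= 0.
Proof.
move=> [oU Ux C1rho grho OmU] cy Uy; rewrite leNgt; apply/negP => ry.
have crho := C1_on_continuous _ _ _ C1rho Uy.
have /cy[z [Oz [rz Uz]]] : nbhs y ([set z | 0 < rho z] `&` U).
  apply: filterI; last exact: open_nbhs_nbhs.
  by have /cvgr_gt/(_ _ ry) := crho.
have : (Omega `&` U) z by [].
by rewrite OmU => -[/= rz' _]; have := lt_trans rz rz'; rewrite ltxx.
Qed.

Lemma local_defining_inside Omega x U rho y : local_defining Omega x U rho ->
  U y -> Omega y <-> rho y < 0.
Proof.
move=> [_ _ _ _ OmU] Uy; split=> [Oy|ry].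
  have : (Omega `&` U) y by [].
  by rewrite OmU => -[].
have : (Omega `&` U) y by rewrite OmU; split.
by case.
Qed.

Lemma boundaryP Omega x : open Omega ->
  boundary Omega x <-> closure Omega x /\ ~ Omega x.
Proof. by move=> oO; rewrite /boundary; have /interior_id -> := oO. Qed.

Lemma local_defining_boundary Omega x U rho y : open Omega ->
  local_defining Omega x U rho -> boundary Omega y -> U y -> rho y = 0.
Proof.
move=> oO LD /(boundaryP _ _ oO)[cy nOy] Uy; apply/eqP.
rewrite eq_le (local_defining_closure _ _ _ _ _ LD) //= leNgt; apply/negP => ry.
by apply: nOy; rewrite (local_defining_inside _ _ _ _ _ LD).
Qed.

Lemma local_defining_at Omega x U rho y : local_defining Omega x U rho -> U y ->
  local_defining Omega y U rho.
Proof. by move=> [oU Ux C1rho grho OmU] Uy; split. Qed.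

(** A direction along which rho1 decreases enters Omega, so rho2 cannot increase along it;
    [half_space_parallel] concludes. This relates the defining function behind n to the one of the
    chart in use. *)
Lemma local_defining_normal Omega x U1 U2 rho1 rho2 : open Omega ->
  boundary Omega x -> local_defining Omega x U1 rho1 ->
  local_defining Omega x U2 rho2 ->
  exists2 l : R, 0 < l & grad rho2 x = l *: grad rho1 x.
Proof.
move=> oO bx LD1 LD2; have [oU1 U1x C1 g1 Om1] := LD1.
have [oU2 U2x C2 g2 Om2] := LD2.
apply: half_space_parallel; [exact: g1|exact: g2|] => v.
have [d1 _] := C1 x U1x; have [d2 _] := C2 x U2x.
rewrite -!grad_derive // => D1; rewrite leNgt; apply/negP => D2.
have r1 := local_defining_boundary _ _ _ _ _ oO LD1 bx U1x.
have r2 := local_defining_boundary _ _ _ _ _ oO LD2 bx U2x.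
have n2 : \forall s \near (0 : R)^'+, 0 < rho2 (s *: v + x).
  by apply: derive_gt0_right => //; exact: diff_derivable.
have n1 : \forall s \near (0 : R)^'+, 0 < (- rho1) (s *: v + x).
  apply: derive_gt0_right; last by rewrite fctE r1 oppr0.
    by apply: derivableN; exact: diff_derivable.
  by rewrite deriveN ?oppr_gt0 //; exact: diff_derivable.
have nU : \forall s \near (0 : R)^'+, (U1 `&` U2) (s *: v + x).
  have cl : {for (0 : R), continuous (fun s : R => s *: v + x)}.
    apply: (@cvgD _ _ _ (nbhs (0 : R))); last exact: cvg_cst.
    by apply: cvgZr_tmp; exact: cvg_id.
  apply: cvg_within; apply: cl; rewrite scale0r add0r.
  by apply: open_nbhs_nbhs; split; [exact: openI|].
have : \forall s \near (0 : R)^'+, [/\ 0 < (- rho1) (s *: v + x),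
    0 < rho2 (s *: v + x) & (U1 `&` U2) (s *: v + x)].
  by near=> s; split; near: s.
move=> /filter_ex[s [s1 s2 [U1s U2s]]].
have : Omega (s *: v + x).
  apply/(local_defining_inside _ _ _ _ _ LD1) => //.
  by move: s1; rewrite fctE oppr_gt0.
move/(local_defining_inside _ _ _ _ _ LD2 U2s) => /(lt_trans s2).
by rewrite ltxx.
Unshelve. all: by end_near. Qed.

End Charts.

(** * Viscosity inequalities as conditions on slopes *)

Section ViscosityTests.
Context {R : realType} {d : nat}.
Local Notation space := 'rV[R]_d.
Local Notation ST := (R * 'rV[R]_d)%type.
Implicit Types (g : R -> R) (h rho : space -> R) (X Y P : ST) (p : space)
  (Omega : set space) (H F G : ST -> space -> R) (w : ST -> R).

Lemma continuous_row {S : topologicalType} (f : S -> space) (s : S) :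
  (forall i, {for s, continuous (fun t => f t 0 i)}) -> {for s, continuous f}.
Proof.
move=> cf A [Q Qf QA].
have : \forall t \near s, forall i : 'I_d, Q 0 i (f t 0 i).
  by apply: filter_forall => i; apply: cf; exact: Qf.
by apply: filterS => t Qt; apply: QA => i j; rewrite ord1.
Qed.

Lemma continuous_grad h : C1_on setT h -> continuous (grad h).
Proof.
move=> C1h x; apply: continuous_row => i; have [_ /(_ (delta_mx 0 i))] := C1h x Logic.I.
have -> // : (fun t => grad h t 0 i) = 'D_(delta_mx 0 i) h.
by apply/funext => t; rewrite mxE.
Qed.

Lemma viscosity_touch T Omega H G w g h X :
  viscosity_subsolution T Omega H G w ->
  C1_on [set t | t < T] g -> C1_on setT h -> Qopen T Omega X ->
  (\forall Y \near X, Qopen T Omega Y ->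
    w Y - (g Y.1 + h Y.2) <= w X - (g X.1 + h X.2)) ->
  (Omega X.2 -> 'D_1 g X.1 + H X (grad h X.2) <= 0) /\
  (boundary Omega X.2 -> 'D_1 g X.1 + G X (grad h X.2) <= 0).
Proof.
move=> subw C1g C1h QX mX.
(* The added constant makes the values at X agree, so that a local maximum of w - g - h is
   enough. *)
pose g' t := g t + (w X - (g X.1 + h X.2)).
have oT : open [set t : R | t < T] by exact: open_lt.
have C1g' : C1_on [set t | t < T] g' by apply: C1_onD => //; exact: C1_on_cst.
have XT : [set t | t < T] X.1 by case: QX => /=; rewrite in_itv /= => /andP[].
have Dg' : 'D_1 g' X.1 = 'D_1 g X.1.
  rewrite deriveD ?derive_cst ?addr0 //; exact: C1_on_derivable C1g XT.
pose phi Y := g' Y.1 + h Y.2.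
have C1phi := C1_on_separated _ _ _ oT C1g' C1h.
rewrite -Dg' -(dt_separated _ _ _ _ XT C1g' C1h) -(Dx_separated _ _ _ _ XT C1g' C1h).
apply: (subw phi) => //.
  exists [set Y | Y.1 < T]; split => //; last first.
    by move=> Y [/=]; rewrite in_itv /= => /andP[].
  by apply: (@open_comp _ _ fst [set t | t < T]) => // Y _; exact: cvg_fst.
split; first by rewrite /phi /g'; ring.
rewrite near_withinE; apply: filterS mX => Y /[apply]; rewrite /phi /g'; lra.
Qed.

(** For w = - v, the inequality v_t + G(X, Dv) >= 0 reads w_t - G(X, - Dw) <= 0, and max becomes
    min. A slope q for u is then paired with the slope - q for - v. *)
Definition opp_operator H : ST -> space -> R := fun X p => - H X (- p).

Lemma viscosity_reflect T Omega H F w :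
  viscosity_supersolution T Omega H (maxH F H) w ->
  viscosity_subsolution T Omega (opp_operator H) (minH (opp_operator F) (opp_operator H))
    (fun X => - w X).
Proof.
move=> supw phi X [U [oU QU C1phi]] QX [phiX tX].
have UX := QU _ QX.
have dphi v : 'D_v (fun Y => - phi Y) X = - 'D_v phi X.
  by rewrite deriveN //; exact: C1_on_derivable C1phi UX.
have dtE : dt (fun Y => - phi Y) X = - dt phi X by exact: dphi.
have DxE : Dx (fun Y => - phi Y) X = - Dx phi X.
  by apply/rowP => i; rewrite [LHS]mxE [RHS]mxE [in RHS]mxE; exact: dphi.
have tf : test_function T Omega (fun Y => - phi Y).
  exists U; split => //; have -> : (fun Y => - phi Y) = (fun Y => (-1) * phi Y).
    by apply/funext => Y; rewrite mulN1r.
  exact: C1_on_scale.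
have tb : touches_from_below (Qopen T Omega) (fun Y => - phi Y) w X.
  by split; [rewrite phiX opprK|apply: filterS tX => Y; rewrite lerNl].
have [H1 H2] := supw _ X tf QX tb.
rewrite /minH /maxH /opp_operator -oppr_max in H1 H2 *; rewrite dtE DxE in H1 H2.
by split => [/H1|/H2]; lra.
Qed.

(** Left side of the equation for the test function g + h - q rho: q is the slope with respect to r
    = - rho, which increases inwards. *)
Definition slope_op H g h rho X (q : R) :=
  'D_1 g X.1 + H X (grad h X.2 - q *: grad rho X.2).

Lemma viscosity_tested T Omega H G w g h rho (D O : set ST) X q c :
  viscosity_subsolution T Omega H G w ->
  C1_on [set t | t < T] g -> C1_on setT h -> C1_on setT rho ->
  Qopen T Omega X -> open O -> O X -> O `&` Qopen T Omega `<=` D ->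
  (\forall Y \near X, D Y ->
    w Y - (g Y.1 + h Y.2) - (q * - rho Y.2 + c * (- rho Y.2) ^+ 2) <=
    w X - (g X.1 + h X.2) - (q * - rho X.2 + c * (- rho X.2) ^+ 2)) ->
  (Omega X.2 -> slope_op H g h rho X (q + 2 * c * - rho X.2) <= 0) /\
  (boundary Omega X.2 -> slope_op G g h rho X (q + 2 * c * - rho X.2) <= 0).
Proof.
move=> subw C1g C1h C1r QX oO OX OD mX.
have oT := @openT space.
pose h' x := h x + (- q * rho x + c * (rho x * rho x)).
have C1rr := C1_onM _ _ _ oT C1r C1r.
have C1qr := C1_on_scale _ _ (- q) oT C1r.
have C1cr := C1_on_scale _ _ c oT C1rr.
have C1s := C1_onD _ _ _ oT C1qr C1cr.
have C1h' : C1_on setT h' by exact: C1_onD.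
(* The level part - q rho + c rho^2 has gradient - (q + 2 c (- rho)) grad rho; the factor is the
   derivative of q r + c r^2 at r = - rho. *)
have gh' : grad h' X.2 = grad h X.2 - (q + 2 * c * - rho X.2) *: grad rho X.2.
  rewrite (gradD _ _ _ C1h C1s) (gradD _ _ _ C1qr C1cr) (grad_scale _ _ _ C1r).
  rewrite (grad_scale _ _ _ C1rr) (gradM _ _ _ C1r C1r).
  by apply/rowP => i; rewrite !mxE; ring.
rewrite /slope_op -gh'; apply: (viscosity_touch T Omega H G w) => //.
have nO : \forall Y \near X, O Y by apply: open_nbhs_nbhs.
move: mX nO; apply: filterS2 => Y mY OY QY.
by have := mY (OD _ (conj OY QY)); rewrite /h' !sqrrN !expr2 !mulrN; lra.
Qed.

Definition joint_lsc (A : set ST) H := forall X p, A X -> forall c, c < H X p ->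
  \forall Z \near (X, p), A Z.1 -> c < H Z.1 Z.2.

Lemma near_pair {S1 S2 : topologicalType} (x : S1) (y : S2)
    (A : S1 * S2 -> Prop) : (\forall z \near (x, y), A z) ->
  exists2 B : set S2, nbhs y B & \forall x' \near x, forall y', B y' -> A (x', y').
Proof.
move=> [[B C] [nB nC] BC]; exists C => //; apply: filterS nB => x' Bx' y' Cy'.
by apply: BC; split.
Qed.

Lemma slope_op_stable T Omega H g h rho (D : set ST) P :
  joint_lsc (Qcl T Omega) H ->
  C1_on [set t | t < T] g -> C1_on setT h -> C1_on setT rho ->
  D `<=` Qcl T Omega -> D P -> P.1 < T ->
  stable_positivity D P (slope_op H g h rho).
Proof.
move=> lscH C1g C1h C1r DQ DP PT q hq.
pose p := grad h P.2 - q *: grad rho P.2.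
(* The positive value 2 e is shared equally between the possible losses of H and of the time
   derivative. *)
pose e := slope_op H g h rho P q / 2.
have e0 : 0 < e by rewrite divr_gt0.
have He : H P p - e < H P p by rewrite ltrBlDr ltrDl.
have nH := lscH P p (DQ _ DP) _ He.
pose f (Z : ST * R) := (Z.1, grad h Z.1.2 - Z.2 *: grad rho Z.1.2).
have cgr (k : space -> R) (Z : ST * R) : C1_on setT k ->
    {for Z, continuous (fun Z : ST * R => grad k Z.1.2)}.
  move=> C1k; have ck := continuous_grad _ C1k.
  have c2 : continuous (fun X : ST => grad k X.2) by exact: continuous_snd.
  exact: (continuous_fst _ c2).
have cl : {for (P, q), continuous (fun Z : ST * R => (f Z).2)}.
  apply: (@cvgB _ _ _ (nbhs (P, q))); first exact: cgr.
  by apply: (@cvgZ _ _ _ (nbhs (P, q))); [exact: cvg_snd|exact: cgr].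
have {}nH : \forall Z \near (P, q), Qcl T Omega (f Z).1 -> H P p - e < H (f Z).1 (f Z).2.
  have [[A1 A2] [/= nA1 nA2] A12] := nH.
  have n1 := near_fst P q A1 nA1; have n2 := cl _ nA2.
  by move: n1 n2; apply: filterS2 => Z ? ?; apply: (A12 (f Z)).
have [B nB HB] := near_pair _ _ _ nH.
have [_ cg] := C1g P.1 PT.
have nD : \forall X \near P, 'D_1 g P.1 - e < 'D_1 g X.1.
  have Dge : 'D_1 g P.1 - e < 'D_1 g P.1 by rewrite ltrBlDr ltrDl.
  have /cvgr_gt/(_ _ Dge)/(near_fst _ P.2) := cg 1.
  by rewrite -surjective_pairing.
move/nbhs_ballP: nB => [r /= r0 rB]; exists (r / 2); first by rewrite divr_gt0.
move: HB nD; apply: filterS2 => X HX DX' DX q' qq'.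
have : H P p - e < H X (grad h X.2 - q' *: grad rho X.2).
  apply: (HX q'); last exact: DQ.
  apply: rB; rewrite /ball /= distrC; apply: le_lt_trans qq' _.
  by rewrite ltr_pdivrMr // ltr_pMr // ltr1n.
move: DX'; rewrite /slope_op => DX' HX'.
have eE : 2 * e = 'D_1 g P.1 + H P p by rewrite /e mulrC divfK.
by clearbody e; lra.
Qed.

End ViscosityTests.

(** * Coercivity along slopes, and functions touched by a test function *)

Section Structure.
Context {R : realType} {d : nat}.
Local Notation space := 'rV[R]_d.
Local Notation ST := (R * 'rV[R]_d)%type.
Implicit Types (g : R -> R) (h rho : space -> R) (X Y P Q : ST) (p : space)
  (Omega U : set space) (H F : ST -> space -> R) (w : ST -> R) (D O : set ST).

Lemma H_i_joint_lsc T Omega H : H_i T Omega H ->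
  joint_lsc (Qcl T Omega) H /\ joint_lsc (Qcl T Omega) (opp_operator H).
Proof.
move=> cH; have near_H (B : set R) X p : Qcl T Omega X -> nbhs (H X p) B ->
    \forall Z \near (X, p), Qcl T Omega Z.1 -> B (H Z.1 Z.2).
  move=> QX nB; have := cH (X, p) B nB.
  move=> nB'; have {nB'} : within (Qcl T Omega `*` setT) (nbhs (X, p))
      (fun Z => B (H Z.1 Z.2)).
    by rewrite (@nbhs_subspace_in _ (Qcl T Omega `*` setT) (X, p)).
  by rewrite /within /=; apply: filterS => Z hZ QZ; exact: hZ.
split=> X p QX c cX.
  by have := near_H [set s | c < s] X p QX (lt_nbhsr cX).
have cX' : H X (- p) < - c by rewrite ltrNr.
have nH := near_H [set s | s < - c] X (- p) QX (lt_nbhsl cX').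
have [[B1 B2] [/= nB1 nB2] B12] := nH.
have n1 := near_fst X p B1 nB1.
have n2 : \forall p' \near p, B2 (- p') by exact: (cvgN cvg_id nB2).
move: n1 (near_snd X p _ n2); apply: filterS2 => Z B1Z B2Z QZ.
by rewrite /opp_operator ltrNr; apply: (B12 (Z.1, - Z.2)).
Qed.

Lemma H_iv_coercive T Omega H : H_iv T Omega H -> forall M : R,
  exists2 L, 0 <= L & forall X p, Qcl T Omega X -> L <= enorm p -> M < H X p.
Proof.
move=> cH M; have : nbhs (+oo%E : \bar R) [set x | (M%:E < x)%E].
  by exists M; split => //; rewrite num_real.
move=> /cH [r [_ Hr]]; exists (`|r| + 1); first by rewrite addr_ge0.
move=> X p QX rp.
have := Hr (`|r| + 1) _ p rp => /=.
have -> : r < `|r| + 1 by rewrite (le_lt_trans (ler_norm r)) // ltrDl.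
move=> /(_ isT) /lt_le_trans/(_ (ereal_inf_lbound _)) => /(_ (H X p)%:E).
by rewrite lte_fin; apply; exists X.
Qed.

Lemma F_iv_coercive T Omega n F : F_iv T Omega n F -> forall M L : R, 0 < L ->
  exists K : R, forall q X p, q <= - K -> Qlat T Omega X -> cube L p ->
    M < F X (p - q *: n X.2).
Proof.
move=> cF M L L0; have : nbhs (+oo%E : \bar R) [set x | (M%:E < x)%E].
  by exists M; split => //; rewrite num_real.
move=> /(cF _ L0) [r [_ Hr]]; exists (`|r| + 1).
move=> q X p qr QX pL.
have := Hr q => /=.
have -> : q < r.
  by apply: le_lt_trans qr _; have := ler_norm (- r); rewrite normrN; lra.
move=> /(_ isT) /lt_le_trans/(_ (ereal_inf_lbound _)).
move=> /(_ (F X (p - q *: n X.2))%:E).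
by rewrite lte_fin; apply; exists (X, p).
Qed.

Lemma slope_op_coercive T Omega H g h rho D P : H_iv T Omega H ->
  C1_on [set t | t < T] g -> C1_on setT h -> C1_on setT rho ->
  D `<=` Qcl T Omega -> P.1 < T -> grad rho P.2 != 0 ->
  exists K : R, \forall X \near P, D X ->
    forall q, K <= `|q| -> 0 < slope_op H g h rho X q.
Proof.
move=> Hco C1g C1h C1r DQ PT gr0.
have m0 := dotp_gt0 _ gr0; set m := dotp _ _ in m0.
pose A := dotp (grad h P.2) (grad h P.2) + 1.
have [L L0 HL] := H_iv_coercive _ _ _ Hco (1 - 'D_1 g P.1).
(* If the gradient had norm below L, then q^2 m / 2 <= 2 L^2 + 2 A. Since K >= 1, the condition on q
   gives q^2 >= K, which contradicts this. *)
pose K := 4 * (L ^+ 2 + A) / m + 1; exists K.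
have A0 : 0 <= A by rewrite addr_ge0 ?dotp_ge0.
have S0 : 0 <= 4 * (L ^+ 2 + A) by rewrite mulr_ge0 // addr_ge0 // exprn_ge0.
have cgg (k : space -> R) : C1_on setT k -> {for P, continuous
    (fun X : ST => dotp (grad k X.2) (grad k X.2))}.
  move=> C1k; have ck := continuous_grad _ C1k.
  have c2 : continuous (fun X : ST => grad k X.2) by exact: continuous_snd.
  by apply: continuous_dotp; exact: c2.
have n1 : \forall X \near P, m / 2 < dotp (grad rho X.2) (grad rho X.2).
  have mm : m / 2 < m by lra.
  by have /cvgr_gt/(_ _ mm) := cgg _ C1r.
have n2 : \forall X \near P, dotp (grad h X.2) (grad h X.2) < A.
  have mm : dotp (grad h P.2) (grad h P.2) < A by rewrite ltrDl.
  by have /cvgr_lt/(_ _ mm) := cgg _ C1h.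
have [_ cg] := C1g P.1 PT.
have n3 : \forall X \near P, 'D_1 g P.1 - 1 < 'D_1 g X.1.
  have Dge : 'D_1 g P.1 - 1 < 'D_1 g P.1 by lra.
  have /cvgr_gt/(_ _ Dge)/(near_fst _ P.2) := cg 1.
  by rewrite -surjective_pairing.
move: n1 n2 n3; apply: filterS3 => X X1 X2 X3 DX q Kq.
rewrite /slope_op; set b := grad rho X.2 in X1 *; set a := grad h X.2 in X2 *.
suff : 1 - 'D_1 g P.1 < H X (a - q *: b) by lra.
apply: HL; first exact: DQ.
rewrite leNgt; apply/negP => pL.
have : dotp (a - q *: b) (a - q *: b) <= L ^+ 2 by rewrite -enorm_le // ltW.
have := dotpD_le (a - q *: b) (- a).
have -> : a - q *: b - a = - (q *: b) by rewrite addrAC subrr add0r.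
rewrite !dotpE !opprK => H1 H2.
have q1 : K <= q ^+ 2.
  have K1 : 1 <= K by rewrite lerDr divr_ge0 // ltW.
  rewrite -(real_normK (num_real q)) expr2.
  have := ler_pM (le_trans ler01 K1) ler01 Kq (le_trans K1 Kq).
  by rewrite mulr1.
have : (4 * (L ^+ 2 + A) / m + 1) * m <= q ^+ 2 * m by rewrite ler_pM2r.
rewrite mulrDl divfK ?gt_eqF // mul1r.
have : q ^+ 2 * (m / 2) <= q ^+ 2 * dotp b b by rewrite ler_wpM2l ?sqr_ge0 // ltW.
move: H1; rewrite expr2; lra.
Qed.

(* [O] only serves to express that [D] is a neighbourhood of [P] relative to
   (0, T) x closure Omega. *)
Record touching_side (T : R) Omega H F w g h D O P : Prop := TouchingSide {
  side_sub : viscosity_subsolution T Omega H (minH F H) w;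
  side_lsc : joint_lsc (Qcl T Omega) H;
  side_C1g : C1_on [set t | t < T] g;
  side_C1h : C1_on setT h;
  side_cpt : compact D;
  side_uscw : usc_on D w;
  side_inQ : D `<=` Qopen T Omega;
  side_open : open O;
  side_OP : O P;
  side_OD : O `&` Qopen T Omega `<=` D;
  side_DP : D P;
  side_val : w P = g P.1 + h P.2 }.

Lemma Qopen_Qcl T Omega : Qopen T Omega `<=` Qcl T Omega.
Proof.
by move=> X [/= + cX]; rewrite !in_itv /= => /andP[X0 XT]; split=> //=;
  rewrite in_itv /= !ltW.
Qed.

Lemma usc_on_minus_C1 (T : R) D w g h : (forall X, D X -> X.1 < T) -> usc_on D w ->
  C1_on [set t | t < T] g -> C1_on setT h ->
  usc_on D (fun X => w X - (g X.1 + h X.2)).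
Proof.
move=> DT uw C1g C1h; apply: usc_onD => //.
apply: pointwise_usc_on => X /DT XT.
have oT : open [set t : R | t < T] by exact: open_lt.
have C1gh := C1_on_separated _ _ _ oT C1g C1h.
by apply: (@cvgN _ _ _ (nbhs X)); exact: (C1_on_continuous _ _ _ C1gh XT).
Qed.

Lemma touching_side_usc T Omega H F w g h D O P :
  touching_side T Omega H F w g h D O P ->
  usc_on D (fun X => w X - (g X.1 + h X.2)).
Proof.
move=> [_ _ C1g C1h _ uw DQ _ _ _ _ _]; apply: usc_on_minus_C1 uw C1g C1h.
by move=> X /DQ[/= + _]; rewrite in_itv /= => /andP[].
Qed.

Lemma touching_side_tested T Omega H F w g h rho D O P :
  touching_side T Omega H F w g h D O P -> C1_on setT rho ->
  \forall X \near P, D X -> Omega X.2 ->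
    tested D (fun X => w X - (g X.1 + h X.2)) (fun X => - rho X.2)
      (slope_op H g h rho) X.
Proof.
move=> [sub _ C1g C1h _ uw DQ oO OP OD _ _] C1r.
have nO : \forall X \near P, O X by exact: open_nbhs_nbhs.
apply: filterS nO => X OX DX OmX q c mX.
have [+ _] := viscosity_tested _ _ _ _ _ _ _ _ _ _ _ _ _ sub C1g C1h C1r (DQ _ DX) oO OX OD mX.
exact.
Qed.

Lemma touching_side_slope T Omega H F w g h rho D O P q :
  touching_side T Omega H F w g h D O P -> C1_on setT rho ->
  boundary Omega P.2 -> rho P.2 = 0 ->
  slope_above D P (fun X => w X - (g X.1 + h X.2)) (fun X => - rho X.2) q ->
  slope_op H g h rho P q <= 0 \/ slope_op F g h rho P q <= 0.
Proof.
move=> [sub _ C1g C1h _ uw DQ oO OP OD DP wP] C1r bP rP sq.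
have mP : \forall Y \near P, D Y ->
    w Y - (g Y.1 + h Y.2) - (q * - rho Y.2 + 0 * (- rho Y.2) ^+ 2) <=
    w P - (g P.1 + h P.2) - (q * - rho P.2 + 0 * (- rho P.2) ^+ 2).
  apply: filterS sq => Y hY DY; have := hY DY.
  by rewrite wP rP !mul0r; lra.
have [_ /(_ bP)] := viscosity_tested _ _ _ _ _ _ _ _ _ _ _ _ _ sub C1g C1h C1r (DQ _ DP) oO OP OD mP.
rewrite mulr0 mul0r addr0 /slope_op /minH; set p := _ - _.
by have [FH|HF] := leP (F P p) (H P p); [right|left].
Qed.

End Structure.

(** * A common slope for the two viscosity inequalities *)

Section ViscosityMatching.
Context {R : realType} {d : nat}.
Local Notation space := 'rV[R]_d.
Local Notation ST := (R * 'rV[R]_d)%type.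
Variables (T : R) (Omega : set space) (H1 F1 H2 F2 : ST -> space -> R)
  (w1 w2 : ST -> R) (g1 g2 : R -> R) (h1 h2 rho : space -> R)
  (D1 D2 O1 O2 : set ST) (P Q : ST) (K : R).
Hypotheses (Omega_open : open Omega)
  (S1 : touching_side T Omega H1 F1 w1 g1 h1 D1 O1 P)
  (S2 : touching_side T Omega H2 F2 w2 g2 h2 D2 O2 Q)
  (C1r : C1_on setT rho) (rPQ : rho P.2 = rho Q.2).

Let z1 (X : ST) := w1 X - (g1 X.1 + h1 X.2).
Let z2 (X : ST) := w2 X - (g2 X.1 + h2 X.2).

Hypotheses
  (sum : forall X Y, D1 X -> D2 Y -> rho X.2 = rho Y.2 -> z1 X + z2 Y <= 0)
  (strict : forall X Y, D1 X -> D2 Y -> rho X.2 = rho Y.2 ->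
     0 <= z1 X + z2 Y -> X = P /\ Y = Q)
  (coercive : \forall X \near P, D1 X ->
     forall q, K <= `|q| -> 0 < slope_op H1 g1 h1 rho X q).

Let continuous_level : continuous (fun X : ST => - rho X.2).
Proof.
move=> X; apply: (@cvgN _ _ _ (nbhs X)).
have cr : continuous rho by move=> x; exact: C1_on_continuous C1r Logic.I.
exact: (continuous_snd _ cr X).
Qed.

Let z1P : z1 P = 0.
Proof. by rewrite /z1 (side_val _ _ _ _ _ _ _ _ _ _ S1) subrr. Qed.

Let z2Q : z2 Q = 0.
Proof. by rewrite /z2 (side_val _ _ _ _ _ _ _ _ _ _ S2) subrr. Qed.

Let stable1 : stable_positivity D1 P (slope_op H1 g1 h1 rho).
Proof.
case: S1 => _ lsc C1g C1h _ _ DQ _ _ _ DP _.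
apply: (@slope_op_stable _ _ T Omega) => // [X /DQ|].
  exact: Qopen_Qcl.
by case: (DQ _ DP) => /=; rewrite in_itv /= => /andP[].
Qed.

Let stable2 : stable_positivity D2 Q (slope_op H2 g2 h2 rho).
Proof.
case: S2 => _ lsc C1g C1h _ _ DQ _ _ _ DP _.
apply: (@slope_op_stable _ _ T Omega) => // [X /DQ|].
  exact: Qopen_Qcl.
by case: (DQ _ DP) => /=; rewrite in_itv /= => /andP[].
Qed.

Lemma near_inside (X : ST) : Omega X.2 -> \forall Y \near X, Omega Y.2.
Proof.
move=> OX; rewrite [X]surjective_pairing; apply: (near_snd _ _ Omega).
exact: open_nbhs_nbhs.
Qed.

Lemma viscosity_matching_interior : Omega P.2 -> Omega Q.2 ->
  exists q, slope_op H1 g1 h1 rho P q <= 0 /\ slope_op H2 g2 h2 rho Q (- q) <= 0.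
Proof.
move=> OP OQ.
apply: (@interior_matching _ _ D1 D2 P Q z1 z2 (fun X => - rho X.2)
  (fun X => - rho X.2) _ _ K) => //.
- exact: side_cpt S1.
- exact: side_cpt S2.
- exact: touching_side_usc S1.
- exact: touching_side_usc S2.
- exact: side_DP S1.
- exact: side_DP S2.
- by rewrite rPQ.
- by move=> X Y DX DY /oppr_inj; exact: sum.
- by move=> X Y DX DY /oppr_inj; exact: strict.
- move: (near_inside _ OP) (touching_side_tested _ _ _ _ _ _ _ _ _ _ _ S1 C1r).
  by apply: filterS2 => X OX H DX; exact: H.
- move: (near_inside _ OQ) (touching_side_tested _ _ _ _ _ _ _ _ _ _ _ S2 C1r).
  by apply: filterS2 => X OX H DX; exact: H.
Qed.

(** In the chart r = - rho is nonnegative on the closure and positive only in Omega. Hence positive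
    levels involve the interior inequality alone, and the boundary condition enters only through the
    slopes at P and Q. *)
Lemma viscosity_matching_boundary (x0 : space) (U : set space) :
  local_defining Omega x0 U rho ->
  (forall X, D1 X -> U X.2) -> (forall X, D2 X -> U X.2) ->
  boundary Omega P.2 -> boundary Omega Q.2 ->
  continuous (slope_op F1 g1 h1 rho P) ->
  (forall q, q <= - K -> 0 < slope_op F1 g1 h1 rho P q) ->
  exists q, slope_op H1 g1 h1 rho P q <= 0 /\
    (slope_op H2 g2 h2 rho Q (- q) <= 0 \/
     slope_op F1 g1 h1 rho P q <= 0 /\ slope_op F2 g2 h2 rho Q (- q) <= 0).
Proof.
move=> LD D1U D2U bP bQ cF1 F1K.
have rP : rho P.2 = 0.
  by apply: local_defining_boundary LD bP _; [exact: Omega_open|apply: D1U; exact: side_DP S1].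
have rQ : rho Q.2 = 0 by rewrite -rPQ.
have inside (D : set ST) X : D `<=` Qopen T Omega -> D X -> U X.2 ->
    0 <= - rho X.2 /\ (0 < - rho X.2 -> Omega X.2).
  move=> DQ DX UX; have [_ cX] := DQ _ DX; split.
    by rewrite oppr_ge0; exact: local_defining_closure LD cX UX.
  by rewrite oppr_gt0 => ?; apply/(local_defining_inside _ _ _ _ _ LD UX).
have D1Q := side_inQ _ _ _ _ _ _ _ _ _ _ S1.
have D2Q := side_inQ _ _ _ _ _ _ _ _ _ _ S2.
apply: (@boundary_matching _ _ D1 D2 P Q z1 z2 (fun X => - rho X.2)
  (fun X => - rho X.2) _ _ _ _ K) => //.
- split => //.
  + exact: side_cpt S1.
  + exact: touching_side_usc S1.
  + by move=> X DX; have [] := inside _ _ D1Q DX (D1U _ DX).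
  + exact: side_DP S1.
  + by rewrite rP oppr0.
  + move=> X DX /eqP; rewrite oppr_eq0 => /eqP rX z1X.
    have [||-> //] := strict X Q DX (side_DP _ _ _ _ _ _ _ _ _ _ S2).
      by rewrite rX rQ.
    by rewrite z2Q addr0.
  + apply: filterS (touching_side_tested _ _ _ _ _ _ _ _ _ _ _ S1 C1r).
    move=> X H DX /(proj2 (inside _ _ D1Q DX (D1U _ DX))); exact: H.
- split => //.
  + exact: side_cpt S2.
  + exact: touching_side_usc S2.
  + by move=> X DX; have [] := inside _ _ D2Q DX (D2U _ DX).
  + exact: side_DP S2.
  + by rewrite rQ oppr0.
  + move=> X DX /eqP; rewrite oppr_eq0 => /eqP rX z2X.
    have [||_ -> //] := strict P X (side_DP _ _ _ _ _ _ _ _ _ _ S1) DX.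
      by rewrite rX rP.
    by rewrite z1P add0r.
  + apply: filterS (touching_side_tested _ _ _ _ _ _ _ _ _ _ _ S2 C1r).
    move=> X H DX /(proj2 (inside _ _ D2Q DX (D2U _ DX))); exact: H.
- by move=> X Y DX DY /oppr_inj; exact: sum.
- by move=> q; exact: touching_side_slope S1 C1r bP rP.
- by move=> q; exact: touching_side_slope S2 C1r bQ rQ.
Qed.

End ViscosityMatching.

(** * Doubling of variables *)

Section OperatorComparison.
Context {R : realType} {d : nat}.
Local Notation space := 'rV[R]_d.
Local Notation ST := (R * 'rV[R]_d)%type.

Lemma modulus_small (om : R -> R) (c : R) : modulus om -> 0 < c ->
  exists2 s, 0 < s & forall r, 0 <= r -> r <= s -> om r < c.
Proof.
move=> [cw mono om0 omz] c0.
have z0 : (`[0, +oo[%classic : set R) 0 by rewrite /= in_itv /= lexx.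
have nc0 : nbhs (om 0) [set s | s < c] by rewrite omz; exact: lt_nbhsl.
have nc := cw 0 _ nc0.
have {nc} : within `[0, +oo[%classic (nbhs (0 : R)) (fun r => om r < c).
  by rewrite (@nbhs_subspace_in _ (`[0, +oo[%classic : set R) 0).
move=> /nbhs_ballP[e /= e0 He]; exists (e / 2); first by rewrite divr_gt0.
move=> r r0 re; apply: (He r); last by rewrite /= in_itv /= r0.
by rewrite /ball /= sub0r normrN ger0_norm //; lra.
Qed.

Variables (T : R) (Omega : set space) (omega : R -> R) (omegaL : R -> R -> R)
  (H F : ST -> space -> R) (rho : space -> R) (x0 : space) (t0 s0 N c sg : R).
Hypotheses (homegaL : forall L : R, 0 < L -> modulus (omegaL L))
  (Hii : H_ii T Omega omegaL H) (Hiii : H_iii T Omega omega H)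
  (Hiv : H_iv T Omega H) (Fii : F_ii T Omega omegaL F)
  (Fiii : F_iii T Omega omega H F) (C1r : C1_on setT rho)
  (gr0 : grad rho x0 != 0) (N0 : 0 < N) (c0 : 0 < c)
  (homega : forall r, 0 <= r -> r <= sg -> omega r < c)
  (ts : `|t0 - s0| * (1 + 2 * N * `|t0 - s0|) < sg).

(** With a = x - z and b = y - z, the combination of the squared norms exceeds the squared norm of
    the combination by s (1 - s) |a - b|^2. The point given by Rolle thus stays close to x0. *)
Lemma segment_dotp (x y z : space) (s e : R) : 0 <= s <= 1 ->
  dotp (x - z) (x - z) < e -> dotp (y - z) (y - z) < e ->
  dotp (s *: (x - y) + y - z) (s *: (x - y) + y - z) < e.
Proof.
move=> /andP[sge0 s1] xz yz.
have -> : s *: (x - y) + y - z = s *: (x - z) + (1 - s) *: (y - z).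
  by apply/rowP => i; rewrite !mxE; ring.
have := dotp_ge0 ((x - z) - (y - z)).
move: (x - z) (y - z) xz yz => a b ae be; rewrite !dotpE (dotpC b a) => ab.
have s1' : 0 <= 1 - s by lra.
have h1 := mulr_ge0 (mulr_ge0 sge0 s1') ab.
have h2 : 0 < s * (e - dotp a a) + (1 - s) * (e - dotp b b).
  have [sh|sh] := leP s (1 / 2).
    by rewrite ltr_wpDl ?mulr_ge0 ?mulr_gt0 //; lra.
  by rewrite ltr_pwDl ?mulr_ge0 ?mulr_gt0 //; lra.
move: h1 h2; lra.
Qed.

(* [E] is almost tangential: by Rolle it is orthogonal to the gradient of [rho]
   at a point between [x] and [y]. Hence a bound on [E + w - q grad rho x]
   bounds [E] and [q] separately. *)
Lemma almost_tangential (b g E w : space) (q m ga L : R) :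
  0 < m -> m / 2 - ga <= dotp b b -> ga <= m / 32 -> dotp g E = 0 ->
  dotp (b - g) (b - g) <= 4 * ga ->
  dotp w w <= 1 -> dotp (E + w - q *: b) (E + w - q *: b) <= L ^+ 2 ->
  dotp E E <= 4 * (L ^+ 2 + 1) /\ q ^+ 2 * m <= 16 * (L ^+ 2 + 1).
Proof.
move=> m0 bb gam gE bg w1 pL.
have bE : dotp b E ^+ 2 <= 4 * ga * dotp E E.
  have -> : dotp b E = dotp (b - g) E by rewrite !dotpE gE subr0.
  apply: le_trans (cauchy_schwarz _ _) _.
  by rewrite ler_wpM2r // dotp_ge0.
have EE := dotp_ge0 E.
have H1 : dotp E E - 2 * q * dotp b E + q ^+ 2 * dotp b b <= 2 * L ^+ 2 + 2.
  have := dotpD_le (E + w - q *: b) (- w).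
  have -> : E + w - q *: b - w = E - q *: b.
    by apply/rowP => i; rewrite !mxE; ring.
  rewrite [dotp (- w) _]dotpNl dotpNr opprK.
  have -> : dotp (E - q *: b) (E - q *: b) =
      dotp E E - 2 * q * dotp b E + q ^+ 2 * dotp b b.
    by rewrite !dotpE (dotpC E b); ring.
  lra.
have H2 : 8 * dotp b E ^+ 2 <= m * dotp E E by nra.
(* Young's inequality: the cross term costs at most q^2 m / 4 and |E|^2 / 2, which leaves positive
   multiples of q^2 m and |E|^2 in [H1]. *)
have H3 : m * (2 * q * dotp b E) <= m * (q ^+ 2 * m / 4) + 4 * dotp b E ^+ 2.
  have := sqr_ge0 (q * m / 2 - 2 * dotp b E); nra.
have H4 : 2 * q * dotp b E <= q ^+ 2 * m / 4 + dotp E E / 2.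
  rewrite -(ler_pM2l m0); nra.
have q0 := sqr_ge0 q.
have H5 : q ^+ 2 * (m / 2 - m / 32) <= q ^+ 2 * dotp b b.
  by rewrite ler_wpM2l //; lra.
split; nra.
Qed.

(** V is chosen before k and q. The bound on H P p confines p by coercivity, [almost_tangential]
    then bounds q independently of k, and in p' - p the terms with k cancel. The change of gradient
    costs less than c by (H-ii), the change of point less than c by (H-iii); likewise for F. *)
Lemma operator_comparison : exists V : set (ST * ST), nbhs ((t0, x0), (s0, x0)) V /\
  forall P Q : ST, V (P, Q) -> Qcl T Omega P -> Qcl T Omega Q ->
  rho P.2 = rho Q.2 -> forall k q : R,
  let p := k *: (P.2 - Q.2) + 2 *: (P.2 - x0) - q *: grad rho P.2 in
  let p' := k *: (P.2 - Q.2) - q *: grad rho Q.2 in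
  let b := - (2 * N * (P.1 - Q.1)) in
  H P p <= b - c ->
  H Q p' < b + c /\
  (Qlat T Omega P -> Qlat T Omega Q -> F P p <= b - c -> F Q p' < b + c).
Proof.
have [m mE0 m0] : exists2 m, dotp (grad rho x0) (grad rho x0) = m & 0 < m.
  by eexists; [reflexivity|exact: dotp_gt0].
(* Times lie in [0, T], so b <= 2 N T: this is the level of H that p cannot exceed. *)
have [L0 L0ge0 HL0] := H_iv_coercive _ _ _ Hiv (2 * N * T).
have [S SE] : exists S, S = L0 ^+ 2 + 1 by exists (L0 ^+ 2 + 1).
have S1 : 1 <= S by rewrite SE lerDr exprn_ge0.
have S0 : 0 < S by apply: lt_le_trans S1.
(* The cube has to contain p' too: |p'|^2 is at most 2 |E|^2 + 2 q^2 |grad rho Q|^2 <= 8 S + 128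
   S. *)
have [L [L0L Lpos L2]] : exists L, [/\ L0 <= L, 0 < L & 16 * 10 * S <= L ^+ 2].
  exists (L0 + 16 * 10 * S).
  by split; [lra|lra|rewrite expr2; nra].
have [sL sL0 HsL] := modulus_small _ _ (homegaL _ Lpos) c0.
(* From q^2 m <= 16 S, this makes q^2 |grad rho P - grad rho Q|^2 at most sL^2 / 8; the bound m / 32
   is the one required by [almost_tangential]. *)
have [ga [ga0 gam gaS]] : exists ga, [/\ 0 < ga, ga <= m / 32 &
    8 * 8 * 8 * S * ga <= sL ^+ 2 * m].
  have S8 : 0 < 8 * 8 * 8 * S by lra.
  have m32 : 0 < m / 32 by lra.
  exists (Num.min (m / 32) (sL ^+ 2 * m / (8 * 8 * 8 * S))); split.
  - by rewrite lt_min m32 divr_gt0 // mulr_gt0 // exprn_gt0.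
  - by rewrite ge_min lexx.
  - by rewrite mulrC -(ler_pdivlMr _ _ S8) ge_min lexx orbT.
have cgr := continuous_grad _ C1r.
have ngr : \forall x \near x0, dotp (grad rho x - grad rho x0) (grad rho x - grad rho x0) < ga.
  exact: cgr (near_dotp_lt (grad rho x0) _ ga0).
have [e1 e10 He1] := nbhs_dotp _ _ ngr.
(* For w = 2 (P - x0), |w|^2 <= 4 e is thus at most 1 and at most sL^2 / 8. *)
have [e [e0 ee1 e4 es]] : exists e, [/\ 0 < e, e <= e1, e <= 1 / 4 & e <= sL ^+ 2 / 32].
  exists (Num.min e1 (Num.min (1 / 4) (sL ^+ 2 / 32))); split.
  - by rewrite !lt_min e10 !divr_gt0 ?exprn_gt0.
  - by rewrite ge_min lexx.
  - by rewrite !ge_min lexx orbT.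
  - by rewrite !ge_min lexx !orbT.
pose dist (Z : ST * ST) := stnorm (Z.2 - Z.1) * (1 + 2 * N * `|Z.1.1 - Z.2.1|).
exists [set Z | [/\ dotp (Z.1.2 - x0) (Z.1.2 - x0) < e,
  dotp (Z.2.2 - x0) (Z.2.2 - x0) < e & dist Z < sg]]; split.
  have n1 : \forall Z \near ((t0, x0), (s0, x0)), dotp (Z.1.2 - x0) (Z.1.2 - x0) < e.
    exact: (near_fst (t0, x0) (s0, x0) _ (near_snd t0 x0 _ (near_dotp_lt x0 e e0))).
  have n2 : \forall Z \near ((t0, x0), (s0, x0)), dotp (Z.2.2 - x0) (Z.2.2 - x0) < e.
    exact: (near_snd (t0, x0) (s0, x0) _ (near_snd s0 x0 _ (near_dotp_lt x0 e e0))).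
  have n3 : \forall Z \near ((t0, x0), (s0, x0)), dist Z < sg.
    have ct : continuous (fun X : ST => X.1) by move=> X; exact: cvg_fst.
    have cx : continuous (fun X : ST => X.2) by move=> X; exact: cvg_snd.
    have c1 : continuous (fun Z : ST * ST => Z.1.1 - Z.2.1).
      move=> Z; apply: (@cvgB _ _ _ (nbhs Z)).
        exact: (continuous_fst _ ct Z).
      exact: (continuous_snd _ ct Z).
    have c2 : continuous (fun Z : ST * ST => Z.2.2 - Z.1.2).
      move=> Z; apply: (@cvgB _ _ _ (nbhs Z)).
        exact: (continuous_snd _ cx Z).
      exact: (continuous_fst _ cx Z).
    have distE Z : dist Z = Num.sqrt ((Z.1.1 - Z.2.1) * (Z.1.1 - Z.2.1) +
        dotp (Z.2.2 - Z.1.2) (Z.2.2 - Z.1.2)) * (1 + 2 * N * `|Z.1.1 - Z.2.1|).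
      rewrite /dist /stnorm /=; congr (Num.sqrt (_ + _) * _); rewrite expr2; ring.
    have cd : continuous dist.
      have -> : dist = fun Z => Num.sqrt ((Z.1.1 - Z.2.1) * (Z.1.1 - Z.2.1) +
        dotp (Z.2.2 - Z.1.2) (Z.2.2 - Z.1.2)) * (1 + 2 * N * `|Z.1.1 - Z.2.1|).
        by apply/funext.
      move=> Z; apply: (@cvgM _ _ (nbhs Z)).
        apply: continuous_comp; last exact: sqrt_continuous.
        apply: (@cvgD _ _ _ (nbhs Z)); last exact: (continuous_dotp _ _ _ (c2 Z) (c2 Z)).
        by apply: (@cvgM _ _ (nbhs Z)); exact: c1.
      apply: (@cvgD _ _ _ (nbhs Z)); first exact: cvg_cst.
      apply: (@cvgM _ _ (nbhs Z)); first exact: cvg_cst.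
      by apply: (@cvg_norm _ _ _ (nbhs Z)); exact: c1.
    have d0 : dist ((t0, x0), (s0, x0)) < sg.
      rewrite distE /= subrr [dotp 0 0]big1 => [|i _]; last by rewrite mxE mul0r.
      by rewrite addr0 -expr2 sqrtr_sqr.
    by have /cvgr_lt/(_ _ d0) := cd ((t0, x0), (s0, x0)).
  by move: n1 n2 n3; apply: filterS3 => Z.
move=> P Q /= [Pe Qe PQd] QP QQ rPQ k q.
have Pga := He1 _ (lt_le_trans Pe ee1); have Qga := He1 _ (lt_le_trans Qe ee1).
have [s s01 sE] := level_rolle _ _ _ C1r rPQ.
have Zga := He1 _ (lt_le_trans (segment_dotp _ _ _ _ _ s01 Pe Qe) ee1).
move: Pga Qga sE Zga; set gz := grad rho (_ + _).
set gP := grad rho P.2; set gQ := grad rho Q.2; set g0 := grad rho x0.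
move=> Pga Qga sE Zga; have mE : dotp g0 g0 = m := mE0.
set E := k *: (P.2 - Q.2); set w := 2 *: (P.2 - x0).
have gzE : dotp gz E = 0 by rewrite /E dotpZr sE mulr0.
have ww : dotp w w <= 4 * e by rewrite /w dotpZl dotpZr; lra.
clearbody E w.
set p := (X in H P X <= _); set p' := (X in H Q X < _).
set b := - (_ * (P.1 - Q.1)) => HPp.
have bE : b = - (2 * N * (P.1 - Q.1)) by [].
clearbody gz gP gQ g0 b.
have diff a a' : dotp (a - g0) (a - g0) < ga -> dotp (a' - g0) (a' - g0) < ga ->
    dotp (a - a') (a - a') <= 4 * ga.
  move=> h1 h2; have -> : a - a' = (a - g0) - (a' - g0).
    by rewrite opprB addrA subrK.
  have := dotpB_le (a - g0) (a' - g0); lra.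
have T2 : `|P.1 - Q.1| <= T.
  move: QP QQ => [/= + _] [/= + _]; rewrite !in_itv /= => /andP[a1 a2] /andP[a3 a4].
  by rewrite ler_norml; apply/andP; split; lra.
have bT : b <= 2 * N * T.
  have := ler_norm (- (P.1 - Q.1)); rewrite normrN => h.
  have : 0 <= N * (T + (P.1 - Q.1)) by rewrite mulr_ge0 ?(ltW N0) //; lra.
  by rewrite bE; lra.
have pL0 : dotp p p <= L0 ^+ 2.
  rewrite -enorm_le //; rewrite leNgt; apply/negP => /ltW pL.
  have h : 2 * N * T < b - c := lt_le_trans (HL0 _ _ QP pL) HPp.
  by move: h bT c0; lra.
have gPP : m / 2 - ga <= dotp gP gP.
  have := dotpD_le gP (g0 - gP); rewrite addrC subrK mE.
  have -> : dotp (g0 - gP) (g0 - gP) = dotp (gP - g0) (gP - g0).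
    by rewrite -opprB dotpNl dotpNr opprK.
  lra.
have [|EE qm] := almost_tangential gP gz E w q m ga L0 m0 gPP gam gzE (diff _ _ Pga Zga) _ pL0.
  by lra.
rewrite -SE in EE qm.
have q0 := sqr_ge0 q.
have gQQ : dotp gQ gQ <= 4 * m.
  have := dotpD_le g0 (gQ - g0); rewrite addrC subrK mE; lra.
have pL : dotp p p <= L ^+ 2.
  by apply: le_trans pL0 _; rewrite ler_pXn2r // ?nnegrE // ltW.
have p'L : dotp p' p' <= L ^+ 2.
  have := dotpB_le E (q *: gQ); rewrite -/p' !dotpZl !dotpZr.
  have : q ^+ 2 * dotp gQ gQ <= q ^+ 2 * (4 * m) by rewrite ler_wpM2l.
  rewrite expr2; lra.
have p'p : dotp (p' - p) (p' - p) <= sL ^+ 2.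
  have -> : p' - p = q *: (gP - gQ) - w.
    by apply/rowP => i; rewrite /p' /p !mxE; ring.
  have dPQ := diff _ _ Pga Qga.
  have := dotpB_le (q *: (gP - gQ)) w; rewrite !dotpZl !dotpZr.
  have : m * (q ^+ 2 * (4 * ga)) <= m * (sL ^+ 2 / 8).
    have : q ^+ 2 * m * ga <= 16 * S * ga by rewrite ler_wpM2r // ltW.
    lra.
  rewrite ler_pM2l // => h1.
  have : q ^+ 2 * dotp (gP - gQ) (gP - gQ) <= q ^+ 2 * (4 * ga) by rewrite ler_wpM2l.
  lra.
have Lw : omegaL L (enorm (p' - p)) < c.
  by apply: HsL; rewrite ?enorm_ge0 // enorm_le // ltW.
have cp : cube L p by apply: enorm_cube => //; exact: ltW.
have cp' : cube L p' by apply: enorm_cube => //; exact: ltW.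
have stn0 : 0 <= stnorm (Q - P) by exact: sqrtr_ge0.
have bN : b <= 2 * N * `|P.1 - Q.1|.
  have := ler_norm (- (P.1 - Q.1)); rewrite normrN => h.
  have : 0 <= N * (`|P.1 - Q.1| + (P.1 - Q.1)) by rewrite mulr_ge0 ?(ltW N0) //; lra.
  by rewrite bE; lra.
(* An operator value below b has positive part at most 2 N |t - s|, so the argument of omega is at
   most [dist], which is below sg on V. *)
have om h : h <= b - c -> omega (stnorm (Q - P) * (1 + Num.max 0 h)) < c.
  move=> hb; have h0 : 0 <= Num.max 0 h by rewrite le_max lexx.
  apply: homega; first by rewrite mulr_ge0 // addr_ge0.
  apply: le_trans (ltW PQd); rewrite /dist /= ler_wpM2l // lerD2l ge_max.
  apply/andP; split; first by rewrite !mulr_ge0 // ltW.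
  by apply: le_trans bN; apply: le_trans hb _; rewrite lerBlDr lerDl ltW.
split.
  have := Hii _ Lpos Q _ _ QQ cp' cp; have := Hiii P Q p QP QQ.
  have := om _ HPp; have := ler_norm (H Q p' - H Q p); lra.
(* (F-iii) involves max(F, H) at P, so the bounds on F and on H are both called upon here. *)
move=> lP lQ FPp.
have := Fii _ Lpos Q _ _ lQ cp' cp; have := Fiii P Q p lP lQ.
have : omega (stnorm (Q - P) * (1 + Num.max 0 (maxH F H P p))) < c.
  by apply: om; rewrite /maxH ge_max FPp.
have := ler_norm (F Q p' - F Q p); lra.
Qed.

End OperatorComparison.

(** * Explicit test functions and charts *)

Section Ingredients.
Context {R : realType}.

Lemma C1_on_real (A : set R) (g g' : R -> R) : open A ->
  (forall t, A t -> is_derive t 1 g (g' t)) ->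
  (forall t, A t -> {for t, continuous g'}) -> C1_on A g.
Proof.
move=> oA dg cg' t At.
have dif s : A s -> differentiable g s.
  by move=> As; apply/derivable1_diffP; have [] := dg s As.
split=> [|v]; first exact: dif.
apply: (@continuous_near_eq _ _ _ (fun s => v * g' s)).
  have := open_nbhs_nbhs (conj oA At); apply: filterS => s As.
  rewrite deriveE; last exact: dif.
  have [_ <-] := dg s As; rewrite -derive1E.
  exact: (congr1 (fun k : R -> R => k v) (diff1E (dif s As))).
by apply: (@cvgM _ _ (nbhs t)); [exact: cvg_cst|exact: cg'].
Qed.

(* The barrier [eta / (T - t)] keeps the maxima away from the final time. *)
Definition barrier (T eta t : R) : R := eta / (T - t).

(** The square around t0 makes the maximum strict, the affine and quadratic part around tP is what
    [decoupling] leaves of the penalty, and c adjusts the value at the touching point. [space_test]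
    has the same structure. *)
Definition time_test (T eta t0 tP k m c t : R) : R :=
  barrier T eta t + ((t - t0) ^+ 2 + (k * (t - tP) + (m * (t - tP) ^+ 2 + c))).

Definition time_test' (T eta t0 tP k m t : R) : R :=
  eta / (T - t) ^+ 2 + (2 * (t - t0) + (k + 2 * m * (t - tP))).

Lemma is_derive_time_test (T eta t0 tP k m c t : R) : t < T ->
  is_derive t 1 (time_test T eta t0 tP k m c) (time_test' T eta t0 tP k m t).
Proof.
move=> tT; have Tt : T - t != 0 by rewrite gt_eqF // subr_gt0.
have db : is_derive t 1 (barrier T eta) (eta / (T - t) ^+ 2).
  have dl : is_derive t 1 (fun s : R => T - s) (- 1).
    by apply: is_derive_eq; rewrite add0r mul1r.
  have dD : derivable (fun s : R => T - s) t 1 by case: dl.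
  have dV : derivable (fun s : R => (T - s)^-1) t 1.
    exact: derivableV.
  have DV : 'D_1 (fun s : R => (T - s)^-1) t = (T - t) ^- 2.
    rewrite deriveV //.
    by have [_ ->] := dl; rewrite scaleNr scalerN opprK [_%:A]mulr1.
  have dc : derivable (fun _ : R => eta) t 1 by exact: derivable_cst.
  apply: DeriveDef; first exact: (derivableM dc dV).
  by rewrite (deriveM dc dV) derive_cst scaler0 addr0 DV.
have dp : is_derive t 1 (fun s : R => (s - t0) ^+ 2 + (k * (s - tP) +
    (m * (s - tP) ^+ 2 + c))) (2 * (t - t0) + (k + 2 * m * (t - tP))).
  apply: is_derive_eq.
  rewrite /GRing.scale /=; ring.
exact: is_deriveD.
Qed.

Lemma C1_on_time_test (T eta t0 tP k m c : R) :
  C1_on [set t | t < T] (time_test T eta t0 tP k m c).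
Proof.
apply: (@C1_on_real _ _ (time_test' T eta t0 tP k m)); first exact: open_lt.
  by move=> t; exact: is_derive_time_test.
move=> t /= tT; have Tt : T - t != 0 by rewrite gt_eqF // subr_gt0.
have cid (a : R) : {for t, continuous (fun s : R => s - a)}.
  by apply: (@cvgB _ _ _ (nbhs t)); [exact: cvg_id|exact: cvg_cst].
apply: (@cvgD _ _ _ (nbhs t)).
  apply: (@cvgM _ _ (nbhs t)); first exact: cvg_cst.
  apply: (@cvgV _ _ (nbhs t)); first by rewrite expf_neq0.
  have cT : {for t, continuous (fun s : R => T - s)}.
    by apply: (@cvgB _ _ _ (nbhs t)); [exact: cvg_cst|exact: cvg_id].
  exact: (cvgM cT cT).
apply: (@cvgD _ _ _ (nbhs t)).
  by apply: (@cvgM _ _ (nbhs t)); [exact: cvg_cst|exact: cid].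
apply: (@cvgD _ _ _ (nbhs t)); first exact: cvg_cst.
by apply: (@cvgM _ _ (nbhs t)); [exact: cvg_cst|exact: cid].
Qed.

Context {d : nat}.
Local Notation space := 'rV[R]_d.
Local Notation ST := (R * 'rV[R]_d)%type.

Definition space_test (x0 xP e : space) (l m : R) (x : space) : R :=
  l * dotp (x - x0) (x - x0) + (dotp e (x - xP) + m * dotp (x - xP) (x - xP)).

Lemma C1_on_space_test x0 xP e l m : C1_on setT (space_test x0 xP e l m).
Proof.
have oT := @openT space.
apply: C1_onD => //; first by apply: C1_on_scale => //; exact: C1_on_sqdist.
apply: C1_onD => //; first exact: C1_on_affine.
by apply: C1_on_scale => //; exact: C1_on_sqdist.
Qed.

Lemma grad_space_test x0 xP e l m :
  grad (space_test x0 xP e l m) xP = 2 * l *: (xP - x0) + e.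
Proof.
have oT := @openT space.
have C1 := C1_on_scale _ _ l oT (C1_on_sqdist x0).
have C2 := C1_on_scale _ _ m oT (C1_on_sqdist xP).
have C3 := C1_on_affine e xP.
rewrite (gradD _ _ _ C1 (C1_onD _ _ _ oT C3 C2)) (gradD _ _ _ C3 C2).
rewrite (grad_scale _ _ _ (C1_on_sqdist x0)) (grad_scale _ _ _ (C1_on_sqdist xP)).
rewrite !grad_sqdist grad_affine subrr !scaler0 addr0 scalerA.
by rewrite (mulrC l).
Qed.

Lemma compact_closure (Omega : set space) : bounded_set Omega ->
  compact (closure Omega).
Proof.
move=> [M [Mr OM]]; apply: bounded_closed_compact; last exact: closed_closure.
exists M; split => // r Mr' x cx.
have cl : closed [set y : space | `|y| <= r].
  apply: (@closed_comp _ _ (fun y : space => `|y|) [set s | s <= r]).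
    by move=> y _; exact: norm_continuous.
  exact: closed_le.
suff : closure [set y : space | `|y| <= r] x by have /closure_id <- := cl.
by apply: closureS cx => y Oy; exact: OM.
Qed.

(** Inside Omega any function with nonzero gradient can define the levels; a coordinate is taken,
    and one exists since d >= 1. Interior and boundary points are thus treated alike. *)
Lemma boundary_chart (Omega : set space) (x0 : space) : (1 <= d)%N ->
  open Omega -> C1_boundary Omega -> closure Omega x0 ->
  exists (U : set space) (rho : space -> R), [/\ open U, U x0, C1_on setT rho,
    grad rho x0 != 0 & U `<=` Omega \/ local_defining Omega x0 U rho].
Proof.
move=> d1 oO bO cx0; have [Ox0|nOx0] := pselect (Omega x0).
  exists Omega, (fun x => x 0 (Ordinal d1)); split => //; last by left.
    exact: C1_on_coord.
  rewrite grad_coord; apply/eqP => /rowP/(_ (Ordinal d1)).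
  by rewrite !mxE !eqxx => /eqP; rewrite oner_eq0.
have bx0 : boundary Omega x0 by apply/boundaryP.
have [U [rho /local_defining_extend[U' [rho' [LD C1r]]]]] := bO _ bx0.
exists U', rho'; case: (LD) => oU Ux _ gr _; split => //; last by right.
exact: gr.
Qed.

Lemma F_i_continuous_slope T Omega n F g h rho (P : ST) : F_i T Omega n F ->
  Qlat T Omega P -> continuous (slope_op F g h rho P).
Proof.
move=> [cF _] lP q; apply: (@cvgD _ _ _ (nbhs q)); first exact: cvg_cst.
set a := grad h P.2; set b := grad rho P.2.
move=> B nB; have := cF (P, a - q *: b) B nB.
move=> nB'; have {nB'} : within (Qlat T Omega `*` setT) (nbhs (P, a - q *: b))
    (fun Z => B (F Z.1 Z.2)).
  by rewrite (@nbhs_subspace_in _ (Qlat T Omega `*` setT) (P, a - q *: b)).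
rewrite /within /= => -[[B1 B2] [/= nB1 nB2] B12].
have cl : {for q, continuous (fun s : R => a - s *: b)}.
  apply: (@cvgB _ _ _ (nbhs q)); first exact: cvg_cst.
  by apply: (@cvgZ _ _ _ (nbhs q)); [exact: cvg_id|exact: cvg_cst].
have nB2' : \forall s \near q, B2 (a - s *: b) by exact: cl nB2.
suff : \forall s \near q, B (F P (a - s *: b)) by [].
apply: filterS nB2' => s B2s.
by apply: (B12 (P, a - s *: b)); split => //; exact: nbhs_singleton nB1.
Qed.

(** On the boundary grad rho = la n with la > 0, so a slope q along grad rho is a slope q la along
    n, to which (F-iv) applies. *)
Lemma F_iv_slope T Omega n F g h rho x0 U (P : ST) : open Omega ->
  (forall x, boundary Omega x -> outward_unit_normal Omega x (n x)) ->
  F_iv T Omega n F -> local_defining Omega x0 U rho -> U P.2 ->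
  Qlat T Omega P ->
  exists K, forall q, q <= - K -> 0 < slope_op F g h rho P q.
Proof.
move=> oO hn cF LD UP lP; have [_ bP] := lP.
have [U' [rho' [LD' nE]]] := hn _ bP.
have [l l0 grE] := local_defining_normal _ _ _ _ _ _ oO bP LD'
  (local_defining_at _ _ _ _ _ LD UP).
have [_ U'P _ /(_ _ U'P) gr0 _] := LD'.
have en0 : 0 < enorm (grad rho' P.2).
  rewrite lt_def enorm_ge0 andbT; apply: contra gr0 => /eqP e0.
  by rewrite -dotp_eq0 -enorm_sqr e0 expr0n.
pose la := l * enorm (grad rho' P.2).
have la0 : 0 < la by exact: mulr_gt0.
have grn : grad rho P.2 = la *: n P.2.
  by rewrite nE scalerA /la -mulrA divff ?gt_eqF // mulr1.
set a := grad h P.2; pose L := enorm a + 1.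
have L0 : 0 < L by rewrite ltr_wpDl // enorm_ge0.
have [K HK] := F_iv_coercive _ _ _ _ cF (- 'D_1 g P.1) L L0.
exists (K / la) => q qK; rewrite /slope_op -/a grn scalerA.
rewrite addrC -[X in 0 < _ + X]opprK subr_gt0; apply: HK => //.
  by move: qK; rewrite -mulNr ler_pdivlMr.
apply: enorm_cube; first exact: ltW.
by rewrite -enorm_le ?(ltW L0) // /L lerDl.
Qed.

End Ingredients.

(** * Doubling the space variable with the time penalisation fixed *)

Section Doubling.
Context {R : realType} {d : nat}.
Local Notation space := 'rV[R]_d.
Local Notation ST := (R * 'rV[R]_d)%type.

Lemma lsc_within_on (A : set ST) (f : ST -> R) :
  lsc_within A f -> usc_on A (fun X => - f X).
Proof.
move=> lf X AX c fc.
have cf : ((- c)%:E < (f X)%:E)%E by rewrite lte_fin ltrNl.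
have [V nV Vf] := lf X (- c) cf.
have {}nV : within A (nbhs X) V by rewrite (@nbhs_subspace_in _ A X).
move: nV; rewrite /within /=; apply: filterS => Y VY AY.
by rewrite ltrNl -lte_fin; apply: Vf; exact: VY.
Qed.

Lemma usc_within_on (A : set ST) (f : ST -> R) : usc_within A f -> usc_on A f.
Proof.
move=> /lsc_within_on uf X AX c fc.
have /(uf _ AX) : - - f X < c by rewrite opprK.
by apply: filterS => Y h /h; rewrite opprK.
Qed.

Lemma cylinder_facts (Omega : set space) (t0 r e : R) (x0 : space) :
  compact (closure Omega) ->
  compact (`[t0 - r, t0 + r]%classic `*`
    (closure Omega `&` [set x | dotp (x - x0) (x - x0) <= e])) /\
  open (`]t0 - r, t0 + r[%classic `*` [set x | dotp (x - x0) (x - x0) < e]).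
Proof.
move=> cO.
have cd : continuous (fun x : space => dotp (x - x0) (x - x0)).
  by move=> x; exact: C1_on_continuous (C1_on_sqdist x0) Logic.I.
split.
  apply: compact_setX; first exact: segment_compact.
  apply: compact_closedI => //.
  apply: (@closed_comp _ _ (fun x : space => dotp (x - x0) (x - x0)) [set s | s <= e]).
    by move=> x _; exact: cd.
  exact: closed_le.
apply: (@openI _ (fst @^-1` `]t0 - r, t0 + r[%classic)
  (snd @^-1` [set x : space | dotp (x - x0) (x - x0) < e])).
  by apply: open_comp; [move=> X _; exact: cvg_fst|exact: interval_open].
apply: open_comp; first by move=> X _; exact: cvg_snd.
apply: (@open_comp _ _ (fun x : space => dotp (x - x0) (x - x0)) [set s | s < e]).
  by move=> x _; exact: cd.
exact: open_lt.
Qed.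

Variables (Omega : set space) (n : space -> space) (T : R) (omega : R -> R)
  (omegaL : R -> R -> R) (H F : ST -> space -> R) (u v : ST -> R).
Hypotheses (d1 : (1 <= d)%N) (Omega_open : open Omega)
  (Omega_bounded : bounded_set Omega) (Omega_C1 : C1_boundary Omega)
  (hn : forall x, boundary Omega x -> outward_unit_normal Omega x (n x))
  (T0 : 0 < T) (homegaL : forall L : R, 0 < L -> modulus (omegaL L))
  (Hi : H_i T Omega H) (Hii : H_ii T Omega omegaL H)
  (Hiii : H_iii T Omega omega H) (Hiv : H_iv T Omega H)
  (Fi : F_i T Omega n F) (Fii : F_ii T Omega omegaL F)
  (Fiii : F_iii T Omega omega H F) (Fiv : F_iv T Omega n F)
  (u_usc : usc_within (Q0 T Omega) u) (v_lsc : lsc_within (Q0 T Omega) v)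
  (u_sub : viscosity_subsolution T Omega H (minH F H) u)
  (v_super : viscosity_supersolution T Omega H (maxH F H) v).

(* The parallelogram inequality decouples the quadratic penalisation: at a
   maximum of the doubled functional, each of the two functions is touched by a
   quadratic of its own. This replaces the two blow-ups. *)
Lemma decoupling (N K : R) (a b tau : R) (A B xi : space) (m0 m1 : R) :
  0 <= N -> 0 <= K ->
  m1 - N * (tau + a - b) ^+ 2 - K * dotp (xi + A - B) (xi + A - B) <=
  m0 - N * tau ^+ 2 - K * dotp xi xi ->
  m1 - m0 - 2 * N * tau * (a - b) - (2 * N + 1) * (a ^+ 2 + b ^+ 2)
    - dotp (2 * K *: xi) (A - B) - (2 * K + 1) * (dotp A A + dotp B B) <=
  - (a ^+ 2 + b ^+ 2) - (dotp A A + dotp B B).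
Proof.
move=> N0 K0 Hm.
have h1 : 0 <= N * (a + b) ^+ 2 by rewrite mulr_ge0 // sqr_ge0.
have h2 : 0 <= K * dotp (A + B) (A + B) by rewrite mulr_ge0 // dotp_ge0.
move: Hm h1 h2; rewrite !dotpE (dotpC A xi) (dotpC B xi) (dotpC B A); lra.
Qed.

(** With c = eta / (2 T^2), the barrier gains 2 c in each of the two inequalities. The localising
    squares in time cost at most c, and the remaining c on each side is the margin of
    [operator_comparison]. *)
Lemma barrier_derivative (eta t : R) : 0 < eta -> 0 < t -> t < T ->
  2 * (eta / (2 * T ^+ 2)) <= eta / (T - t) ^+ 2.
Proof.
move=> e0 t0 tT.
have Tt : 0 < T - t by rewrite subr_gt0.
have -> : 2 * (eta / (2 * T ^+ 2)) = eta / T ^+ 2.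
  by field; rewrite gt_eqF.
rewrite ler_pM2l // lef_pV2 ?posrE ?exprn_gt0 //.
by rewrite ler_pXn2r ?nnegrE ?ltW //; lra.
Qed.

Lemma separated_points (X Y P Q : ST) :
  0 <= - ((X.1 - P.1) ^+ 2 + (Y.1 - Q.1) ^+ 2)
    - (dotp (X.2 - P.2) (X.2 - P.2) + dotp (Y.2 - Q.2) (Y.2 - Q.2)) ->
  X = P /\ Y = Q.
Proof.
move: X Y P Q => [t x] [s y] [tP xP] [sQ yQ] /= hh.
have q1 := sqr_ge0 (t - tP); have q2 := sqr_ge0 (s - sQ).
have q3 := dotp_ge0 (x - xP); have q4 := dotp_ge0 (y - yQ).
have /eqP e1 : (t - tP) ^+ 2 = 0 by lra.
have /eqP e2 : (s - sQ) ^+ 2 = 0 by lra.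
have /eqP e3 : dotp (x - xP) (x - xP) = 0 by lra.
have /eqP e4 : dotp (y - yQ) (y - yQ) = 0 by lra.
move: e1 e2 e3 e4; rewrite !sqrf_eq0 !dotp_eq0 !subr_eq0.
by move=> /eqP -> /eqP -> /eqP -> /eqP ->.
Qed.

Lemma slope_bound1 (be c dt b G : R) : 2 * c <= be -> - (c / 2) <= dt ->
  be + (2 * dt + b) + G <= 0 -> G <= - b - c.
Proof. lra. Qed.

Lemma slope_bound2 (be c dt b G : R) : 2 * c <= be -> - (c / 2) <= dt ->
  be + (2 * dt - b) - G <= 0 -> - b + c <= G.
Proof. lra. Qed.

(** [hmax] compares values at a common space point only, so it controls the doubled functional where
    g = 0; [penalization] turns this into closeness to the base point for a suitable K, chosen after
    the neighbourhood of [operator_comparison]. *)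
Lemma doubled_maximum_absurd (T'' eta N sg t0 s0 : R) (x0 : space) :
  T'' <= T -> 0 < eta -> 0 < N ->
  (forall r, 0 <= r -> r <= sg -> omega r < eta / (2 * T ^+ 2)) ->
  `|t0 - s0| * (1 + 2 * N * `|t0 - s0|) < sg ->
  closure Omega x0 -> 0 < t0 < T'' -> 0 < s0 < T'' ->
  (forall t s x, 0 < t < T'' -> 0 < s < T'' -> closure Omega x ->
    u (t, x) - v (s, x) - barrier T eta t - barrier T eta s - N * (t - s) ^+ 2
    <= u (t0, x0) - v (s0, x0) - barrier T eta t0 - barrier T eta s0
       - N * (t0 - s0) ^+ 2) -> False.
Proof.
move=> T''T eta0 N0 homega ts cx0 /andP[t00 t0T] /andP[s00 s0T] hmax.
pose c := eta / (2 * T ^+ 2).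
have c0 : 0 < c by rewrite divr_gt0 // mulr_gt0 // exprn_gt0.
have [U [rho [oU Ux0 C1r gr0 chart]]] := boundary_chart _ _ d1 Omega_open Omega_C1 cx0.
have [V [nV HV]] := operator_comparison T Omega omega omegaL H F rho x0 t0 s0
  N c sg homegaL Hii Hiii Hiv Fii Fiii C1r gr0 N0 c0 homega ts.
have cO := compact_closure _ Omega_bounded.
have [r [r0 [rt0 rtT] [rs0 rsT]]] : exists r, [/\ 0 < r, 0 < t0 - r /\ t0 + r < T'' &
    0 < s0 - r /\ s0 + r < T''].
  exists (Num.min (Num.min t0 s0) (Num.min (T'' - t0) (T'' - s0)) / 2).
  have m0 : 0 < Num.min (Num.min t0 s0) (Num.min (T'' - t0) (T'' - s0)).
    by rewrite !lt_min t00 s00 !subr_gt0 t0T s0T.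
  move: m0.
  have [m [-> m1 m2 m3 m4]] : exists m, [/\ Num.min (Num.min t0 s0)
      (Num.min (T'' - t0) (T'' - s0)) = m, m <= t0, m <= s0, m <= T'' - t0 &
      m <= T'' - s0].
    by eexists; split; first reflexivity; rewrite !ge_min lexx ?orbT.
  by move=> m0; split; [lra|split; lra|split; lra].
have ngr : \forall x \near x0, U x /\ grad rho x != 0.
  have cg := continuous_grad _ C1r.
  have cgg : {for x0, continuous (fun x => dotp (grad rho x) (grad rho x))}.
    by apply: continuous_dotp; exact: cg.
  have := dotp_gt0 _ gr0 => /(cvgr_gt _ cgg) n1.
  have n2 : \forall x \near x0, U x by exact: open_nbhs_nbhs.
  move: n1 n2; apply: filterS2 => x gx Ux; split => //.
  by rewrite -dotp_eq0 gt_eqF.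
have [e1 e10 He1] := nbhs_dotp _ _ ngr.
pose e := e1 / 2; have e0 : 0 < e by rewrite divr_gt0.
pose Bc := closure Omega `&` [set x | dotp (x - x0) (x - x0) <= e].
have BcU x : Bc x -> U x /\ grad rho x != 0.
  by move=> [_ /= xe]; apply: He1; apply: le_lt_trans xe _; rewrite /e; lra.
pose Bo := [set x : space | dotp (x - x0) (x - x0) < e].
have x0x0 : dotp (x0 - x0) (x0 - x0) = 0.
  by rewrite subrr /dotp big1 // => i _; rewrite mxE mul0r.
pose cyl (a : R) : set ST := `[a - r, a + r]%classic `*` Bc.
pose cylo (a : R) : set ST := `]a - r, a + r[%classic `*` Bo.
have [cD1 oO1] := cylinder_facts Omega t0 r e x0 cO.
have [cD2 oO2] := cylinder_facts Omega s0 r e x0 cO.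
have cylT a X : 0 < a - r -> a + r < T'' -> cyl a X ->
    [/\ 0 < X.1, X.1 < T'', closure Omega X.2 & Qopen T Omega X].
  move=> ar aT [/= + [cX _]]; rewrite in_itv /= => /andP[a1 a2].
  have h1 : 0 < X.1 by lra.
  have h2 : X.1 < T'' by lra.
  by split => //; split => //=; rewrite in_itv /= h1 (lt_le_trans h2).
have cyloD a : cylo a `&` Qopen T Omega `<=` cyl a.
  move=> X [[/= + xe] [_ /= cX]]; rewrite in_itv /= => /andP[/ltW a1 /ltW a2].
  by split=> /=; [rewrite in_itv /= a1 a2|split => //=; exact: ltW].
have cyl0 a : cyl a (a, x0).
  split=> /=; first by rewrite in_itv /=; apply/andP; split; lra.
  by split => //=; rewrite x0x0 ltW.
have cylo0 a : cylo a (a, x0).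
  split=> /=; first by rewrite in_itv /=; apply/andP; split; lra.
  by rewrite /Bo /= x0x0.
have Qopen0 : Qopen T Omega `<=` Q0 T Omega.
  move=> X [/= + cX]; rewrite in_itv /= => /andP[h1 h2].
  by split=> //=; rewrite in_itv /= (ltW h1).
have D1Q : cyl t0 `<=` Qopen T Omega by move=> X /(cylT _ _ rt0 rtT)[].
have D2Q : cyl s0 `<=` Qopen T Omega by move=> X /(cylT _ _ rs0 rsT)[].
have uu : usc_on (cyl t0) u.
  by apply: usc_on_sub (usc_within_on _ _ u_usc) => X /D1Q/Qopen0.
have uv : usc_on (cyl s0) (fun X => - v X).
  by apply: usc_on_sub (lsc_within_on _ _ v_lsc) => X /D2Q/Qopen0.
pose Z2 : set (ST * ST) := (cyl t0 `*` cyl s0) `&`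
  [set Z | rho Z.1.2 - rho Z.2.2 = 0].
have cr : continuous rho by move=> x; exact: C1_on_continuous C1r Logic.I.
have cx : continuous (fun X : ST => X.2) by move=> X; exact: cvg_snd.
have ct : continuous (fun X : ST => X.1) by move=> X; exact: cvg_fst.
have cZ2 : compact Z2.
  apply: compact_closedI; first exact: compact_setX.
  apply: (@closed_comp _ _ (fun Z : ST * ST => rho Z.1.2 - rho Z.2.2) [set s | s = 0]);
    last exact: closed_eq.
  have crx := continuous_snd (S := R) _ cr.
  move=> Z _; apply: (@cvgB _ _ _ (nbhs Z)).
    exact: (continuous_fst _ crx Z).
  exact: (continuous_snd _ crx Z).
(* The squares around t0, s0 and x0 make the base point the only maximum on g = 0. They are grouped
   with the barriers so that semicontinuity follows from [usc_on_minus_C1]. *)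
pose f (Z : ST * ST) :=
  (u Z.1 - (time_test T eta t0 t0 0 0 0 Z.1.1 + dotp (Z.1.2 - x0) (Z.1.2 - x0)))
  + (- v Z.2 - (time_test T eta s0 s0 0 0 0 Z.2.1 + 0))
  + - (N * ((Z.1.1 - Z.2.1) * (Z.1.1 - Z.2.1))).
have fE (X Y : ST) : f (X, Y) = u X - v Y - barrier T eta X.1 - barrier T eta Y.1
    - N * (X.1 - Y.1) ^+ 2
    - ((X.1 - t0) ^+ 2 + (Y.1 - s0) ^+ 2 + dotp (X.2 - x0) (X.2 - x0)).
  by rewrite /f /time_test /=; ring.
have uf : usc_on Z2 f.
  have DT a X : 0 < a - r -> a + r < T'' -> cyl a X -> X.1 < T.
    by move=> ar aT /(cylT _ _ ar aT)[_ h _ _]; exact: lt_le_trans h T''T.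
  apply: (@usc_on_sub _ _ (cyl t0 `*` cyl s0)); first by move=> Z [].
  apply: usc_onD; first apply: usc_onD.
  - apply: (usc_on_fst _ _
      (fun X => u X - (time_test T eta t0 t0 0 0 0 X.1 + dotp (X.2 - x0) (X.2 - x0)))).
    apply: (usc_on_minus_C1 T _ u (time_test T eta t0 t0 0 0 0)
       (fun x => dotp (x - x0) (x - x0))) => //.
    + by move=> X; exact: DT.
    + exact: C1_on_time_test.
    + exact: C1_on_sqdist.
  - apply: (usc_on_snd _ _
      (fun X => - v X - (time_test T eta s0 s0 0 0 0 X.1 + 0))).
    apply: (usc_on_minus_C1 T _ (fun X => - v X) (time_test T eta s0 s0 0 0 0)
       (fun=> 0)) => //.
    + by move=> X; exact: DT.
    + exact: C1_on_time_test.
    + exact: C1_on_cst.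
  apply: continuous_usc_on.
  have cts : continuous (fun Z : ST * ST => Z.1.1 - Z.2.1).
    move=> Z; apply: (@cvgB _ _ _ (nbhs Z)).
      exact: (continuous_fst _ ct Z).
    exact: (continuous_snd _ ct Z).
  move=> Z; apply: (@cvgN _ _ _ (nbhs Z)).
  by apply: (@cvgM _ _ (nbhs Z)); [exact: cvg_cst|exact: (cvgM (cts Z) (cts Z))].
pose g (Z : ST * ST) := dotp (Z.1.2 - Z.2.2) (Z.1.2 - Z.2.2).
have cg : continuous g.
  move=> Z; have cxx : {for Z, continuous (fun Z : ST * ST => Z.1.2 - Z.2.2)}.
    apply: (@cvgB _ _ _ (nbhs Z)).
      exact: (continuous_fst _ cx Z).
    exact: (continuous_snd _ cx Z).
  exact: (continuous_dotp _ _ _ cxx cxx).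
have g0 Z : Z2 Z -> 0 <= g Z by move=> _; exact: dotp_ge0.
pose M := f ((t0, x0), (s0, x0)).
have ME : M = u (t0, x0) - v (s0, x0) - barrier T eta t0 - barrier T eta s0
     - N * (t0 - s0) ^+ 2.
  by rewrite /M fE /= x0x0; ring.
have fM Z : Z2 Z -> g Z = 0 -> f Z <= M - ((Z.1.1 - t0) ^+ 2 + (Z.2.1 - s0) ^+ 2
    + dotp (Z.1.2 - x0) (Z.1.2 - x0)).
  move: Z => [[t x] [s y]] [[/= Xt Ys] _] /eqP; rewrite dotp_eq0 subr_eq0 /=.
  move=> /eqP xy; subst y.
  have [/= h1 h2 h3 _] := cylT _ _ rt0 rtT Xt.
  have [/= h4 h5 _ _] := cylT _ _ rs0 rsT Ys.
  have ht : 0 < t < T'' by rewrite h1 h2.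
  have hs : 0 < s < T'' by rewrite h4 h5.
  by have := hmax t s x ht hs h3; rewrite ME fE /=; lra.
have fM' Z : Z2 Z -> g Z = 0 -> f Z <= M.
  move=> ZZ gZ; apply: le_trans (fM _ ZZ gZ) _; rewrite lerBlDr lerDl.
  by rewrite !addr_ge0 ?sqr_ge0 ?dotp_ge0.
(* Within c / 2 of t0 and s0, the derivatives of the localising squares are at least - c. *)
pose V' := V `&` [set Z : ST * ST | [/\ cylo t0 Z.1, cylo s0 Z.2,
  `|Z.1.1 - t0| <= c / 2 & `|Z.2.1 - s0| <= c / 2]].
have nV' : nbhs ((t0, x0), (s0, x0)) V'.
  have c2 : 0 < c / 2 by rewrite divr_gt0.
  have nt (a : R) := near_fst a x0 _ (near_dist_le a (c / 2) c2).
  have n1 : nbhs (t0, x0) (cylo t0) by exact: open_nbhs_nbhs.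
  have n2 : nbhs (s0, x0) (cylo s0) by exact: open_nbhs_nbhs.
  have n3 := near_fst (t0, x0) (s0, x0) _ n1.
  have n4 := near_snd (t0, x0) (s0, x0) _ n2.
  have n5 := near_fst (t0, x0) (s0, x0) _ (nt t0).
  have n6 := near_snd (t0, x0) (s0, x0) _ (nt s0).
  by near=> Z; split; [near: Z|split; near: Z].
have fV Z : Z2 Z -> g Z = 0 -> f Z = M -> nbhs Z V'.
  move=> ZZ gZ fZ; have := fM _ ZZ gZ; rewrite fZ.
  have q1 := sqr_ge0 (Z.1.1 - t0); have q2 := sqr_ge0 (Z.2.1 - s0).
  have q3 := dotp_ge0 (Z.1.2 - x0) => hh.
  have /eqP e1' : (Z.1.1 - t0) ^+ 2 = 0 by lra.
  have /eqP e2' : (Z.2.1 - s0) ^+ 2 = 0 by lra.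
  have /eqP e3' : dotp (Z.1.2 - x0) (Z.1.2 - x0) = 0 by lra.
  have /eqP e4' := gZ; rewrite dotp_eq0 subr_eq0 in e4'.
  rewrite sqrf_eq0 subr_eq0 in e1'; rewrite sqrf_eq0 subr_eq0 in e2'.
  rewrite dotp_eq0 subr_eq0 in e3'.
  move: Z {ZZ gZ fZ q1 q2 q3 hh} e1' e2' e3' e4' => [[t x] [s y]] /=.
  by move=> /eqP -> /eqP -> /eqP -> /eqP <-.
have [K K0 HK] := penalization Z2 f g M V' 1 cZ2 uf cg g0 fM' fV ltr01.
have Z20 : Z2 ((t0, x0), (s0, x0)) by split; [split; exact: cyl0|rewrite /= subrr].
have ufK : usc_on Z2 (fun Z => f Z + - (K * g Z)).
  apply: usc_onD => //; apply: continuous_usc_on => Z.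
  by apply: (@cvgN _ _ _ (nbhs Z)); apply: (@cvgM _ _ (nbhs Z));
    [exact: cvg_cst|exact: cg].
have [|[P Q] [[/= DP DQ] /eqP]] := usc_on_max Z2 _ cZ2 _ ufK.
  by exists ((t0, x0), (s0, x0)).
rewrite subr_eq0 => /eqP rPQ maxPQ.
have Z2PQ : Z2 (P, Q) by split; [split|rewrite /= rPQ subrr].
have MPQ : M <= f (P, Q) - K * g (P, Q).
  by have := maxPQ _ Z20; rewrite {1}/g /= subrr [dotp 0 0]big1 => [|i _];
    rewrite ?mxE ?mul0r // mulr0 subr0.
have [[VPQ [/= OP OQ Pt Qs]] _] := HK _ Z2PQ MPQ.
have [Pt0 PtT cP QP] := cylT _ _ rt0 rtT DP.
have [Qs0 QsT cQ QQ] := cylT _ _ rs0 rsT DQ.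
have PT : P.1 < T by exact: lt_le_trans PtT T''T.
have QT : Q.1 < T by exact: lt_le_trans QsT T''T.
clear HK Z20 ufK fV nV' fM' fM g0 cg uf cZ2 ct cx cr He1 ngr nV.
pose tau := P.1 - Q.1; pose xi := P.2 - Q.2.
(* The linear parts come from expanding the penalties at (P, Q). The coefficients exceed by 1 the 2
   N and 2 K of the parallelogram inequality, and this surplus gives [strict]. *)
pose g1 := time_test T eta t0 P.1 (2 * N * tau) (2 * N + 1)
  (u P - barrier T eta P.1 - (P.1 - t0) ^+ 2 - dotp (P.2 - x0) (P.2 - x0)).
pose g2 := time_test T eta s0 Q.1 (- (2 * N * tau)) (2 * N + 1)
  (- v Q - barrier T eta Q.1 - (Q.1 - s0) ^+ 2).
pose h1 := space_test x0 P.2 (2 * K *: xi) 1 (2 * K + 1).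
pose h2 := space_test x0 Q.2 (- (2 * K *: xi)) 0 (2 * K + 1).
have dotp0 (x : space) : dotp x 0 = 0.
  by rewrite /dotp big1 // => i _; rewrite mxE mulr0.
have S1 : touching_side T Omega H F u g1 h1 (cyl t0) (cylo t0) P.
  split => //.
  - exact: (H_i_joint_lsc _ _ _ Hi).1.
  - exact: C1_on_time_test.
  - exact: C1_on_space_test.
  - by rewrite /g1 /h1 /time_test /space_test !subrr !dotp0; ring.
have S2 : touching_side T Omega (opp_operator H) (opp_operator F) (fun X => - v X)
    g2 h2 (cyl s0) (cylo s0) Q.
  split => //.
  - exact: viscosity_reflect.
  - exact: (H_i_joint_lsc _ _ _ Hi).2.
  - exact: C1_on_time_test.
  - exact: C1_on_space_test.
  - by rewrite /g2 /h2 /time_test /space_test !subrr !dotp0; ring.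
have key X Y : cyl t0 X -> cyl s0 Y -> rho X.2 = rho Y.2 ->
    (u X - (g1 X.1 + h1 X.2)) + (- v Y - (g2 Y.1 + h2 Y.2)) <=
    - ((X.1 - P.1) ^+ 2 + (Y.1 - Q.1) ^+ 2)
    - (dotp (X.2 - P.2) (X.2 - P.2) + dotp (Y.2 - Q.2) (Y.2 - Q.2)).
  move=> DX DY rXY.
  have Z2XY : Z2 (X, Y) by split; [split|rewrite /= rXY subrr].
  have := maxPQ _ Z2XY; rewrite /g /= !fE => mXY.
  have := decoupling N K (X.1 - P.1) (Y.1 - Q.1) tau (X.2 - P.2) (Y.2 - Q.2) xi
    (u P - v Q - barrier T eta P.1 - barrier T eta Q.1
      - ((P.1 - t0) ^+ 2 + (Q.1 - s0) ^+ 2 + dotp (P.2 - x0) (P.2 - x0)))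
    (u X - v Y - barrier T eta X.1 - barrier T eta Y.1
      - ((X.1 - t0) ^+ 2 + (Y.1 - s0) ^+ 2 + dotp (X.2 - x0) (X.2 - x0)))
    (ltW N0) (ltW K0).
  have -> : tau + (X.1 - P.1) - (Y.1 - Q.1) = X.1 - Y.1 by rewrite /tau; ring.
  have -> : xi + (X.2 - P.2) - (Y.2 - Q.2) = X.2 - Y.2.
    by apply/rowP => i; rewrite !mxE; ring.
  rewrite -/tau -/xi in mXY; move=> dec.
  apply: (fun A B => le_trans B (dec A)); first by lra.
  rewrite le_eqVlt; apply/orP; left; apply/eqP.
  have -> : dotp (2 * K *: xi) (X.2 - P.2 - (Y.2 - Q.2)) =
      dotp (2 * K *: xi) (X.2 - P.2) - dotp (2 * K *: xi) (Y.2 - Q.2).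
    by rewrite [LHS]dotpDr dotpNr.
  rewrite /g1 /g2 /h1 /h2 /time_test /space_test.
  rewrite [dotp (- (2 * K *: xi)) _]dotpNl.
  ring.
have sum X Y : cyl t0 X -> cyl s0 Y -> rho X.2 = rho Y.2 ->
    (u X - (g1 X.1 + h1 X.2)) + (- v Y - (g2 Y.1 + h2 Y.2)) <= 0.
  move=> DX DY rXY; apply: le_trans (key _ _ DX DY rXY) _.
  rewrite -opprD oppr_le0.
  by rewrite !addr_ge0 ?sqr_ge0 ?dotp_ge0.
have strict X Y : cyl t0 X -> cyl s0 Y -> rho X.2 = rho Y.2 ->
    0 <= (u X - (g1 X.1 + h1 X.2)) + (- v Y - (g2 Y.1 + h2 Y.2)) ->
    X = P /\ Y = Q.
  move=> DX DY rXY /le_trans/(_ (key _ _ DX DY rXY)).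
  exact: separated_points.
have C1g1 : C1_on [set t | t < T] g1 by exact: C1_on_time_test.
have C1h1 : C1_on setT h1 by exact: C1_on_space_test.
have DQcl a X : 0 < a - r -> a + r < T'' -> cyl a X -> Qcl T Omega X.
  by move=> ar aT /(cylT _ _ ar aT)[_ _ _]; exact: Qopen_Qcl.
have [K1 hK1] : exists K1 : R, \forall X \near P, cyl t0 X ->
    forall q, K1 <= `|q| -> 0 < slope_op H g1 h1 rho X q.
  apply: (slope_op_coercive T Omega) => //; first by move=> X; exact: DQcl.
  by have [_ /BcU[]] := DP.
have op1 (G : ST -> space -> R) q : slope_op G g1 h1 rho P q =
    eta / (T - P.1) ^+ 2 + (2 * (P.1 - t0) + 2 * N * tau) +
    G P (2 * K *: xi + 2 *: (P.2 - x0) - q *: grad rho P.2).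
  rewrite /slope_op grad_space_test mulr1.
  have [_ ->] := is_derive_time_test T eta t0 P.1 (2 * N * tau) (2 * N + 1)
    (u P - barrier T eta P.1 - (P.1 - t0) ^+ 2 - dotp (P.2 - x0) (P.2 - x0)) P.1 PT.
  by rewrite /time_test' subrr mulr0 addr0 [2 *: _ + _]addrC.
have op2 (G : ST -> space -> R) q : slope_op (opp_operator G) g2 h2 rho Q (- q) =
    eta / (T - Q.1) ^+ 2 + (2 * (Q.1 - s0) - 2 * N * tau) -
    G Q (2 * K *: xi - q *: grad rho Q.2).
  rewrite /slope_op grad_space_test mulr0 scale0r add0r.
  have [_ ->] := is_derive_time_test T eta s0 Q.1 (- (2 * N * tau)) (2 * N + 1)
    (- v Q - barrier T eta Q.1 - (Q.1 - s0) ^+ 2) Q.1 QT.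
  rewrite /time_test' subrr mulr0 addr0 /opp_operator; congr (_ - G Q _).
  by rewrite opprB scaleNr opprK addrC.
have bP := barrier_derivative eta P.1 eta0 Pt0 PT.
have bQ := barrier_derivative eta Q.1 eta0 Qs0 QT.
rewrite -/c in bP bQ.
have Pt' : - (c / 2) <= P.1 - t0 by move: Pt; rewrite ler_norml => /andP[].
have Qs' : - (c / 2) <= Q.1 - s0 by move: Qs; rewrite ler_norml => /andP[].
have bound1 (G : ST -> space -> R) q : slope_op G g1 h1 rho P q <= 0 ->
    G P (2 * K *: xi + 2 *: (P.2 - x0) - q *: grad rho P.2) <=
    - (2 * N * (P.1 - Q.1)) - c.
  rewrite op1 -/tau; exact: slope_bound1.
have bound2 (G : ST -> space -> R) q : slope_op (opp_operator G) g2 h2 rho Q (- q) <= 0 ->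
    - (2 * N * (P.1 - Q.1)) + c <= G Q (2 * K *: xi - q *: grad rho Q.2).
  rewrite op2 -/tau; exact: slope_bound2.
have PQcl := DQcl _ _ rt0 rtT DP; have QQcl := DQcl _ _ rs0 rsT DQ.
have contra q : slope_op H g1 h1 rho P q <= 0 ->
    slope_op (opp_operator H) g2 h2 rho Q (- q) <= 0 \/
    (Qlat T Omega P /\ Qlat T Omega Q) /\ slope_op F g1 h1 rho P q <= 0 /\
      slope_op (opp_operator F) g2 h2 rho Q (- q) <= 0 -> False.
  move=> /bound1 HP; have [HQ FQ] := HV P Q VPQ PQcl QQcl rPQ (2 * K) q HP.
  case=> [/bound2|[[lP lQ] [/bound1 FP /bound2]]]; rewrite leNgt => /negP; apply.
    exact: HQ.
  exact: FQ.
have interior : Omega P.2 -> Omega Q.2 -> False.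
  move=> OmP OmQ.
  have [q [H1 H2]] := viscosity_matching_interior T Omega H F (opp_operator H)
    (opp_operator F) u (fun X => - v X) g1 g2 h1 h2 rho (cyl t0) (cyl s0) (cylo t0)
    (cylo s0) P Q K1 Omega_open S1 S2 C1r rPQ sum strict hK1 OmP OmQ.
  by apply: (contra q H1); left.
have UP : U P.2 by have [_ /BcU[]] := DP.
have UQ : U Q.2 by have [_ /BcU[]] := DQ.
case: chart => [UO|LD]; first by apply: interior; exact: UO.
(* The sign of rho decides membership in Omega and rho P = rho Q, so there is no mixed case. *)
have [OmP|nOmP] := pselect (Omega P.2).
  apply: interior => //; apply/(local_defining_inside _ _ _ _ _ LD UQ).
  by rewrite -rPQ; apply/(local_defining_inside _ _ _ _ _ LD UP).
have nOmQ : ~ Omega Q.2.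
  move=> /(local_defining_inside _ _ _ _ _ LD UQ); rewrite -rPQ.
  by move=> /(local_defining_inside _ _ _ _ _ LD UP).
have bdP : boundary Omega P.2 by apply/boundaryP.
have bdQ : boundary Omega Q.2 by apply/boundaryP.
have lP : Qlat T Omega P by split => //; case: PQcl.
have lQ : Qlat T Omega Q by split => //; case: QQcl.
have [K2 hK2] := F_iv_slope T Omega n F g1 h1 rho x0 U P Omega_open hn Fiv LD UP lP.
pose K3 := Num.max K1 K2.
have hK3 : \forall X \near P, cyl t0 X ->
    forall q, K3 <= `|q| -> 0 < slope_op H g1 h1 rho X q.
  apply: filterS hK1 => X hX DX q K3q; apply: hX => //.
  by apply: le_trans K3q; rewrite le_max lexx.
have hF3 q : q <= - K3 -> 0 < slope_op F g1 h1 rho P q.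
  by move=> qK; apply: hK2; apply: le_trans qK _; rewrite lerN2 le_max lexx orbT.
have D1U X : cyl t0 X -> U X.2 by move=> [_ /BcU[]].
have D2U X : cyl s0 X -> U X.2 by move=> [_ /BcU[]].
have cF := F_i_continuous_slope T Omega n F g1 h1 rho P Fi lP.
have [q [H1 H2]] := viscosity_matching_boundary T Omega H F (opp_operator H)
    (opp_operator F) u (fun X => - v X) g1 g2 h1 h2 rho (cyl t0) (cyl s0) (cylo t0)
    (cylo s0) P Q K3 Omega_open S1 S2 C1r rPQ sum strict hK3 x0 U LD D1U D2U
    bdP bdQ cF hF3.
by apply: (contra q H1); case: H2 => [?|?]; [left|right].
Unshelve. all: by end_near. Qed.

End Doubling.

(** * Doubling the time variable, and conclusion *)

Lemma within_continuous_usc_on {R : realType} {E : topologicalType} (A : set E)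
    (f : E -> R) : {within A, continuous f} ->
  usc_on A f /\ usc_on A (fun x => - f x).
Proof.
move=> cf; have near_f (B : set R) x : A x -> nbhs (f x) B ->
    \forall y \near x, A y -> B (f y).
  move=> Ax nB; have := cf x B nB.
  move=> nB'; have {nB'} : within A (nbhs x) (fun y => B (f y)).
    by rewrite (@nbhs_subspace_in _ A x).
  by [].
split=> x Ax c fc; first by have := near_f [set s | s < c] x Ax (lt_nbhsl fc).
have fc' : - c < f x by rewrite ltrNl.
by have := near_f [set s | - c < s] x Ax (lt_nbhsr fc'); apply: filterS => y h /h /=;
  rewrite ltrNl.
Qed.

Theorem theorem5p1 (R : realType) (d : nat) (hd : (1 <= d)%N)
  (Omega : set 'rV[R]_d) (Omega_open : open Omega)
  (Omega_bounded : bounded_set Omega) (Omega_C1 : C1_boundary Omega)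
  (n : 'rV[R]_d -> 'rV[R]_d)
  (hn : forall x, boundary Omega x -> outward_unit_normal Omega x (n x))
  (T : R) (hT : 0 < T)
  (omega : R -> R) (homega : modulus omega)
  (omegaL : R -> R -> R) (homegaL : forall L : R, 0 < L -> modulus (omegaL L))
  (H F : R * 'rV[R]_d -> 'rV[R]_d -> R)
  (Hi : H_i T Omega H) (Hii : H_ii T Omega omegaL H)
  (Hiii : H_iii T Omega omega H) (Hiv : H_iv T Omega H)
  (Fi : F_i T Omega n F) (Fii : F_ii T Omega omegaL F)
  (Fiii : F_iii T Omega omega H F) (Fiv : F_iv T Omega n F)
  (u0 : 'rV[R]_d -> R) (hu0 : {within closure Omega, continuous u0})
  (u v : R * 'rV[R]_d -> R)
  (u_usc : usc_within (Q0 T Omega) u) (v_lsc : lsc_within (Q0 T Omega) v)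
  (u_sub : viscosity_subsolution T Omega H (minH F H) u)
  (v_super : viscosity_supersolution T Omega H (maxH F H) v)
  (hC : exists C_T : R, 0 < C_T /\
     forall (t : R) (x : 'rV[R]_d), Q0 T Omega (t, x) ->
       u (t, x) <= u0 x + C_T /\ u0 x - C_T <= v (t, x))
  (hinit : forall x, closure Omega x -> u (0, x) <= u0 x /\ u0 x <= v (0, x)) :
  forall (t : R) (x : 'rV[R]_d), Q0 T Omega (t, x) -> u (t, x) <= v (t, x).
Proof.
move=> t1 x1 Q1; rewrite leNgt; apply/negP => vu.
have [CT [CT0 hCT]] := hC.
have cO := compact_closure _ Omega_bounded.
have [uu0 uu0'] := within_continuous_usc_on _ _ hu0.
have [C1 hC1] := usc_on_bounded _ _ cO uu0.
have [C2 hC2] := usc_on_bounded _ _ cO uu0'.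
have [C0 C00 hC0] : exists2 C0, 0 < C0 & forall t s x, Q0 T Omega (t, x) ->
    Q0 T Omega (s, x) -> u (t, x) - v (s, x) <= C0.
  exists (`|C1| + `|C2| + 2 * CT).
    by rewrite ltr_wpDl ?addr_ge0 ?mulr_gt0.
  move=> t s x Qt Qs; have [h1 _] := hCT _ _ Qt; have [_ h2] := hCT _ _ Qs.
  have [_ /= cx] := Qt; have := hC1 _ cx; have := hC2 _ cx.
  have := ler_norm C1; have := ler_norm C2; lra.
have [/= + cx1] := Q1; rewrite in_itv /= => /andP[t10 t1T].
pose th := u (t1, x1) - v (t1, x1).
have th0 : 0 < th by rewrite subr_gt0.
have thC : th <= C0 by exact: hC0.
have Tt1 : 0 < T - t1 by rewrite subr_gt0.
(* The two barriers at t1 remove only th / 4 from the value th, and th <= C0 gives the last bound,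
   which places T'' after t1. *)
have [eta [eta0 bt1 etaC]] : exists eta, [/\ 0 < eta,
    barrier T eta t1 = th / 8 & eta / (2 * C0) < T - t1].
  exists (th * (T - t1) / 8); split.
  - by rewrite divr_gt0 // mulr_gt0.
  - by rewrite /barrier mulrAC mulfK ?gt_eqF.
  - rewrite ltr_pdivrMr ?mulr_gt0 //.
    have : th * (T - t1) <= C0 * (T - t1) by rewrite ler_pM2r.
    have : 0 < C0 * (T - t1) by rewrite mulr_gt0.
    lra.
(* At T'' the two barriers amount to 4 C0, more than u - v can reach. The interval [0, T''] gives
   compactness, u and v being controlled on [0, T) only. *)
have [T'' [T''T t1T'' bT'']] : exists T'', [/\ T'' < T, t1 < T'' &
    barrier T eta T'' = 2 * C0].
  exists (T - eta / (2 * C0)); split.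
  - by rewrite ltrBlDr ltrDl divr_gt0 // mulr_gt0.
  - by rewrite ltrBrDl -ltrBrDr.
  - by rewrite /barrier subKr invf_div mulrCA divff ?mulr1 // gt_eqF.
have bar0 t : t < T -> 0 <= barrier T eta t.
  by move=> tT; rewrite divr_ge0 ?subr_ge0 ?ltW.
have T''0 : 0 < T'' by lra.
pose c := eta / (2 * T ^+ 2).
have c0 : 0 < c by rewrite divr_gt0 // mulr_gt0 // exprn_gt0.
have [sg sg0 hsg] := modulus_small _ _ homega c0.
pose cyl : set (R * 'rV[R]_d) := `[0, T'']%classic `*` closure Omega.
have cylQ : cyl `<=` Q0 T Omega.
  move=> X [/= + cX]; rewrite in_itv /= => /andP[h1 h2].
  by split=> //=; rewrite in_itv /= h1 (le_lt_trans h2).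
have cylT X : cyl X -> X.1 < T.
  by move=> /cylQ[/= + _]; rewrite in_itv /= => /andP[].
have ccyl : compact cyl by apply: compact_setX => //; exact: segment_compact.
have cx : continuous (fun X : R * 'rV[R]_d => X.2) by move=> X; exact: cvg_snd.
have ct : continuous (fun X : R * 'rV[R]_d => X.1) by move=> X; exact: cvg_fst.
pose Z1 := (cyl `*` cyl) `&` [set Z | dotp (Z.1.2 - Z.2.2) (Z.1.2 - Z.2.2) = 0].
have Z1E X Y : Z1 (X, Y) -> [/\ cyl X, cyl Y & X.2 = Y.2].
  by move=> [[/= cX cY] /eqP]; rewrite dotp_eq0 subr_eq0 => /eqP.
have diagZ t s x : cyl (t, x) -> cyl (s, x) -> Z1 ((t, x), (s, x)).
  by move=> ctx csx; split=> //=; rewrite subrr /dotp big1 // => i _; rewrite mxE mul0r.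
have cZ1 : compact Z1.
  apply: compact_closedI; first exact: compact_setX.
  apply: (@closed_comp _ _ (fun Z : (R * 'rV[R]_d) * (R * 'rV[R]_d) =>
    dotp (Z.1.2 - Z.2.2) (Z.1.2 - Z.2.2)) [set s | s = 0]); last exact: closed_eq.
  move=> Z _; have cxx : {for Z, continuous
      (fun Z : (R * 'rV[R]_d) * (R * 'rV[R]_d) => Z.1.2 - Z.2.2)}.
    apply: (@cvgB _ _ _ (nbhs Z)).
      exact: (continuous_fst _ cx Z).
    exact: (continuous_snd _ cx Z).
  exact: (continuous_dotp _ _ _ cxx cxx).
(* With these parameters the two squares cancel and the bare barrier remains, so the regularity
   lemma of [time_test] covers it. *)
pose be := time_test T eta 0 0 0 (- 1) 0.
have beE t : be t = barrier T eta t by rewrite /be /time_test; ring.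
pose f (Z : (R * 'rV[R]_d) * (R * 'rV[R]_d)) :=
  (u Z.1 - (be Z.1.1 + 0)) + (- v Z.2 - (be Z.2.1 + 0)).
have fE X Y : f (X, Y) = u X - v Y - barrier T eta X.1 - barrier T eta Y.1.
  by rewrite /f /= !beE; ring.
have uf : usc_on Z1 f.
  apply: (@usc_on_sub _ _ (cyl `*` cyl)); first by move=> Z [].
  apply: usc_onD.
  - apply: (usc_on_fst _ _ (fun X => u X - (be X.1 + 0))).
    apply: (usc_on_minus_C1 T _ u be (fun=> 0)) => //.
    + exact: usc_on_sub (usc_within_on _ _ u_usc).
    + exact: C1_on_time_test.
    + exact: C1_on_cst.
  - apply: (usc_on_snd _ _ (fun X => - v X - (be X.1 + 0))).
    apply: (usc_on_minus_C1 T _ (fun X => - v X) be (fun=> 0)) => //.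
    + exact: usc_on_sub (lsc_within_on _ _ v_lsc).
    + exact: C1_on_time_test.
    + exact: C1_on_cst.
pose g (Z : (R * 'rV[R]_d) * (R * 'rV[R]_d)) := (Z.1.1 - Z.2.1) * (Z.1.1 - Z.2.1).
have cts : continuous (fun Z : (R * 'rV[R]_d) * (R * 'rV[R]_d) => Z.1.1 - Z.2.1).
  move=> Z; apply: (@cvgB _ _ _ (nbhs Z)).
    exact: (continuous_fst _ ct Z).
  exact: (continuous_snd _ ct Z).
have cg : continuous g by move=> Z; exact: (cvgM (cts Z) (cts Z)).
have g0 Z : Z1 Z -> 0 <= g Z by move=> _; exact: sqr_ge0.
have cyl1 : cyl (t1, x1) by split=> //=; rewrite in_itv /= t10 ltW.
have cZg : compact (Z1 `&` [set Z | g Z = 0]).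
  apply: compact_closedI => //.
  by apply: (@closed_comp _ _ g [set s | s = 0]) => [Z _|]; [exact: cg|exact: closed_eq].
(* The reference value of the time penalisation is the maximum over equal times; it is positive by
   the value at (t1, x1). *)
have [||zs [Zzs gzs] maxzs] := usc_on_max _ f cZg.
- by exists ((t1, x1), (t1, x1)); split; [exact: diagZ|rewrite /= /g subrr mul0r].
- by apply: usc_on_sub uf => Z [].
pose M := f zs.
have M0 : 0 < M.
  apply: lt_le_trans (maxzs ((t1, x1), (t1, x1)) _).
    by rewrite fE /= bt1 -/th; lra.
  by split; [exact: diagZ|rewrite /= /g subrr mul0r].
pose V := [set Z : (R * 'rV[R]_d) * (R * 'rV[R]_d) | [/\ 0 < Z.1.1 < T'',
  0 < Z.2.1 < T'' & `|Z.1.1 - Z.2.1| < sg / 6]].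
have fM Z : Z1 Z -> g Z = 0 -> f Z <= M by move=> ZZ gZ; exact: maxzs.
(* At time 0 the initial ordering would give M <= 0, and at T'' the barriers would; so maximisers
   with equal times are interior in time. *)
have fV Z : Z1 Z -> g Z = 0 -> f Z = M -> nbhs Z V.
  move: Z => [[t x] [s y]] ZZ /eqP; have [cX cY /= xy] := Z1E _ _ ZZ; subst y.
  rewrite mulf_eq0 orbb /= subr_eq0 => /eqP ts; subst s; rewrite fE /= => fMt.
  have Qt := cylQ _ cX; have [/= + cxx] := cX; rewrite in_itv /= => /andP[h1 h2].
  have bt := bar0 _ (cylT _ cX).
  have tp : 0 < t.
    rewrite lt_def h1 andbT; apply/eqP => tz; subst t.
    have [a1 a2] := hinit x cxx; move: fMt M0 bt => /=; lra.
  have tT : t < T''.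
    rewrite lt_def h2 andbT; apply/eqP => tz; subst t.
    have := hC0 _ _ _ Qt Qt; move: fMt M0 => /=; rewrite bT''; lra.
  have n1 : \forall t' \near t, 0 < t' < T''.
    near=> t'; apply/andP; split; near: t'.
      exact: lt_nbhsr.
    exact: lt_nbhsl.
  have m1 := near_fst (t, x) (t, x) _ (near_fst t x _ n1).
  have m2 := near_snd (t, x) (t, x) _ (near_fst t x _ n1).
  have z6 : `|t - t| < sg / 6 by rewrite subrr normr0 divr_gt0.
  have cn : {for ((t, x), (t, x)), continuous
      (fun Z : (R * 'rV[R]_d) * (R * 'rV[R]_d) => `|Z.1.1 - Z.2.1|)}.
    by apply: (@cvg_norm _ _ _ (nbhs ((t, x), (t, x)))); exact: cts.
  have m3 : \forall Z \near ((t, x), (t, x)), `|Z.1.1 - Z.2.1| < sg / 6.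
    by have /cvgr_lt/(_ _ z6) := cn.
  by near=> Z; split; near: Z.
have e0 : 0 < sg / 6 by rewrite divr_gt0.
have [N N0 hN] := penalization Z1 f g M V (sg / 6) cZ1 uf cg g0 fM fV e0.
have ufN : usc_on Z1 (fun Z => f Z + - (N * g Z)).
  apply: usc_onD => //; apply: continuous_usc_on => Z.
  by apply: (@cvgN _ _ _ (nbhs Z)); apply: (@cvgM _ _ (nbhs Z));
    [exact: cvg_cst|exact: cg].
have [|Z0 ZZ0 maxZ0] := usc_on_max Z1 _ cZ1 _ ufN; first by exists zs.
have MZ0 : M <= f Z0 - N * g Z0.
  by have := maxZ0 _ Zzs; rewrite gzs mulr0 subr0.
have [VZ0 NgZ0] := hN _ ZZ0 MZ0.
move: Z0 ZZ0 maxZ0 MZ0 VZ0 NgZ0 => [[t0 x0] [s0 y0]] ZZ0 maxZ0 MZ0 [/= ht0 hs0 ts0] NgZ0.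
have [cX cY /= xy] := Z1E _ _ ZZ0; subst y0.
(* Both |t0 - s0| and N |t0 - s0|^2 are at most sg / 6, so the left side is at most sg / 2. *)
have tssg : `|t0 - s0| * (1 + 2 * N * `|t0 - s0|) < sg.
  move: NgZ0; rewrite /g /= -expr2 -real_normK ?num_real //; lra.
have [_ /= cx0] := cX.
apply: (doubled_maximum_absurd Omega n T omega omegaL H F u v hd Omega_open
  Omega_bounded Omega_C1 hn hT homegaL Hi Hii Hiii Hiv Fi Fii Fiii Fiv u_usc
  v_lsc u_sub v_super T'' eta N sg t0 s0 x0 (ltW T''T) eta0 N0 hsg tssg cx0
  ht0 hs0).
move=> t s x /andP[ta tb] /andP[sa sb] cxx.
have cyt : cyl (t, x) by split=> //=; rewrite in_itv /= !ltW.
have cys : cyl (s, x) by split=> //=; rewrite in_itv /= !ltW.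
by have := maxZ0 _ (diagZ _ _ _ cyt cys); rewrite !fE /g /= !expr2.
Unshelve. all: by end_near. Qed.
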